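(* Let $1\le r\le p$, $U\in\mathrm{St}(r,p)$, $B\in\mathbb{S}_+(r)$, $X=UBU^\top$, and suppose the weights $V_B,W_B$ in the metric $\bar g^{r+}_{(U,B)}$ satisfy $V_B=OV_{O^\top BO}O^\top$ and $W_B=OW_{O^\top BO}O^\top$ for all $B\in\mathbb{S}_+(r)$, $O\in\mathbb{O}_r$. Write $\overline{\operatorname{grad}h_{r+}([U,B])}=[\overline{\operatorname{grad}_Uh_{r+}([U,B])}^\top\ \ \overline{\operatorname{grad}_Bh_{r+}([U,B])}^\top]^\top$ for the $U$- and $B$-components. Then $$\operatorname{grad}f(X)=\tfrac12\,\overline{\operatorname{grad}_Uh_{r+}([U,B])}V_BB^{-1}U^\top+\tfrac12\big(\overline{\operatorname{grad}_Uh_{r+}([U,B])}V_BB^{-1}U^\top\big)^\top+UW_B\overline{\operatorname{grad}_Bh_{r+}([U,B])}W_BU^\top,$$ $$\overline{\operatorname{grad}h_{r+}([U,B])}=\begin{bmatrix}2P_{U_\perp}\operatorname{grad}f(X)UBV_B^{-1}\\ W_B^{-1}U^\top\operatorname{grad}f(X)UW_B^{-1}\end{bmatrix}.$$ Furthermore, if $[U,B]$ is a Riemannian first-order stationary point of $h_{r+}$ on $\mathcal{M}^{q_2}_{r+}$, then $$\overline{\operatorname{Hess}h_{r+}([U,B])}[\theta_{(U,B)},\theta_{(U,B)}]=\operatorname{Hess}f(X)\big[\mathcal{L}^{r+}_{U,B}(\theta_{(U,B)}),\mathcal{L}^{r+}_{U,B}(\theta_{(U,B)})\big]\qquad\forall\,\theta_{(U,B)}\in\mathcal{H}_{(U,B)}\overline{\mathcal{M}}^{q_2}_{r+}.$$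 Finally (at such a point), $\overline{\operatorname{Hess}h_{r+}([U,B])}$ has $pr-(r^2-r)/2$ eigenvalues, and for $i=1,\dots,pr-(r^2-r)/2$, $\lambda_i(\overline{\operatorname{Hess}h_{r+}([U,B])})$ is sandwiched between $$\big(\sigma_r^2(W_B^{-1})\wedge2\sigma_r^2(V_B^{-1/2}B)\big)\lambda_i(\operatorname{Hess}f(X))\quad\text{and}\quad\big(\sigma_1^2(W_B^{-1})\vee2\sigma_1^2(V_B^{-1/2}B)\big)\lambda_i(\operatorname{Hess}f(X)).$$
   Context: Notation: $\mathrm{St}(r,p)$ = $p\times r$ matrices with orthonormal columns; $\mathbb{O}_r$ = $r\times r$ orthogonal matrices; $\mathbb{S}^{r\times r}$, $\mathbb{S}_+(r)$ = symmetric, resp. symmetric positive definite, $r\times r$ matrices; $U_\perp$ = orthonormal complement of $U$, $P_{U_\perp}=U_\perp U_\perp^\top$; $\sigma_i,\lambda_i$ = $i$-th largest singular value/eigenvalue; $a\wedge b=\min$, $a\vee b=\max$. ''$a$ is sandwiched between $b$ and $c$'' means $\min\{b,c\}\le a\le\max\{b,c\}$. Objective: $f:\mathbb{R}^{p\times p}\to\mathbb{R}$ is twice continuously differentiable with $f(X)=f(X^\top)$. Embedded geometry: $\mathcal{M}^e_{r+}=\{X\in\mathbb{S}^{p\times p}:\operatorname{rank}X=r,\ X\succeq0\}$, an embedded submanifold of $\mathbb{R}^{p\times p}$ of dimension $pr-(r^2-r)/2$ with the metric induced by the Euclidean inner product. $\operatorname{grad}f(X)$, $\operatorname{Hess}f(X)$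 are the Riemannian gradient and Hessian of $f|_{\mathcal{M}^e_{r+}}$. Quotient geometry $\mathcal{M}^{q_2}_{r+}$: total space $\overline{\mathcal{M}}^{q_2}_{r+}=\mathrm{St}(r,p)\times\mathbb{S}_+(r)$, equivalence classes $[U,B]=\{(UO,O^\top BO):O\in\mathbb{O}_r\}$, $\mathcal{M}^{q_2}_{r+}=\overline{\mathcal{M}}^{q_2}_{r+}/\mathbb{O}_r$ with quotient map $\pi$. Tangent vectors are written $\theta_{(U,B)}=[\theta_U^\top\ \ \theta_B^\top]^\top$. The total space carries the Riemannian metric $\bar g^{r+}_{(U,B)}(\eta,\theta)=\operatorname{tr}(V_B\eta_U^\top\theta_U)+\operatorname{tr}(W_B\eta_BW_B\theta_B)$, where $V_B,W_B\in\mathbb{S}_+(r)$ depend smoothly on $B$. The chosen horizontal space (complementary, but not necessarily orthogonal, to the tangent space of the fiber) is $$\mathcal{H}_{(U,B)}\overline{\mathcal{M}}^{q_2}_{r+}=\{[\theta_U^\top\ \ \theta_B^\top]^\top:\theta_U=U_\perp D,\ D\in\mathbb{R}^{(p-r)\times r},\ \theta_B\in\mathbb{S}^{r\times r}\}.$$ The horizontal lift at $(U,B)$ of a tangent vector $\theta_{[U,B]}$ is the unique horizontal $\theta_{(U,B)}$ with $\mathrm{D}\pi(U,B)[\theta_{(U,B)}]=\theta_{[U,B]}$; the metric on the quotient is $g^{r+}_{[U,B]}(\eta_{[U,B]},\theta_{[U,B]})=\bar g^{r+}_{(U,B)}(\eta_{(U,B)},\theta_{(U,B)})$. $h_{r+}([U,B])=f(UBU^\top)$.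 $\overline{\operatorname{grad}h_{r+}([U,B])}$ is the horizontal lift of the Riemannian gradient, and $\overline{\operatorname{Hess}h_{r+}([U,B])}[\theta_{(U,B)},\eta_{(U,B)}]=\operatorname{Hess}h_{r+}([U,B])[\theta_{[U,B]},\eta_{[U,B]}]$ is the bilinear form of the Riemannian Hessian, on the horizontal space; its eigenvalues are those of the corresponding self-adjoint operator on the horizontal space with inner product $\bar g^{r+}_{(U,B)}$. A Riemannian first-order stationary point is a point where the Riemannian gradient vanishes. The map $\mathcal{L}^{r+}_{U,B}:\mathcal{H}_{(U,B)}\overline{\mathcal{M}}^{q_2}_{r+}\to T_X\mathcal{M}^e_{r+}$ is $\mathcal{L}^{r+}_{U,B}(\theta_{(U,B)})=UB\theta_U^\top+U\theta_BU^\top+\theta_UBU^\top$. *)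

(* Defs.v *)
From HB Require Import structures.
From mathcomp Require Export all_boot all_order all_algebra.
From mathcomp Require Export all_classical all_reals all_analysis.

Set Implicit Arguments.
Unset Strict Implicit.
Unset Printing Implicit Defensive.

Export Order.TTheory GRing.Theory Num.Theory.
Export numFieldNormedType.Exports.

Global Open Scope classical_set_scope.
Global Open Scope ring_scope.

Section Smoothness.
Variable R : realType.

(* To be used with [A] open.  In finite dimension, being C^(k+1) amounts to
   being differentiable with all directional derivatives of class C^k. *)
Fixpoint Ck (k : nat) (V W : normedModType R) (A : set V) (f : V -> W) : Prop :=
  if k is k'.+1 then
    (forall x, A x -> differentiable f x) /\
    (forall v, Ck k' A (fun x => 'D_v f x))
  else forall x, A x -> f y @[y --> x] --> f x.

Definition smooth_on (V W : normedModType R) (A : set V) (f : V -> W) : Prop :=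
  forall k, Ck k A f.

(* Velocities at x of the smooth curves through x that stay in M: the tangent
   space at x when M is an embedded submanifold of V. *)
Definition tangent_space (V : normedModType R) (M : set V) (x : V) : set V :=
  [set v | exists (c : R -> V) (I : set R),
    [/\ open I /\ I 0, smooth_on I c, forall t, I t -> M (c t), c 0 = x
      & 'D_1 c 0 = v]].

End Smoothness.

(* Levi-Civita calculus of a metric g on an open subset of R^d. *)
Section LocalCoordinates.
Variables (R : realType) (d : nat) (g : 'rV[R]_d -> 'M[R]_d).

Definition partial (i : 'I_d) (F : 'rV[R]_d -> R) (y : 'rV[R]_d) : R :=
  'D_(delta_mx 0 i) F y.

Definition christoffel (y : 'rV[R]_d) (k i j : 'I_d) : R :=
  2^-1 * \sum_l invmx (g y) k l *
    (partial i (fun z => g z j l) y + partial j (fun z => g z i l) y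
     - partial l (fun z => g z i j) y).

Definition coord_grad (F : 'rV[R]_d -> R) (y : 'rV[R]_d) : 'rV[R]_d :=
  \row_k \sum_l invmx (g y) k l * partial l F y.

Definition covariant_derivative (v : 'rV[R]_d) (Y : 'rV[R]_d -> 'rV[R]_d)
    (y : 'rV[R]_d) : 'rV[R]_d :=
  \row_k ('D_v (fun z => Y z 0 k) y
          + \sum_i \sum_j christoffel y k i j * v 0 i * Y y 0 j).

End LocalCoordinates.

(* A Riemannian manifold whose points are represented by the elements of an
   embedded submanifold [carrier] of V.  Tangent vectors at the point
   represented by x are represented by the elements of [tspace x], and [tproj x]
   sends a velocity at x of a curve in [carrier] to the representative of the
   tangent vector it induces.
   - Embedded submanifold: [tspace] is the tangent space, [tproj x] = id.
   - Quotient manifold: [carrier] is the total space, [tspace] the horizontal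
     space; theta in [tspace x] stands for the tangent vector D pi(x)[theta] of
     which it is the horizontal lift at x, so that [tproj x] is the projection
     onto the horizontal space along the tangent space of the fiber, and functions
     on the quotient are given by their composition with pi. *)
Record rmanifold (R : realType) (V : normedModType R) := RManifold {
  carrier : set V;
  tspace : V -> set V;
  tproj : V -> V -> V;
  metric : V -> V -> V -> R }.

Section RiemannianCalculus.
Variables (R : realType) (V : normedModType R) (M : rmanifold V).

Definition is_rgrad (f : V -> R) (x xi : V) : Prop :=
  tspace M x xi /\
  forall eta, tspace M x eta -> metric M x xi eta = 'D_eta f x.

Definition rgrad (f : V -> R) (x : V) : V := get [set xi | is_rgrad f x xi].

(* [s] represents a local parametrization, i.e. the inverse of a chart, centered
   at the point represented by [x].  For a quotient, the parametrization is
   pi \o s, and the last condition says that its differential at 0 is bijective. *)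
Definition parametrization (x : V) (d : nat) (s : 'rV[R]_d -> V) : Prop :=
  s 0 = x /\
  exists O : set 'rV[R]_d,
    [/\ open O /\ O 0, smooth_on O s, forall y, O y -> carrier M (s y)
      & set_bij [set: 'rV[R]_d] (tspace M x) (fun v => tproj M x ('D_v s 0))].

Definition gram (d : nat) (s : 'rV[R]_d -> V) (y : 'rV[R]_d) : 'M[R]_d :=
  \matrix_(i, j) metric M (s y) (tproj M (s y) ('D_(delta_mx 0 i) s y))
                                (tproj M (s y) ('D_(delta_mx 0 j) s y)).

(* H is the Riemannian Hessian operator xi |-> nabla_xi (grad f) at x, nabla
   being the Levi-Civita connection, which is computed in coordinates. *)
Definition is_rhess (f : V -> R) (x : V) (H : V -> V) : Prop :=
  forall (d : nat) (s : 'rV[R]_d -> V), parametrization x s ->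
  forall v : 'rV[R]_d,
    H (tproj M x ('D_v s 0)) =
    tproj M x
      ('D_(covariant_derivative (gram s) v (coord_grad (gram s) (f \o s)) 0) s 0).

Definition rhess (f : V -> R) (x : V) : V -> V := get [set H | is_rhess f x H].

Definition rhess_form (f : V -> R) (x xi eta : V) : R :=
  metric M x (rhess f x xi) eta.

End RiemannianCalculus.

Section Spectra.
Variable R : realType.

(* All eigenvalues, with multiplicity, in nonincreasing order (the i-th largest
   one has index i - 1). *)
Definition is_eigenvalues (n : nat) (A : 'M[R]_n) (s : seq R) : Prop :=
  sorted >=%R s /\ char_poly A = \prod_(l <- s) ('X - l%:P).

Definition eigenvalues (n : nat) (A : 'M[R]_n) : seq R :=
  xget [::] [set s | is_eigenvalues A s].

(* Eigenvalues of an operator T of a finite-dimensional subspace E of V, read off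
   its matrix A in a basis e of E. *)
Definition op_eigenvalues (V : lmodType R) (E : set V) (T : V -> V) : seq R :=
  xget [::] [set s | exists (n : nat) (e : 'I_n -> V) (A : 'M[R]_n),
    [/\ set_bij [set: 'rV[R]_n] E (fun c => \sum_i c 0 i *: e i),
        forall i, T (e i) = \sum_j A i j *: e j
      & is_eigenvalues A s]].

(* i-th largest singular value, i >= 1 *)
Definition sigma (m n i : nat) (A : 'M[R]_(m, n)) : R :=
  Num.sqrt (nth 0 (eigenvalues (A^T *m A)) i.-1).

End Spectra.

Definition sandwiched (R : realType) (a b c : R) : Prop :=
  Num.min b c <= a <= Num.max b c.

Section FixedRankPSD.
Variable R : realType.

Definition is_sym (n : nat) (A : 'M[R]_n) : Prop := A^T = A.

Definition psd (n : nat) (A : 'M[R]_n) : Prop :=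
  is_sym A /\ forall v : 'cV[R]_n, 0 <= (v^T *m A *m v) 0 0.

Definition spd (n : nat) (A : 'M[R]_n) : Prop :=
  is_sym A /\ forall v : 'cV[R]_n, v != 0 -> 0 < (v^T *m A *m v) 0 0.

Definition orthogonal (n : nat) (Q : 'M[R]_n) : Prop := Q^T *m Q = 1%:M.

Definition stiefel (p r : nat) (U : 'M[R]_(p, r)) : Prop := U^T *m U = 1%:M.

Definition sqrtmx (n : nat) (A : 'M[R]_n) : 'M[R]_n :=
  get [set S | spd S /\ S *m S = A].

Definition perp (p r : nat) (U : 'M[R]_(p, r)) : 'M[R]_(p, p - r) :=
  get [set Up | Up^T *m Up = 1%:M /\ U^T *m Up = 0].

Definition Pperp (p r : nat) (U : 'M[R]_(p, r)) : 'M[R]_p :=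
  perp U *m (perp U)^T.

Definition symmetrize (n : nat) (A : 'M[R]_n) : 'M[R]_n := 2^-1 *: (A + A^T).

(* S_+(r) is open in the space of symmetric matrices only, so smoothness of F
   on S_+(r) is expressed by composing with the linear projection onto that
   space. *)
Definition smooth_spd_weight (r : nat) (F : 'M[R]_r -> 'M[R]_r) : Prop :=
  (forall B, spd B -> spd (F B)) /\
  smooth_on [set A | spd (symmetrize A)] (fun A => F (symmetrize A)).

Definition embedded_psd (p r : nat) : set 'M[R]_p :=
  [set X : 'M[R]_p | psd X /\ (\rank X = r)%N].

Definition Me (p r : nat) : rmanifold 'M[R]_p := {|
  carrier := @embedded_psd p r;
  tspace := tangent_space (@embedded_psd p r);
  tproj := fun _ xi => xi;
  metric := fun _ xi eta => \tr (xi^T *m eta) |}.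

Section Quotient.
Variables (p r : nat).
Notation pt := ('M[R]_(p, r) * 'M[R]_r)%type.

Definition total_space : set pt := [set x | stiefel x.1 /\ spd x.2].

(* the equivalence class [U, B], i.e. the fiber of pi through (U, B) *)
Definition fiber (x : pt) : set pt :=
  [set y | exists2 Q : 'M[R]_r, orthogonal Q & y = (x.1 *m Q, Q^T *m x.2 *m Q)].

Definition horizontal (x : pt) : set pt :=
  [set theta | (exists D : 'M[R]_(p - r, r), theta.1 = perp x.1 *m D) /\
               is_sym theta.2].

(* the horizontal lift at x of D pi(x)[tau] *)
Definition hlift (x tau : pt) : pt :=
  get [set theta | horizontal x theta /\
                   tangent_space (fiber x) x (tau - theta)].

Definition total_metric (V W : 'M[R]_r -> 'M[R]_r) (x eta theta : pt) : R :=
  \tr (V x.2 *m eta.1^T *m theta.1) +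
  \tr (W x.2 *m eta.2 *m W x.2 *m theta.2).

Definition Mq2 (V W : 'M[R]_r -> 'M[R]_r) : rmanifold pt := {|
  carrier := total_space;
  tspace := horizontal;
  tproj := hlift;
  metric := total_metric V W |}.

(* h composed with pi *)
Definition hq (f : 'M[R]_p -> R) (x : pt) : R := f (x.1 *m x.2 *m x.1^T).

Definition Lmap (x theta : pt) : 'M[R]_p :=
  x.1 *m x.2 *m theta.1^T + x.1 *m theta.2 *m x.1^T + theta.1 *m x.2 *m x.1^T.

End Quotient.
End FixedRankPSD.

(* Main.v *)
Require Import Defs.
From mathcomp Require Import ring lra zify.

Set Implicit Arguments.
Unset Strict Implicit.
Unset Printing Implicit Defensive.

(* Let K = U_perp. The tangent space of the embedded manifold at X is the set of
   symmetric xi with K^T xi K = 0 (positive semidefiniteness makes X minimise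
   every v^T K^T Y K v), and it is the bijective image of the horizontal space
   under L, which kills the vertical vectors (U Om, B Om - Om B), Om skew. So both
   gradients are explicit projections of the Euclidean gradient.

   At a stationary point the coordinate gradient vanishes, the Christoffel terms
   drop out, and the Riemannian Hessian only depends on the second derivative of
   f o s, where s is any C^2 map into the embedded manifold with s(0) = X: a chart
   of that manifold, or a chart of the total space followed by
   (U, B) |-> U B U^T. Because the manifold is locally the graph
   K^T Y K = (K^T Y U) (U^T Y U)^-1 (U^T Y K), the normal part of the second
   derivative of s is a function of the first derivatives, so f o s has the second
   derivative Q(D_v s, D_w s) for one bilinear form Q, symmetric by Schwarz.

   Hence the two Hessians are the same form in two inner products related by
   bounds on |L theta|^2 / g(theta, theta), and the eigenvalue estimate is
   Ostrowski's theorem, by intersecting spans of eigenvectors. *)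

(** * Functions of class C^k *)

(** Gradients, Hessians, lifts, complements and spectra are all chosen by [get] or [xget], so each
    needs an existence proof, and those that are computed a uniqueness proof as well. For [rhess]
    this shapes the development: [is_rhess] quantifies over all parametrizations, hence existence
    demands a value independent of the chart, while uniqueness demands at least one concrete chart,
    without which every operator would qualify. Both manifolds therefore get an explicit chart: (U +
    K D)(B + S)(U + K D)^T for the embedded one and, for the total space, U rotated by the Cayley
    transform of a skew matrix. Both are rational in the coordinates, so that smoothness reduces to
    sums, products and inverses.

    The constants come from |L theta|^2 = 2 |D B|^2 + |theta_B|^2 for theta_U = K D: the two
    off-diagonal blocks of L theta are transposes of each other, hence the factor 2. These terms are
    compared with tr(V D^T D) and tr(W theta_B W theta_B) through the singular values of V^(-1/2) B
    and of W^-1 respectively. *)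

Lemma near_eq_differentiable (R : realType) (V W : normedModType R)
    (f g : V -> W) (x : V) :
  (\near x, f x = g x) -> differentiable f x -> differentiable g x.
Proof.
move=> fg df.
(* The difference vanishes near [x], so its remainder against the zero differential is eventually
   null; [g] is then [f] plus a differentiable function. *)
have E : continuous (0 : V -> W) /\
   (g \- f) \o shift x = cst ((g \- f) x) + \0 +o_ 0 id.
  split; first exact: cst_continuous.
  apply/eqaddoP => e e0 /=.
  have fg0 : \forall h \near (0:V), f (h + x) = g (h + x).
    have : (h + x) @[h --> (0:V)] --> x.
      by rewrite -[X in _ --> X]add0r; apply: cvgD; [exact: cvg_id|exact: cvg_cst].
    by move=> /(_ _ fg).
  near=> h.
  rewrite /cst /= !fctE /= -(near fg0 h)// subrr (nbhs_singleton fg) subrr.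
  by rewrite !(addr0, oppr0, subrr) normr0 mulr_ge0// ltW.
have dgf : differentiable (g \- f) x.
  by apply/diff_locallyP; rewrite (diff_unique E.1 E.2); case: E.
have -> : g = f + (g \- f) by apply/funext => y; rewrite fctE addrC subrK.
exact: differentiableD.
Unshelve. all: by end_near. Qed.

Lemma is_deriveE (R : realType) (V W : normedModType R) (f : V -> W) x v w :
  is_derive x v f w -> 'D_v f x = w.
Proof. by case. Qed.

Section CkCalculus.
Variables (R : realType) (V : normedModType R).
Implicit Types (A : set V) (k : nat).

(** Derivation rules hold only where the functions are differentiable, that is on [A], while the
    derivatives in [Ck] are total functions. Transfer along an equality on an open set bridges the
    two in the inductive steps below. *)
Lemma Ck_eq (W : normedModType R) k A (f g : V -> W) :
  open A -> (forall x, A x -> f x = g x) -> Ck k A f -> Ck k A g.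
Proof.
elim: k f g => [|k IH] f g oA fg /=.
  move=> cf x Ax; rewrite -fg//; apply: cvg_trans (cf x Ax).
  apply: near_eq_cvg; apply: (@filterS _ _ _ A) => [y|]; first exact: fg.
  exact: open_nbhs_nbhs.
move=> [df Df].
have nfg x : A x -> \near x, f x = g x.
  by move=> Ax; apply: (@filterS _ _ _ A) fg _; exact: open_nbhs_nbhs.
split=> [x Ax|v].
  exact: near_eq_differentiable (nfg x Ax) (df x Ax).
apply: IH (Df v) => // x Ax; exact: near_eq_derive (nfg x Ax).
Qed.

Lemma CkS (W : normedModType R) k A (f : V -> W) : Ck k.+1 A f -> Ck k A f.
Proof.
elim: k f => [|k IH] f [df Df]; last by split=> // v; exact: IH (Df v).
by move=> x Ax; apply: differentiable_continuous; exact: df.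
Qed.

Lemma Ck_cst (W : normedModType R) k A (a : W) : Ck k A (fun=> a).
Proof.
elim: k a => [|k IH] a; first by move=> x _; exact: cvg_cst.
split=> [x _|v]; first exact: differentiable_cst.
have -> : (fun x => 'D_v (fun=> a) x) = (fun=> 0) :> (V -> W).
  by apply/funext => x; exact: (derive_cst a x v).
exact: IH.
Qed.

Lemma CkD (W : normedModType R) k A (f g : V -> W) : open A ->
  Ck k A f -> Ck k A g -> Ck k A (fun x => f x + g x).
Proof.
move=> oA; elim: k f g => [|k IH] f g.
  by move=> cf cg x Ax; apply: cvgD; [exact: cf|exact: cg].
move=> [df Df] [dg Dg]; split=> [x Ax|v].
  by apply: (@differentiableD _ _ _ f g); [exact: df|exact: dg].
apply: (Ck_eq oA _ (IH _ _ (Df v) (Dg v))) => x Ax.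
exact/esym/(deriveD (diff_derivable (df x Ax)) (diff_derivable (dg x Ax))).
Qed.

Lemma Ck_sum (W : normedModType R) k A (I : Type) (s : seq I) (P : pred I)
    (F : I -> V -> W) : open A -> (forall i, Ck k A (F i)) ->
  Ck k A (fun x => \sum_(i <- s | P i) F i x).
Proof.
move=> oA CF; elim: s => [|i s IH].
  by apply: (Ck_eq oA _ (@Ck_cst _ k A 0)) => x _; rewrite big_nil.
apply: (Ck_eq (f := fun x => if P i then F i x + \sum_(j <- s | P j) F j x
  else \sum_(j <- s | P j) F j x) oA) => [x _|]; first by rewrite big_cons.
by case: (P i) => //; exact: CkD.
Qed.

Lemma CkM k A (f g : V -> R) : open A ->
  Ck k A f -> Ck k A g -> Ck k A (fun x => f x * g x).
Proof.
move=> oA; elim: k f g => [|k IH] f g.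
  by move=> cf cg x Ax; apply: cvgM; [exact: cf|exact: cg].
move=> Cf Cg; have [df Df] := Cf; have [dg Dg] := Cg; split=> [x Ax|v].
  by apply: (@differentiableM _ _ f g); [exact: df|exact: dg].
have H1 := IH _ _ (CkS Cf) (Dg v); have H2 := IH _ _ (CkS Cg) (Df v).
apply: (Ck_eq oA _ (CkD oA H1 H2)) => x Ax.
exact/esym/(deriveM (diff_derivable (df x Ax)) (diff_derivable (dg x Ax))).
Qed.

Lemma CkN k A (f : V -> R) : open A -> Ck k A f -> Ck k A (fun x => - f x).
Proof.
move=> oA Cf; apply: (Ck_eq oA _ (CkM oA (@Ck_cst R k A (-1)) Cf)) => x _.
by rewrite mulN1r.
Qed.

Lemma Ck_prod k A (I : Type) (s : seq I) (P : pred I) (F : I -> V -> R) :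
  open A -> (forall i, Ck k A (F i)) ->
  Ck k A (fun x => \prod_(i <- s | P i) F i x).
Proof.
move=> oA CF; elim: s => [|i s IH].
  by apply: (Ck_eq oA _ (@Ck_cst R k A 1)) => x _; rewrite big_nil.
apply: (Ck_eq (f := fun x => if P i then F i x * \prod_(j <- s | P j) F j x
  else \prod_(j <- s | P j) F j x) oA) => [x _|]; first by rewrite big_cons.
by case: (P i) => //; exact: CkM.
Qed.

Lemma CkV k A (f : V -> R) : open A -> (forall x, A x -> f x != 0) ->
  Ck k A f -> Ck k A (fun x => (f x)^-1).
Proof.
move=> oA f0; elim: k => [|k IH] Cf.
  by move=> x Ax; apply: cvgV; [exact: f0|exact: Cf].
have [df Df] := Cf; split=> [x Ax|v].
  by apply: (@differentiableV _ _ f); [exact: df|exact: f0].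
have H := IH (CkS Cf).
apply: (Ck_eq oA _ (CkN oA (CkM oA (CkM oA H H) (Df v)))) => x Ax.
apply/esym; apply: etrans (deriveV (f0 x Ax) (diff_derivable (df x Ax))) _.
by rewrite -exprVn expr2 scaleNr.
Qed.

Lemma differentiable_mx m n (M : V -> 'M[R]_(m, n)) x :
  (forall i j, differentiable (fun y => M y i j) x) -> differentiable M x.
Proof.
move=> dM.
have -> : M = \sum_i \sum_j (fun y => M y i j *: delta_mx i j : 'M[R]_(m, n)).
  apply/funext => y; rewrite [LHS]matrix_sum_delta fct_sumE.
  by apply: eq_bigr => i _; rewrite fct_sumE.
apply: differentiable_sum => i; apply: differentiable_sum => j.
exact: differentiableZl.
Qed.

Lemma differentiable_coef m n (M : V -> 'M[R]_(m, n)) x i j :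
  differentiable M x -> differentiable (fun y => M y i j) x.
Proof.
move=> dM; apply: (@differentiable_comp _ _ _ _ M (fun N => N i j)) => //.
exact: differentiable_coord.
Qed.

Lemma derive_coef m n (M : V -> 'M[R]_(m, n)) x v i j :
  derivable M x v -> 'D_v (fun y => M y i j) x = ('D_v M x) i j.
Proof. by move=> dM; rewrite (derive_mx dM) mxE. Qed.

Lemma cvg_mx m n (T : Type) (F : set_system T) (FF : Filter F)
  (M : T -> 'M[R]_(m, n)) (L : 'M[R]_(m, n)) :
  (forall i j, M x i j @[x --> F] --> L i j) -> M x @[x --> F] --> L.
Proof.
move=> cM.
have -> : M = fun x => \sum_i \sum_j M x i j *: delta_mx i j.
  by apply/funext => y; rewrite [LHS]matrix_sum_delta.
rewrite [L in _ --> L]matrix_sum_delta.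
apply: cvg_big => [|i _]; first exact: add_continuous.
apply: cvg_big => [|j _]; first exact: add_continuous.
by apply: cvgZr_tmp; exact: cM.
Qed.

Lemma Ck_mxP k A m n (M : V -> 'M[R]_(m, n)) : open A ->
  (Ck k A M <-> forall i j, Ck k A (fun x => M x i j)).
Proof.
move=> oA; elim: k M => [|k IH] M; split.
- move=> cM i j x Ax; apply: (cvg_comp M (fun N => N i j) (cM x Ax)).
  exact: coord_continuous.
- by move=> cM x Ax; apply: cvg_mx => i j; exact: cM.
- move=> [dM DM] i j; split=> [x Ax|v].
    by apply: differentiable_coef; exact: dM.
  have /IH /(_ i j) := DM v; apply: (Ck_eq oA) => x Ax.
  by rewrite derive_coef//; exact/diff_derivable/dM.
- move=> cM; have dM x : A x -> differentiable M x.
    by move=> Ax; apply: differentiable_mx => i j; case: (cM i j) => /(_ x Ax).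
  split=> // v; apply/IH => i j.
  case: (cM i j) => _ /(_ v); apply: (Ck_eq oA) => x Ax.
  by rewrite derive_coef//; exact/diff_derivable/dM.
Qed.

Lemma Ck_pair (W1 W2 : normedModType R) k A (f : V -> W1) (g : V -> W2) :
  open A -> Ck k A f -> Ck k A g -> Ck k A (fun x => (f x, g x)).
Proof.
move=> oA; elim: k f g => [|k IH] f g.
  by move=> cf cg x Ax; apply: cvg_pair; [exact: cf|exact: cg].
move=> [df Df] [dg Dg].
have dfg x : A x -> differentiable (fun x => (f x, g x)) x.
  by move=> Ax; apply: differentiable_pair; [exact: df|exact: dg].
split=> // v; apply: (Ck_eq oA _ (IH _ _ (Df v) (Dg v))) => x Ax.
rewrite [RHS]deriveE; last exact: dfg.
rewrite diff_pair; [|exact: df|exact: dg].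
by rewrite !deriveE//; [exact: dg|exact: df].
Qed.

Lemma derive_fst (W1 W2 : normedModType R) (f : V -> W1 * W2) x v :
  derivable f x v -> 'D_v (fun y => (f y).1) x = ('D_v f x).1.
Proof.
move=> /cvg_ex[/= l fl]; have -> : 'D_v f x = l by apply/cvg_lim.
apply/cvg_lim => //.
exact: (cvg_comp _ _ fl (@cvg_fst _ _ (nbhs l.1) (nbhs l.2) _)).
Qed.

Lemma derive_snd (W1 W2 : normedModType R) (f : V -> W1 * W2) x v :
  derivable f x v -> 'D_v (fun y => (f y).2) x = ('D_v f x).2.
Proof.
move=> /cvg_ex[/= l fl]; have -> : 'D_v f x = l by apply/cvg_lim.
apply/cvg_lim => //.
exact: (cvg_comp _ _ fl (@cvg_snd _ _ (nbhs l.1) (nbhs l.2) _)).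
Qed.

Lemma differentiable_fst (W1 W2 : normedModType R) (f : V -> W1 * W2) x :
  differentiable f x -> differentiable (fun y => (f y).1) x.
Proof.
move=> df; apply: (@differentiable_comp _ _ _ _ f fst) => //.
apply: linear_differentiable => y; exact: cvg_fst.
Qed.

Lemma differentiable_snd (W1 W2 : normedModType R) (f : V -> W1 * W2) x :
  differentiable f x -> differentiable (fun y => (f y).2) x.
Proof.
move=> df; apply: (@differentiable_comp _ _ _ _ f snd) => //.
apply: linear_differentiable => y; exact: cvg_snd.
Qed.

Lemma Ck_fst (W1 W2 : normedModType R) k A (f : V -> W1 * W2) : open A ->
  Ck k A f -> Ck k A (fun x => (f x).1).
Proof.
move=> oA; elim: k f => [|k IH] f.
  by move=> cf x Ax; apply: (cvg_comp f fst (cf x Ax)); exact: cvg_fst.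
move=> [df Df]; split=> [x Ax|v]; first exact/differentiable_fst/df.
have := IH _ (Df v); apply: (Ck_eq oA) => x Ax.
by rewrite derive_fst//; exact/diff_derivable/df.
Qed.

Lemma Ck_snd (W1 W2 : normedModType R) k A (f : V -> W1 * W2) : open A ->
  Ck k A f -> Ck k A (fun x => (f x).2).
Proof.
move=> oA; elim: k f => [|k IH] f.
  by move=> cf x Ax; apply: (cvg_comp f snd (cf x Ax)); exact: cvg_snd.
move=> [df Df]; split=> [x Ax|v]; first exact/differentiable_snd/df.
have := IH _ (Df v); apply: (Ck_eq oA) => x Ax.
by rewrite derive_snd//; exact/diff_derivable/df.
Qed.

Lemma Ck_mulmx k A m n q (M : V -> 'M[R]_(m, n)) (N : V -> 'M[R]_(n, q)) :
  open A -> Ck k A M -> Ck k A N -> Ck k A (fun x => M x *m N x).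
Proof.
move=> oA /(Ck_mxP k _ oA) cM /(Ck_mxP k _ oA) cN; apply/(Ck_mxP k _ oA) => i j.
apply: (Ck_eq (f := fun x => \sum_l M x i l * N x l j) oA) => [x _|].
  by rewrite mxE.
by apply: Ck_sum => // l; exact: CkM.
Qed.

Lemma Ck_trmx k A m n (M : V -> 'M[R]_(m, n)) :
  open A -> Ck k A M -> Ck k A (fun x => (M x)^T).
Proof.
move=> oA /(Ck_mxP k _ oA) cM; apply/(Ck_mxP k _ oA) => i j.
by apply: (Ck_eq oA _ (cM j i)) => x _; rewrite mxE.
Qed.

Lemma Ck_det k A n (M : V -> 'M[R]_n) :
  open A -> Ck k A M -> Ck k A (fun x => \det (M x)).
Proof.
move=> oA /(Ck_mxP k _ oA) cM; rewrite /determinant.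
apply: Ck_sum => // s; apply: CkM => //; first exact: Ck_cst.
by apply: Ck_prod => // i; exact: cM.
Qed.

(** Cramer's formula: each entry is a cofactor over the determinant, hence a polynomial in the
    entries times a nonvanishing reciprocal. *)
Lemma Ck_invmx k A n (M : V -> 'M[R]_n) : open A ->
  (forall x, A x -> M x \in unitmx) -> Ck k A M -> Ck k A (fun x => invmx (M x)).
Proof.
move=> oA uM CM; apply/(Ck_mxP k _ oA) => i j.
apply: (Ck_eq (f := fun x => (\det (M x))^-1 * cofactor (M x) j i) oA).
  by move=> x Ax; rewrite /invmx uM// !mxE.
apply: CkM => //.
  apply: CkV => //; last exact: Ck_det.
  by move=> x Ax; rewrite -unitfE -unitmxE; exact: uM.
rewrite /cofactor; apply: CkM => //; first exact: Ck_cst.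
apply: Ck_det => //; apply/(Ck_mxP k _ oA) => a b.
move/(Ck_mxP k _ oA): CM => /(_ (lift j a) (lift i b)); apply: (Ck_eq oA) => x _.
by rewrite !mxE.
Qed.

Lemma derive_mulmx m n q (M : V -> 'M[R]_(m, n)) (N : V -> 'M[R]_(n, q)) x v :
  derivable M x v -> derivable N x v ->
  is_derive x v (fun y => M y *m N y) ('D_v M x *m N x + M x *m 'D_v N x).
Proof.
move=> dM dN.
have /derivable_mxP dM' := dM; have /derivable_mxP dN' := dN.
have E i j : is_derive x v (fun y => (M y *m N y) i j)
   (\sum_l ('D_v M x i l * N x l j + M x i l * 'D_v N x l j)).
  have -> : (fun y => (M y *m N y) i j) =
     \sum_l (fun y => M y i l * N y l j).
    by apply/funext => y; rewrite mxE fct_sumE.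
  apply: is_derive_sum => l.
  have H := is_deriveM (derivableP (dM' i l)) (derivableP (dN' l j)).
  apply: is_derive_eq H _.
  by rewrite !derive_coef// addrC; congr (_ + _); exact: mulrC.
have dMN : derivable (fun y => M y *m N y) x v.
  by apply/derivable_mxP => i j; case: (E i j).
apply: DeriveDef => //; rewrite derive_mx//.
apply/matrixP => i j; rewrite !mxE (is_deriveE (E i j)) -big_split.
by apply: eq_bigr => l _.
Qed.

Lemma derive_trmx m n (M : V -> 'M[R]_(m, n)) x v :
  derivable M x v -> is_derive x v (fun y => (M y)^T) ('D_v M x)^T.
Proof.
move=> dM; have /derivable_mxP dM' := dM.
have D : derivable (fun y => (M y)^T) x v.
  apply/derivable_mxP => i j; have := dM' j i.
  by congr (derivable _ x v); apply/funext => y; rewrite mxE.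
apply: DeriveDef => //; rewrite derive_mx//; apply/matrixP => i j.
rewrite !mxE -derive_coef//; congr ('D_v _ x).
by apply/funext => y; rewrite mxE.
Qed.

End CkCalculus.

(** * Schwarz's theorem and second derivatives of compositions *)

Lemma derive_comp (R : realType) (V V' W : normedModType R) (s : V -> V') (f : V' -> W) x v :
  differentiable s x -> differentiable f (s x) ->
  'D_v (f \o s) x = 'D_('D_v s x) f (s x).
Proof.
move=> ds df; rewrite deriveE; last exact: differentiable_comp.
by rewrite diff_comp//= !deriveE.
Qed.

Section DirectionalDerivatives.
Variables (R : realType) (V : normedModType R).

Lemma deriveDl (W : normedModType R) (f : V -> W) x u v : differentiable f x ->
  'D_(u + v) f x = 'D_u f x + 'D_v f x.
Proof. by move=> df; rewrite !deriveE// linearD. Qed.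

Lemma deriveZl (W : normedModType R) (f : V -> W) x a v : differentiable f x ->
  'D_(a *: v) f x = a *: 'D_v f x.
Proof. by move=> df; rewrite !deriveE// linearZ. Qed.

Lemma derive_suml (W : normedModType R) (f : V -> W) x (I : finType) (P : pred I)
    (a : I -> R) (v : I -> V) : differentiable f x ->
  'D_(\sum_(i | P i) a i *: v i) f x = \sum_(i | P i) a i *: 'D_(v i) f x.
Proof.
move=> df; rewrite deriveE// linear_sum; apply: eq_bigr => i _.
by rewrite linearZ deriveE.
Qed.

Lemma derive_translate (W : normedModType R) (f : V -> W) c x v :
  'D_v (fun y => f (y + c)) x = 'D_v f (x + c).
Proof.
rewrite /derive; set g := (fun h => h^-1 *: (f (h *: v + (x + c)) - f (x + c))).
have -> : g = (fun h : R => h^-1 *: (f (h *: v + x + c) - f (x + c))).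
  by apply/funext => h; rewrite /g addrA.
by [].
Qed.

Lemma differentiable_translate (W : normedModType R) (f : V -> W) c x :
  differentiable f (x + c) -> differentiable (fun y => f (y + c)) x.
Proof.
move=> df; apply: (@differentiable_comp _ _ _ _ (fun y => y + c) f)=> //.
Qed.

Lemma is_derive_fin_sum (W : normedModType R) (I : finType) (h : I -> V -> W)
    (dh : I -> W) x v : (forall i, is_derive x v (h i) (dh i)) ->
  is_derive x v (\sum_i h i) (\sum_i dh i).
Proof.
move=> hh; elim/big_ind2: _ => //; first exact: is_derive_cst.
by move=> *; exact: is_deriveD.
Qed.

Lemma line_MVT (F : V -> R) y v t : (forall z, differentiable F z) -> 0 < t ->
  exists2 c, 0 < c < t & F (y + t *: v) - F y = t * 'D_v F (y + c *: v).
Proof.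
move=> dF t0.
have D (z : R) : is_derive z (1:R) (fun c => F (y + c *: v)) ('D_v F (y + z *: v)).
  have dl : is_diff z (fun c : R => y + c *: v) (fun c => c *: v).
    apply: (is_diff_eq (is_diffD (is_diff_cst y z) (is_diff_scalel z v))).
    by rewrite add0r.
  have dl' : differentiable (fun c : R => y + c *: v) z by case: dl.
  have dc : differentiable (F \o (fun c : R => y + c *: v)) z.
    exact: differentiable_comp.
  apply: DeriveDef; first exact: diff_derivable.
  rewrite -[LHS]/('D_1 (F \o (fun c : R => y + c *: v)) z).
  rewrite (derive_comp (1:R) dl' (dF _)).
  by rewrite [X in 'D_X F _ = _]deriveE// (@diff_val _ _ _ _ _ _ _ dl) scale1r.
have [|c /andP[c0 ct]] := @MVT R _ _ 0 t t0 (fun z _ => D z).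
  apply: derivable_within_continuous => z _; by case: (D z).
rewrite subr0 scale0r addr0 mulrC => ->; exists c => //.
by move: c0 ct; rewrite !bnd_simp => -> ->.
Qed.

(** Where [b] vanishes, the difference quotient of the product is [a] times that of [b], so a limit
    of [a] is enough. With [a] an entry of the inverse Gram matrix and [b] a partial derivative at a
    stationary point, this differentiates the coordinate gradient. *)
Lemma derive_mul_vanishing (a b : V -> R) x v : {for x, continuous a} ->
  b x = 0 -> derivable b x v ->
  is_derive x v (fun y => a y * b y) (a x * 'D_v b x).
Proof.
move=> ca b0 db.
have H : (h^-1 *: (a (h *: v + x) * b (h *: v + x) - a x * b x)) @[h --> 0^']
     --> a x * 'D_v b x.
  have -> : (fun h => h^-1 *: (a (h *: v + x) * b (h *: v + x) - a x * b x)) =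
    (fun h => a (h *: v + x) * (h^-1 *: (b (h *: v + x) - b x))).
    apply/funext => h; rewrite b0 mulr0 !subr0 /GRing.scale /=.
    by rewrite mulrCA.
  apply: cvgM; last exact: db.
  apply: cvg_within_filter.
  have hx : (h *: v + x) @[h --> (0:R)] --> x.
    rewrite -[X in _ --> X]add0r -(scale0r v); apply: cvgD; last exact: cvg_cst.
    by apply: cvgZr_tmp; exact: cvg_id.
  exact: (cvg_comp _ a hx ca).
apply: DeriveDef; first by apply/cvg_ex; exists (a x * 'D_v b x).
exact/cvg_lim.
Qed.

(** The mean value theorem along [v] for the increment of [f] in direction [t *: w], then along [w]
    for ['D_v f]. The left side is symmetric in [v] and [w], so exchanging them expresses one number
    by both mixed derivatives. *)
Lemma second_difference (f : V -> R) x v w t :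
  (forall z, differentiable f z) -> (forall z, differentiable ('D_v f) z) ->
  0 < t -> exists c d, [/\ 0 < c < t, 0 < d < t &
  f (x + t *: v + t *: w) - f (x + t *: v) - (f (x + t *: w) - f x) =
  t * (t * 'D_w ('D_v f) (x + c *: v + d *: w))].
Proof.
move=> df dvf t0.
have d1 z : differentiable (fun y => f (y + t *: w) - f y) z.
  by apply: (@differentiableB _ _ _ (fun y => f (y + t *: w)) f) => //;
    exact: differentiable_translate.
have [c ct ->] := line_MVT x v d1 t0.
have -> : 'D_v (fun y => f (y + t *: w) - f y) (x + c *: v) =
   'D_v f (x + c *: v + t *: w) - 'D_v f (x + c *: v).
  rewrite -(derive_translate f); apply: (@deriveB _ _ _ (fun y => f (y + t *: w)) f).
    exact/diff_derivable/differentiable_translate.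
  exact: diff_derivable.
have [d dt ->] := line_MVT (x + c *: v) w dvf t0.
by exists c, d.
Qed.

Lemma derive_symmetric (f : V -> R) x v w : Ck 2 setT f ->
  'D_v ('D_w f) x = 'D_w ('D_v f) x.
Proof.
move=> [df Df].
have dD u z : differentiable ('D_u f) z by case: (Df u) => + _; exact.
have cD u u' : {for x, continuous ('D_u ('D_u' f))}.
  by case: (Df u') => _ /(_ u) /(_ x I).
have near_small u u' e : 0 < e -> \forall c \near (0:R) & d \near (0:R),
    `|'D_u ('D_u' f) x - 'D_u ('D_u' f) (x + c *: u' + d *: u)| < e.
  move=> e0; have /cvgrPdist_lt /(_ e e0) := cD u u'.
  have : (x + z.1 *: u' + z.2 *: u) @[z --> ((0:R), (0:R))] --> x.
    rewrite -[X in _ --> X]addr0 -[X in _ --> X + _]addr0.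
    apply: cvgD; first apply: cvgD; first exact: cvg_cst.
      by rewrite -(scale0r u'); apply: cvgZr_tmp; exact: cvg_fst.
    by rewrite -(scale0r u); apply: cvgZr_tmp; exact: cvg_snd.
  by move=> /[apply].
apply/eqP; rewrite -subr_eq0 -normr_le0; apply/ler_addgt0Pl => e e0.
rewrite addr0.
have e2 : 0 < e / 2 by rewrite divr_gt0.
have [[A1 B1] /= [/nbhs_ballP[a1 /= a10 A1P] /nbhs_ballP[b1 /= b10 B1P]] H1] :=
  near_small v w _ e2.
have [[A2 B2] /= [/nbhs_ballP[a2 /= a20 A2P] /nbhs_ballP[b2 /= b20 B2P]] H2] :=
  near_small w v _ e2.
(* All mean value parameters lie below [t], hence inside both neighborhoods on which a mixed
   derivative stays within [e / 2] of its value at [x]. *)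
pose t := Num.min (Num.min a1 b1) (Num.min a2 b2).
have t0 : 0 < t by rewrite !lt_min a10 b10 a20 b20.
have ta1 : t <= a1 by rewrite /t !ge_min lexx.
have tb1 : t <= b1 by rewrite /t !ge_min lexx ?orbT.
have ta2 : t <= a2 by rewrite /t !ge_min lexx ?orbT.
have tb2 : t <= b2 by rewrite /t !ge_min lexx ?orbT.
have inb c r : 0 < c < t -> t <= r -> ball 0 r c.
  move=> /andP[c0 ct] tr; rewrite /ball /= sub0r normrN gtr0_norm//.
  exact: lt_le_trans ct tr.
have df' z : differentiable f z by exact: df.
have [c [d [ct dt E1]]] := second_difference x v df' (dD w) t0.
have [c' [d' [ct' dt' E2]]] := second_difference x w df' (dD v) t0.
(* Both sides are the same second difference divided by the square of [t]. *)
have E : 'D_v ('D_w f) (x + c *: w + d *: v) = 'D_w ('D_v f) (x + c' *: v + d' *: w).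
  apply: (mulfI (lt0r_neq0 t0)); apply: (mulfI (lt0r_neq0 t0)).
  apply: (etrans (esym E1)); apply: etrans E2.
  rewrite [x + t *: v + t *: w]addrAC.
  set p := f _; set q := f (x + t *: w); set q' := f (x + t *: v).
  by rewrite !opprB addrACA [RHS]addrACA [- q - _]addrC.
have /= h1 := H1 (c, d) (conj (A1P _ (inb _ _ ct ta1)) (B1P _ (inb _ _ dt tb1))).
have /= h2 := H2 (c', d') (conj (A2P _ (inb _ _ ct' ta2)) (B2P _ (inb _ _ dt' tb2))).
rewrite -E distrC in h2.
apply: ltW; rewrite [e]splitr.
apply: le_lt_trans (ltrD h1 h2).
apply: le_trans (ler_normD _ _).
by rewrite addrA subrK.
Qed.

End DirectionalDerivatives.

Section MatrixFunctions.
Variables (R : realType) (m n : nat) (V : normedModType R).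
Implicit Types (f : 'M[R]_(m, n) -> R) (s : V -> 'M[R]_(m, n)).

Lemma derive_delta f X xi : differentiable f X ->
  'D_xi f X = \sum_ij xi ij.1 ij.2 * 'D_(delta_mx ij.1 ij.2) f X.
Proof.
move=> df.
have {1}-> : xi = \sum_ij xi ij.1 ij.2 *: delta_mx ij.1 ij.2.
  by rewrite [LHS]matrix_sum_delta pair_bigA.
by rewrite derive_suml.
Qed.

(** On [O] the chain rule turns the first derivative into a finite sum, over matrix entries, of
    products of scalar functions; the product rule then applies termwise. In the first resulting
    term the direction ['D_w s x] is frozen at [x]. *)
Lemma second_derive_comp f s (O : set V) x v w : Ck 2 setT f ->
  open O -> O x -> Ck 2 O s ->
  is_derive x v ('D_w (f \o s))
    ('D_('D_v s x) ('D_('D_w s x) f) (s x) + 'D_('D_v ('D_w s) x) f (s x)).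
Proof.
move=> [df Df] oO Ox [ds Ds].
have df' z : differentiable f z by exact: df.
have dD u z : differentiable ('D_u f) z by case: (Df u) => + _; exact.
have dDs : differentiable ('D_w s) x by case: (Ds w) => /(_ x Ox).
have E : \near x, \sum_ij 'D_w s x ij.1 ij.2 * 'D_(delta_mx ij.1 ij.2) f (s x) =
     'D_w (f \o s) x.
  apply: (@filterS _ _ _ O); last exact: open_nbhs_nbhs.
  by move=> y Oy; rewrite (derive_comp w (ds y Oy) (df' _)); exact/esym/derive_delta.
apply: (near_eq_is_derive E).
have -> : (fun y => \sum_ij 'D_w s y ij.1 ij.2 * 'D_(delta_mx ij.1 ij.2) f (s y)) =
  \sum_ij (fun y => 'D_w s y ij.1 ij.2 * 'D_(delta_mx ij.1 ij.2) f (s y)).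
  by apply/funext => y; rewrite fct_sumE.
have dsx : differentiable s x by exact: ds.
have H ij : is_derive x v
   (fun y => 'D_w s y ij.1 ij.2 * 'D_(delta_mx ij.1 ij.2) f (s y))
   ('D_w s x ij.1 ij.2 * 'D_('D_v s x) ('D_(delta_mx ij.1 ij.2) f) (s x) +
   'D_v ('D_w s) x ij.1 ij.2 * 'D_(delta_mx ij.1 ij.2) f (s x)).
  have d1 : derivable (fun y => 'D_w s y ij.1 ij.2) x v.
    exact/diff_derivable/differentiable_coef.
  have d2 : derivable ('D_(delta_mx ij.1 ij.2) f \o s) x v.
    exact/diff_derivable/differentiable_comp.
  have M := is_deriveM (derivableP d1) (derivableP d2).
  apply: is_derive_eq M _.
  rewrite (derive_comp v dsx (dD _ _)) derive_coef; last exact: diff_derivable.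
  by congr (_ + _); exact: mulrC.
apply: is_derive_eq (is_derive_fin_sum H) _.
rewrite big_split /=; congr (_ + _); last by rewrite -derive_delta.
have -> : 'D_('D_w s x) f =
  \sum_ij (fun y => 'D_w s x ij.1 ij.2 * 'D_(delta_mx ij.1 ij.2) f y).
  by apply/funext => y; rewrite fct_sumE -derive_delta.
apply/esym/is_deriveE.
apply: is_derive_fin_sum => ij.
apply: is_deriveZ; exact/derivableP/diff_derivable.
Qed.

Lemma hessian_linear f X xi1 xi2 eta a : Ck 2 setT f ->
  'D_(a *: xi1 + xi2) ('D_eta f) X =
  a * 'D_xi1 ('D_eta f) X + 'D_xi2 ('D_eta f) X.
Proof.
move=> [df Df]; have dD : differentiable ('D_eta f) X by case: (Df eta) => /(_ X I).
by rewrite deriveDl// deriveZl.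
Qed.

End MatrixFunctions.

(** * Spectral theorem and positive definite matrices *)

Section QuadraticForms.
Variable R : realType.

(** Vectors are rows from here on, as suits row spaces and [row i P], whereas [psd] and [spd]
    quantify over columns; [spdP] translates. *)
Definition qform n (A : 'M[R]_n) (x : 'rV[R]_n) : R := (x *m A *m x^T) 0 0.
Definition sqnorm n (x : 'rV[R]_n) : R := (x *m x^T) 0 0.

Lemma sqnormE n (x : 'rV[R]_n) : sqnorm x = \sum_j x 0 j ^+ 2.
Proof. by rewrite /sqnorm mxE; apply: eq_bigr => j _; rewrite mxE expr2. Qed.

Lemma sqnorm_ge0 n (x : 'rV[R]_n) : 0 <= sqnorm x.
Proof. by rewrite sqnormE; apply: sumr_ge0 => j _; exact: sqr_ge0. Qed.

Lemma sqnorm_eq0 n (x : 'rV[R]_n) : (sqnorm x == 0) = (x == 0).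
Proof.
apply/idP/eqP => [|->]; last by rewrite /sqnorm mul0mx mxE.
rewrite sqnormE psumr_eq0 => [/allP x0|j _]; last exact: sqr_ge0.
apply/rowP => j; rewrite mxE; apply/eqP; rewrite -sqrf_eq0.
by apply: x0; rewrite mem_index_enum.
Qed.

Lemma sqnorm_gt0 n (x : 'rV[R]_n) : (0 < sqnorm x) = (x != 0).
Proof. by rewrite lt_def sqnorm_eq0 sqnorm_ge0 andbT. Qed.

Lemma sqnorm_qform n (x : 'rV[R]_n) : sqnorm x = qform 1%:M x.
Proof. by rewrite /qform mulmx1. Qed.

Definition bil n (A : 'M[R]_n) (x y : 'rV[R]_n) : R := (x *m A *m y^T) 0 0.

Lemma bilC n (A : 'M[R]_n) (x y : 'rV[R]_n) : A^T = A -> bil A x y = bil A y x.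
Proof.
move=> AT; rewrite /bil; have -> : x *m A *m y^T = (y *m A *m x^T)^T.
  by rewrite !trmx_mul trmxK AT mulmxA.
by rewrite mxE.
Qed.

Lemma bilDr n (A : 'M[R]_n) x y z : bil A x (y + z) = bil A x y + bil A x z.
Proof. by rewrite /bil linearD mulmxDr mxE. Qed.

Lemma bilDl n (A : 'M[R]_n) x y z : bil A (y + z) x = bil A y x + bil A z x.
Proof. by rewrite /bil !mulmxDl mxE. Qed.

Lemma bilZr n (A : 'M[R]_n) x y t : bil A x (t *: y) = t * bil A x y.
Proof. by rewrite /bil linearZ -scalemxAr mxE. Qed.

Lemma bilZl n (A : 'M[R]_n) x y t : bil A (t *: x) y = t * bil A x y.
Proof. by rewrite /bil -!scalemxAl mxE. Qed.

Lemma qformD n (A : 'M[R]_n) (x y : 'rV[R]_n) t : A^T = A ->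
  qform A (x + t *: y) = qform A x + 2 * t * bil A x y + t ^+ 2 * qform A y.
Proof.
move=> AT; rewrite -![qform _ _]/(bil _ _ _) bilDr !bilDl !bilZl !bilZr (bilC y x AT).
by ring.
Qed.

Lemma qformZ n (A : 'M[R]_n) (x : 'rV[R]_n) t :
  qform A (t *: x) = t ^+ 2 * qform A x.
Proof. by rewrite -![qform _ _]/(bil _ _ _) bilZl bilZr mulrA expr2. Qed.

(** If [bil A x y] were nonzero, the form would be negative at a suitable [x + t *: y]. This turns
    Rayleigh maximisers into eigenvectors, and a vanishing quadratic form into a vanishing
    matrix. *)
Lemma psd_qform_eq0 n (A : 'M[R]_n) (x : 'rV[R]_n) : A^T = A ->
  (forall y, 0 <= qform A y) -> qform A x = 0 -> x *m A = 0.
Proof.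
move=> AT A0 qx.
suff H : forall y, bil A x y = 0.
  have := H (x *m A); rewrite /bil => /eqP.
  by rewrite -/(sqnorm (x *m A)) sqnorm_eq0 => /eqP.
move=> y; set b := bil A x y.
apply/eqP; apply: contraT => b0.
(* The added 1 keeps [c] positive when [y] is isotropic too; at [t = - b / c] the form equals
   [b ^+ 2 / c * (qform A y / c - 2)], and [qform A y / c < 1]. *)
pose c := qform A y + 1.
have c0 : 0 < c by rewrite ltr_wpDl.
have := A0 (x + (- b / c) *: y); rewrite qformD// qx -/b add0r.
have -> : 2 * (- b / c) * b + (- b / c) ^+ 2 * qform A y =
   b ^+ 2 / c * (qform A y / c - 2) by field; rewrite gt_eqF.
rewrite pmulr_rge0; last by rewrite divr_gt0// exprn_even_gt0.
rewrite subr_ge0 ler_pdivlMr// /c leNgt => /negP[].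
by have := A0 y; lra.
Qed.

Lemma qform_row m n (P : 'M[R]_(m, n)) (A : 'M[R]_n) j :
  qform A (row j P) = (P *m A *m P^T) j j.
Proof.
rewrite /qform -row_mul tr_row mxE [RHS]mxE; apply: eq_bigr => k _.
by congr (_ * _); rewrite mxE.
Qed.

Lemma sqnorm_row_mx m n (x : 'rV[R]_m) (y : 'rV[R]_n) :
  sqnorm (row_mx x y) = sqnorm x + sqnorm y.
Proof. by rewrite /sqnorm tr_row_mx mul_row_col mxE. Qed.

(** The reflection in the hyperplane orthogonal to [v - e] exchanges the unit vectors [e] and [v].
    It yields an orthonormal basis with first row [v]. *)
Lemma householder n (v : 'rV[R]_n.+1) : sqnorm v = 1 ->
  exists Q : 'M[R]_n.+1, [/\ Q *m Q^T = 1%:M & delta_mx 0 0 *m Q = v].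
Proof.
move=> v1; set e : 'rV[R]_n.+1 := delta_mx 0 0.
have [->|ve] := eqVneq v e; first by exists 1%:M; rewrite trmx1 !mulmx1.
have e1 : sqnorm e = 1.
  by rewrite /sqnorm /e trmx_delta mul_delta_mx mxE !eqxx.
pose w := v - e.
have w0 : sqnorm w != 0 by rewrite sqnorm_eq0 subr_eq0.
pose c := 2 / sqnorm w.
have ww : w *m w^T = (sqnorm w)%:M by rewrite [LHS]mx11_scalar.
pose Q := 1%:M - c *: (w^T *m w).
have QT : Q^T = Q by rewrite /Q linearB linearZ /= trmx_mul trmxK trmx1.
exists Q; split.
  rewrite QT {1}/Q mulmxBl mul1mx -scalemxAl -mulmxA.
  have -> : w *m Q = - w.
    rewrite /Q mulmxBr mulmx1 -scalemxAr mulmxA ww mul_scalar_mx scalerA.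
    rewrite /c divfK// -[X in X - _]scale1r -scalerBl -[RHS]scaleN1r.
    by congr (_ *: _); ring.
  by rewrite mulmxN scalerN opprK /Q subrK.
have ev : bil 1%:M e w = - sqnorm w / 2.
  have h : sqnorm w = bil 1%:M v v - 2 * bil 1%:M e v + bil 1%:M e e.
    rewrite sqnorm_qform -[LHS]/(bil _ w w) /w bilDl !bilDr.
    rewrite -(scaleN1r e) !bilZl !bilZr (bilC v e) ?trmx1//.
    lra.
  have h1 : bil 1%:M e w = bil 1%:M e v - bil 1%:M e e.
    by rewrite /w bilDr -scaleN1r bilZr mulN1r.
  have h2 : bil 1%:M v v = 1 by rewrite /bil mulmx1.
  have h3 : bil 1%:M e e = 1 by rewrite /bil mulmx1.
  rewrite h1; lra.
rewrite /Q mulmxBr mulmx1 -scalemxAr mulmxA.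
have -> : e *m w^T = (- sqnorm w / 2)%:M.
  by rewrite -ev [LHS]mx11_scalar /bil mulmx1.
rewrite mul_scalar_mx scalerA /c.
have -> : 2 / sqnorm w * (- sqnorm w / 2) = -1.
  by field.
by rewrite scaleN1r opprK /w addrC subrK.
Qed.

Lemma Rayleigh_max n (A : 'M[R]_n.+1) : exists2 v : 'rV[R]_n.+1, sqnorm v = 1 &
  forall x, qform A x <= qform A v * sqnorm x.
Proof.
have cq (B : 'M[R]_n.+1) : continuous (fun x : 'rV[R]_n.+1 => qform B x).
  have H : Ck 0 setT (fun x : 'rV[R]_n.+1 => x *m B *m x^T).
    have o := @openT 'rV[R]_n.+1.
    have Hid : Ck 0 setT (fun x : 'rV[R]_n.+1 => x) by move=> x _; exact: cvg_id.
    apply: Ck_mulmx => //; last exact: Ck_trmx.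
    by apply: Ck_mulmx => //; exact: Ck_cst.
  move=> x; have /Ck_mxP := H => /(_ (@openT _)) /(_ 0 0) /(_ x I); exact.
pose S := [set x : 'rV[R]_n.+1 | sqnorm x = 1].
have S0 : S !=set0.
  exists (delta_mx 0 0); rewrite /S /= /sqnorm trmx_delta mul_delta_mx mxE !eqxx//.
have cs : continuous (fun x : 'rV[R]_n.+1 => sqnorm x).
  by move=> x; have := cq 1%:M x; congr (continuous_at x _); apply/funext => y;
    rewrite /qform mulmx1.
have Sc : compact S.
  apply: bounded_closed_compact.
    (* The norm on matrices is the largest absolute entry, which is at most the Euclidean length
       1. *)
    exists 1; split=> // M M1 x xS; apply: le_trans (ltW M1).
    rewrite [leLHS]/Num.Def.normr/= mx_normrE; apply: bigmax_le => // -[i j] _ /=.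
    rewrite ord1 -(@ler_pXn2r _ 2)// ?nnegrE// expr1n real_normK ?num_real//.
    rewrite -xS sqnormE (bigD1 j)//= lerDl; apply: sumr_ge0 => k _; exact: sqr_ge0.
  have -> : S = (fun x : 'rV[R]_n.+1 => sqnorm x) @^-1` [set 1] by [].
  apply: closed_comp => [x _|]; first exact: cs.
  exact: closed_eq.
have [|v /set_mem vS vmax] := EVT_max_rV S0 Sc (f := fun x => qform A x).
  by apply: continuous_subspaceT; exact: cq.
exists v => // x; have [->|x0] := eqVneq x 0.
  by rewrite /qform /sqnorm !mul0mx !mxE mulr0.
have sx : 0 < sqnorm x by rewrite sqnorm_gt0.
pose t := (Num.sqrt (sqnorm x))^-1.
have t2 : t ^+ 2 = (sqnorm x)^-1 by rewrite exprVn sqr_sqrtr// ltW.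
have := vmax (t *: x); rewrite qformZ t2.
have -> : t *: x \in S.
  by rewrite inE /S /= sqnorm_qform qformZ t2 -sqnorm_qform mulVf// gt_eqF.
move=> /(_ isT); rewrite mulrC ler_pdivrMr//; exact.
Qed.

Lemma block_mx_first_row n (A : 'M[R]_(1 + n)) m : A^T = A ->
  (forall j, A 0 j = m *+ (j == 0)) -> A = block_mx m%:M 0 0 (drsubmx A).
Proof.
move=> AT A0; rewrite -[LHS]submxK; congr block_mx; apply/matrixP => i j;
  rewrite !mxE ?ord1 ?lshift0 ?A0//.
by rewrite -AT mxE A0.
Qed.

(** Induction on the size: a maximiser [v] of the Rayleigh quotient is an eigenvector, a reflection
    moves it to the first basis vector, and symmetry leaves a smaller symmetric block. The rows of
    [P] are the eigenvectors. *)
Lemma spectral_decomposition n (A : 'M[R]_n) : A^T = A ->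
  exists (P : 'M[R]_n) (d : 'rV[R]_n), [/\ P *m P^T = 1%:M,
    A = P^T *m diag_mx d *m P & forall i j : 'I_n, (i <= j)%N -> d 0 j <= d 0 i].
Proof.
elim: n A => [|n IH] A AT.
  by exists 1%:M, 0; split; [rewrite [LHS]flatmx0 [RHS]flatmx0|
    rewrite [LHS]flatmx0 [RHS]flatmx0|case].
have [v v1 vmax] := Rayleigh_max A.
set m := qform A v in vmax.
have vA : v *m A = m *: v.
  apply/eqP; rewrite eq_sym -subr_eq0 -mul_mx_scalar -mulmxBr; apply/eqP.
  (* Maximality says that [m%:M - A] is positive semidefinite, and its form vanishes at [v]. *)
  apply: psd_qform_eq0.
  - by rewrite linearB /= tr_scalar_mx AT.
  - move=> y; rewrite /qform mulmxBr mulmxBl mul_mx_scalar -scalemxAl mxE [X in _ + X]mxE.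
    rewrite [X in X - _]mxE subr_ge0; exact: vmax.
  - rewrite /qform mulmxBr mulmxBl mul_mx_scalar -scalemxAl mxE [X in _ + X]mxE.
    by rewrite [X in X - _]mxE -/(qform A v) -/(sqnorm v) v1 mulr1 subrr.
have [Q [QQ eQ]] := householder v1.
have QTQ : Q^T *m Q = 1%:M by apply: mulmx1C.
pose A1 : 'M[R]_(1 + n) := Q *m A *m Q^T.
have A1T : A1^T = A1 by rewrite /A1 !trmx_mul trmxK AT mulmxA.
have eA1 : (delta_mx 0 0 : 'rV[R]_(1 + n)) *m A1 = m *: delta_mx 0 0.
  rewrite /A1 !mulmxA eQ vA -scalemxAl; congr (_ *: _).
  by rewrite -eQ -mulmxA QQ mulmx1.
have rA1 j : A1 0 j = m *+ (j == 0).
  have := congr1 (fun M : 'rV[R]_(1 + n) => M 0 j) eA1.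
  by rewrite -rowE !mxE eqxx /= => ->; rewrite mulr_natr.
pose A2 := drsubmx A1.
have A2T : A2^T = A2 by rewrite /A2 trmx_drsub A1T.
have A1E : A1 = block_mx m%:M 0 0 A2 by exact: block_mx_first_row.
have [P2 [d2 [PP2 A2E d2s]]] := IH A2 A2T.
pose P1 : 'M[R]_(1 + n) := block_mx 1%:M 0 0 P2.
exists (P1 *m Q), (row_mx m%:M d2 : 'rV[R]_(1 + n)).
have P1P1 : P1 *m P1^T = 1%:M.
  by rewrite /P1 tr_block_mx mulmx_block !trmx0 !mulmx0 !mul0mx !addr0 trmx1
    mulmx1 PP2 add0r -scalar_mx_block.
have D : block_mx m%:M 0 0 A2 = P1^T *m block_mx m%:M 0 0 (diag_mx d2) *m P1.
  rewrite {1}A2E /P1 tr_block_mx !mulmx_block.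
  by rewrite !trmx0 !mulmx0 !mul0mx !addr0 !add0r trmx1 ?mulmx1 ?mul1mx ?mul0mx.
split.
- by rewrite trmx_mul -mulmxA (mulmxA Q) QQ mul1mx.
- have -> : diag_mx (row_mx m%:M d2 : 'rV[R]_(1 + n)) = block_mx m%:M 0 0 (diag_mx d2).
    rewrite diag_mx_row; congr block_mx; apply/matrixP => i j.
    by rewrite !ord1 !mxE.
  have : A = Q^T *m A1 *m Q.
    by rewrite /A1 !mulmxA QTQ mul1mx -mulmxA QTQ mulmx1.
  move=> AE; rewrite [LHS]AE trmx_mul A1E -!mulmxA; congr (_ *m _); rewrite !mulmxA.
  congr (_ *m _); exact: D.
(* An eigenvector of the block, padded with a zero and rotated back by [Q], is a unit vector on
   which the form of [A] takes the value [d2 0 j]; maximality of [m] thus sorts the list. *)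
have d2m j : d2 0 j <= m.
  have PP2' : P2^T *m P2 = 1%:M by exact: mulmx1C.
  have h : qform A2 (row j P2) = d2 0 j.
    rewrite qform_row A2E !mulmxA PP2 mul1mx -mulmxA PP2 mulmx1.
    by rewrite mxE eqxx.
  have := vmax ((row_mx 0 (row j P2) : 'rV[R]_(1 + n)) *m Q).
  have -> : sqnorm ((row_mx 0 (row j P2) : 'rV[R]_(1 + n)) *m Q) = 1.
    rewrite /sqnorm trmx_mul mulmxA -(mulmxA _ Q) QQ mulmx1 -/(sqnorm _).
    rewrite sqnorm_row_mx {1}/sqnorm mul0mx mxE add0r sqnorm_qform.
    by rewrite qform_row mulmx1 PP2 mxE eqxx.
  rewrite mulr1; apply: le_trans; rewrite -h.
  have <- : qform A1 (row_mx 0 (row j P2)) = qform A2 (row j P2).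
    rewrite /qform {1}A1E.
    by rewrite mul_row_block tr_row_mx mul_row_col ?mulmx0 ?mul0mx ?add0r ?mul0mx ?add0r.
  by rewrite /qform /A1 trmx_mul !mulmxA.
have mono : forall i j : 'I_(1 + n), (i <= j)%N ->
    (row_mx m%:M d2 : 'rV[R]_(1 + n)) 0 j <= (row_mx m%:M d2 : 'rV[R]_(1 + n)) 0 i.
  move=> i j; case: (split_ordP i) => i' ->; case: (split_ordP j) => j' ->;
    rewrite ?row_mxEl ?row_mxEr ?ord1 //=.
  - by rewrite [_%:M _ _]mxE eqxx d2m.
  - by rewrite leq_add2l => /d2s.
exact: mono.
Qed.

Lemma diag_conj_qform n (P : 'M[R]_n) (d : 'rV[R]_n) x :
  qform (P^T *m diag_mx d *m P) x = \sum_j d 0 j * (x *m P^T) 0 j ^+ 2.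
Proof.
have -> : qform (P^T *m diag_mx d *m P) x = qform (diag_mx d) (x *m P^T).
  by rewrite /qform !mulmxA trmx_mul trmxK !mulmxA.
set y := x *m P^T; rewrite /qform mul_mx_diag mxE; apply: eq_bigr => j _.
by rewrite !mxE mulrAC mulrC expr2.
Qed.

Lemma spdP n (A : 'M[R]_n) :
  spd A <-> A^T = A /\ forall x : 'rV[R]_n, x != 0 -> 0 < qform A x.
Proof.
split=> -[AT A0]; split=> // x x0.
  rewrite /qform -{1}[x]trmxK; apply: A0.
  by apply: contraNneq x0 => x0; rewrite -[x]trmxK x0 trmx0.
rewrite -{2}[x]trmxK; apply: A0.
by apply: contraNneq x0 => x0; rewrite -[x]trmxK x0 trmx0.
Qed.

Lemma spd_qform_ge0 n (A : 'M[R]_n) x : spd A -> 0 <= qform A x.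
Proof.
move=> /spdP[_ A0]; have [->|/A0/ltW//] := eqVneq x 0.
by rewrite /qform !mul0mx mxE.
Qed.

Lemma spd_unitmx n (A : 'M[R]_n) : spd A -> A \in unitmx.
Proof.
move=> /spdP[_ A0]; rewrite -row_free_unit -kermx_eq0.
apply/rowV0P => x /sub_kermxP xA; apply/eqP/contraT => /A0.
by rewrite /qform xA mul0mx mxE ltxx.
Qed.

Lemma spd_congr n (A P : 'M[R]_n) : spd A -> P \in unitmx -> spd (P *m A *m P^T).
Proof.
move=> /spdP[AT A0] uP; apply/spdP; split.
  by rewrite !trmx_mul trmxK AT mulmxA.
move=> x x0; have := A0 (x *m P); rewrite /qform trmx_mul !mulmxA; apply.
by apply: contraNneq x0 => xP; rewrite -(mulmxK uP x) xP mul0mx.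
Qed.

Lemma spd_diag n (d : 'rV[R]_n) : (forall j, 0 < d 0 j) -> spd (diag_mx d).
Proof.
move=> d0; apply/spdP; split; first by rewrite tr_diag_mx.
move=> x x0; have := diag_conj_qform 1%:M d x; rewrite trmx1 !mulmx1 mul1mx => ->.
rewrite lt_def; apply/andP; split; last first.
  by apply: sumr_ge0 => j _; apply: mulr_ge0; [exact: ltW|exact: sqr_ge0].
apply: contra x0; rewrite psumr_eq0 => [/allP h|j _]; last first.
  by apply: mulr_ge0; [exact: ltW|exact: sqr_ge0].
apply/eqP/rowP => j; rewrite mxE; apply/eqP; rewrite -sqrf_eq0.
have := h j; rewrite mem_index_enum => /(_ isT).
by rewrite mulf_eq0 gt_eqF.
Qed.

Lemma orthogonal_unitmx n (P : 'M[R]_n) : P *m P^T = 1%:M -> P \in unitmx.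
Proof. by move=> /mulmx1_unit[]. Qed.

Lemma spd_spectral n (A : 'M[R]_n) : spd A ->
  exists (P : 'M[R]_n) (d : 'rV[R]_n), [/\ P *m P^T = 1%:M,
    A = P^T *m diag_mx d *m P, forall i j : 'I_n, (i <= j)%N -> d 0 j <= d 0 i
    & forall j, 0 < d 0 j].
Proof.
move=> As; have /spdP[AT A0] := As.
have [P [d [PP AE ds]]] := spectral_decomposition AT.
exists P, d; split=> // j.
have -> : d 0 j = qform A (row j P).
  by rewrite qform_row AE !mulmxA PP mul1mx -mulmxA PP mulmx1 mxE eqxx.
apply: A0; apply/eqP => rj; suff: (1 : R) = 0 by move/eqP; rewrite oner_eq0.
have := congr1 (fun M : 'M[R]_n => M j j) PP; rewrite mxE.
rewrite big1 => [|k _]; first by rewrite mxE eqxx => /esym.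
by have /rowP /(_ k) := rj; rewrite !mxE => ->; rewrite mul0r.
Qed.

Lemma spd_sqrt n (A : 'M[R]_n) : spd A -> exists S, spd S /\ S *m S = A.
Proof.
move=> /spd_spectral[P [d [PP -> _ d0]]].
exists (P^T *m diag_mx (map_mx Num.sqrt d) *m P); split.
  rewrite -{2}[P]trmxK; apply: spd_congr.
    by apply: spd_diag => j; rewrite mxE sqrtr_gt0.
  by rewrite unitmx_tr orthogonal_unitmx.
rewrite -!mulmxA (mulmxA P) PP mul1mx !mulmxA; congr (_ *m _).
rewrite -mulmxA; congr (_ *m _); rewrite mulmx_diag; congr diag_mx.
by apply/rowP => j; rewrite !mxE -expr2 sqr_sqrtr// ltW.
Qed.

Lemma sqrtmxP n (A : 'M[R]_n) : spd A -> spd (sqrtmx A) /\ sqrtmx A *m sqrtmx A = A.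
Proof. by move=> /spd_sqrt; exact: getPex. Qed.

Lemma spd_invmx n (A : 'M[R]_n) : spd A -> spd (invmx A).
Proof.
move=> As; have uA := spd_unitmx As; have [AT _] := As.
have -> : invmx A = invmx A *m A *m (invmx A)^T.
  by rewrite mulVmx// mul1mx trmx_inv AT.
by apply: spd_congr => //; rewrite unitmx_inv.
Qed.

(** With [S] the square root of [G], the spectral theorem for [invmx S *m Q *m invmx S] gives a
    basis, the rows of [P], that is orthonormal for [G] and orthogonal for [Q]. *)
Lemma pencil_diagonalization n (Q G : 'M[R]_n) : Q^T = Q -> spd G ->
  exists (P : 'M[R]_n) (d : 'rV[R]_n), [/\ P *m G *m P^T = 1%:M,
    P *m Q *m P^T = diag_mx d & forall i j : 'I_n, (i <= j)%N -> d 0 j <= d 0 i].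
Proof.
move=> QT Gs; have [S [Ss SG]] := spd_sqrt Gs.
have uS := spd_unitmx Ss; have [ST _] := Ss.
have iST : (invmx S)^T = invmx S by rewrite trmx_inv ST.
have [|P [d [PP E ds]]] := @spectral_decomposition _ (invmx S *m Q *m invmx S).
  by rewrite !trmx_mul iST QT mulmxA.
exists (P *m invmx S), d; split=> //; rewrite trmx_mul iST !mulmxA.
  by rewrite -SG -!mulmxA (mulmxA (invmx S) S) mulVmx// mul1mx (mulmxA S) mulmxV// mul1mx.
rewrite -(mulmxA P) -(mulmxA P) E !mulmxA PP mul1mx -mulmxA PP.
by rewrite mulmx1.
Qed.

Definition row_seq n (d : 'rV[R]_n) : seq R := [seq d 0 j | j <- enum 'I_n].

Lemma nth_row_seq n (d : 'rV[R]_n) i (ni : (i < n)%N) :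
  nth 0 (row_seq d) i = d 0 (Ordinal ni).
Proof.
rewrite /row_seq (nth_map (Ordinal ni)) ?size_enum_ord//.
by congr (d _ _); apply: val_inj; rewrite /= nth_enum_ord.
Qed.

Lemma sorted_row_seq n (d : 'rV[R]_n) :
  (forall i j : 'I_n, (i <= j)%N -> d 0 j <= d 0 i) -> sorted >=%R (row_seq d).
Proof.
move=> dd; rewrite /row_seq sorted_map.
have : sorted leq (map val (enum 'I_n)) by rewrite val_enum_ord iota_sorted.
by rewrite sorted_map; apply: sub_sorted => i j; exact: dd.
Qed.

Lemma char_poly_similar n (P A A' : 'M[R]_n) : P \in unitmx ->
  P *m A = A' *m P -> char_poly A = char_poly A'.
Proof.
move=> uP PA; have dP0 : \det (map_mx polyC P) != 0.
  by rewrite det_map_mx polyC_eq0 -unitfE -unitmxE.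
apply: (mulfI dP0); rewrite /char_poly -det_mulmx.
have -> : map_mx polyC P *m char_poly_mx A = char_poly_mx A' *m map_mx polyC P.
  rewrite /char_poly_mx mulmxBr mulmxBl -!map_mxM PA; congr (_ - _).
  by rewrite mul_mx_scalar mul_scalar_mx.
by rewrite det_mulmx mulrC.
Qed.

Lemma is_eigenvalues_diag n (A P : 'M[R]_n) (d : 'rV[R]_n) : P \in unitmx ->
  P *m A = diag_mx d *m P ->
  (forall i j : 'I_n, (i <= j)%N -> d 0 j <= d 0 i) ->
  is_eigenvalues A (row_seq d).
Proof.
move=> uP PA dd; split; first exact: sorted_row_seq.
rewrite (char_poly_similar uP PA) char_poly_trig ?diag_mx_is_trig//.
rewrite /row_seq big_map big_enum /=; apply: eq_big => // j _.
by rewrite mxE eqxx mulr1n.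
Qed.

Lemma is_eigenvalues_uniq n n' (A : 'M[R]_n) (A' : 'M[R]_n') s t :
  char_poly A = char_poly A' ->
  is_eigenvalues A s -> is_eigenvalues A' t -> s = t.
Proof.
move=> cA [ss sA] [tt tA]; apply: sorted_eq ss tt _.
- by move=> x y z /= xy yz; exact: le_trans yz xy.
- by move=> x y /=; rewrite andbC => /le_anti.
- by apply: prod_XsubC_eq; rewrite -sA -tA.
Qed.

Lemma eigenvalues_diag n (A P : 'M[R]_n) (d : 'rV[R]_n) : P \in unitmx ->
  P *m A = diag_mx d *m P ->
  (forall i j : 'I_n, (i <= j)%N -> d 0 j <= d 0 i) ->
  eigenvalues A = row_seq d.
Proof.
move=> uP PA dd; have H := is_eigenvalues_diag uP PA dd.
rewrite /eigenvalues; case: xgetP => [s _ sA|/(_ (row_seq d))//].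
exact: is_eigenvalues_uniq sA H.
Qed.

End QuadraticForms.

(** * Comparison of eigenvalues *)

Section Pencils.
Variable R : realType.

Lemma invmx_uniq n (A B : 'M[R]_n) : A *m B = 1%:M -> invmx B = A.
Proof.
by move=> AB; have [_ uB] := mulmx1_unit AB; rewrite -[RHS](mulmxK uB) AB mul1mx.
Qed.

Lemma qform_mul m n (A : 'M[R]_n) (P : 'M[R]_(m, n)) y :
  qform A (y *m P) = qform (P *m A *m P^T) y.
Proof. by rewrite /qform trmx_mul !mulmxA. Qed.

Lemma qform_diag n (d y : 'rV[R]_n) :
  qform (diag_mx d) y = \sum_j d 0 j * y 0 j ^+ 2.
Proof.
have := diag_conj_qform 1%:M d y.
by rewrite trmx1 mulmx1 mul1mx => ->; rewrite mulmx1.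
Qed.

(* The spans of the first i+1 generalised eigenvectors of one pencil and of the
   last n-i of the other have a common nonzero vector. *)
Lemma pencil_crossing n (Q G1 G2 P1 P2 : 'M[R]_n) (d1 d2 : 'rV[R]_n) (i : 'I_n) :
  P1 *m G1 *m P1^T = 1%:M -> P1 *m Q *m P1^T = diag_mx d1 ->
  (forall i j : 'I_n, (i <= j)%N -> d1 0 j <= d1 0 i) ->
  P2 *m G2 *m P2^T = 1%:M -> P2 *m Q *m P2^T = diag_mx d2 ->
  (forall i j : 'I_n, (i <= j)%N -> d2 0 j <= d2 0 i) ->
  exists2 x, x != 0 & d1 0 i * qform G1 x <= qform Q x <= d2 0 i * qform G2 x.
Proof.
move=> G1E Q1E d1s G2E Q2E d2s.
have uP1 : P1 \in unitmx.
  by have /mulmx1_unit[] : P1 *m (G1 *m P1^T) = 1%:M by rewrite mulmxA.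
have uP2 : P2 \in unitmx.
  by have /mulmx1_unit[] : P2 *m (G2 *m P2^T) = 1%:M by rewrite mulmxA.
(* Both spans include index [i], so the dimensions [i + 1] and [n - i] add up to [n + 1]. *)
pose A : 'M[R]_n := pid_mx i.+1 *m P1; pose B : 'M[R]_n := copid_mx i *m P2.
have rA : \rank A = i.+1 by rewrite mxrankMfree ?row_free_unit// rank_pid_mx.
have rB : \rank B = (n - i)%N by rewrite mxrankMfree ?row_free_unit// rank_copid_mx// ltnW.
have /rowV0Pn[x] : (A :&: B)%MS != 0.
  rewrite -mxrank_eq0 -lt0n.
  have := mxrank_sum_cap A B; rewrite rA rB.
  have := rank_leq_col (A + B)%MS; have := ltn_ord i.
  move: (\rank _) (\rank _) => a b; lia.
rewrite sub_capmx => /andP[/submxP[c xA] /submxP[e xB]] x0; exists x => //.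
pose y := c *m (pid_mx i.+1 : 'M[R]_n); pose z := e *m (copid_mx i : 'M[R]_n).
have xy : x = y *m P1 by rewrite xA /A mulmxA.
have xz : x = z *m P2 by rewrite xB /B mulmxA.
have y0 (j : 'I_n) : (i < j)%N -> y 0 j = 0.
  move=> ij; rewrite mxE big1// => k _; rewrite mxE.
  case: eqP => [->|] /=; last by rewrite mulr0.
  by rewrite ltnS leqNgt ij mulr0.
have z0 (j : 'I_n) : (j < i)%N -> z 0 j = 0.
  move=> ji; rewrite /z /copid_mx mulmxBr mulmx1 mxE [X in _ + X]mxE mxE.
  rewrite (bigD1 j)//= big1 => [|k kj]; rewrite !mxE.
    by rewrite eqxx ji mulr1 addr0 subrr.
  by rewrite (inj_eq val_inj) (negbTE kj) mulr0.
move: (y) (z) xy xz y0 z0 => {}y {}z xy xz y0 z0.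
apply/andP; split.
  rewrite {1}xy xy !qform_mul G1E Q1E qform_diag -sqnorm_qform sqnormE mulr_sumr.
  apply: ler_sum => j _; have [ij|ji] := ltnP i j.
    by rewrite y0// expr0n mulr0 mulr0.
  by apply: ler_wpM2r; [exact: sqr_ge0|exact: d1s].
rewrite {1}xz xz !qform_mul G2E Q2E qform_diag -sqnorm_qform sqnormE mulr_sumr.
apply: ler_sum => j _; have [ij|ji] := ltnP j i.
  by rewrite z0// expr0n mulr0 mulr0.
by apply: ler_wpM2r; [exact: sqr_ge0|exact: d2s].
Qed.

(** With coordinates in rows, [Q *m invmx G] is the matrix of the operator that the inner product
    [G] associates with the form [Q]. Since [invmx G = P^T *m P], conjugation by [P] makes it
    diagonal. *)
Lemma pencil_eigenvalues n (Q G P : 'M[R]_n) (d : 'rV[R]_n) : spd G ->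
  P *m G *m P^T = 1%:M -> P *m Q *m P^T = diag_mx d ->
  (forall i j : 'I_n, (i <= j)%N -> d 0 j <= d 0 i) ->
  is_eigenvalues (Q *m invmx G) (row_seq d).
Proof.
move=> Gs GE QE ds.
have uP : P \in unitmx by have /mulmx1_unit[] : P *m (G *m P^T) = 1%:M by rewrite mulmxA.
apply: (is_eigenvalues_diag uP) => //; rewrite -QE.
have -> : invmx G = P^T *m P.
  by apply: invmx_uniq; rewrite -mulmxA; apply: mulmx1C.
by rewrite !mulmxA.
Qed.

(** A crossing vector [x] gives [d2 * qform G2 x <= d1 * qform G1 x] for the i-th eigenvalues, and
    another one the reverse inequality. Replacing [qform G2 x] by a multiple of [qform G1 x] uses
    [a] or [b] according to the sign of [d2], whence the minimum and maximum. *)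
Lemma pencil_sandwich n (Q G1 G2 : 'M[R]_n) a b s1 s2 :
  Q^T = Q -> spd G1 -> spd G2 ->
  (forall x, a * qform G1 x <= qform G2 x <= b * qform G1 x) ->
  is_eigenvalues (Q *m invmx G1) s1 -> is_eigenvalues (Q *m invmx G2) s2 ->
  size s1 = n /\ forall i, (i < n)%N ->
  sandwiched (nth 0 s1 i) (a * nth 0 s2 i) (b * nth 0 s2 i).
Proof.
move=> QT G1s G2s ab.
have [P1 [d1 [G1E Q1E d1s]]] := pencil_diagonalization QT G1s.
have [P2 [d2 [G2E Q2E d2s]]] := pencil_diagonalization QT G2s.
move=> /(is_eigenvalues_uniq erefl) -/(_ _ (pencil_eigenvalues G1s G1E Q1E d1s)) ->.
move=> /(is_eigenvalues_uniq erefl) -/(_ _ (pencil_eigenvalues G2s G2E Q2E d2s)) ->.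
split=> [|k kn]; first by rewrite size_map size_enum_ord.
rewrite !nth_row_seq; set i := Ordinal kn.
apply/andP; split.
  have [x x0 /andP[l u]] := pencil_crossing i G2E Q2E d2s G1E Q1E d1s.
  have /andP[h1 h2] := ab x.
  have /spdP[_ /(_ x x0) q1] := G1s; rewrite ge_min.
  have [d0|d0] := leP 0 (d2 0 i); apply/orP; [left|right];
    rewrite -(ler_pM2r q1); apply: le_trans u; apply: le_trans l; nra.
have [x x0 /andP[l u]] := pencil_crossing i G1E Q1E d1s G2E Q2E d2s.
have /andP[h1 h2] := ab x.
have /spdP[_ /(_ x x0) q1] := G1s; rewrite le_max.
have [d0|d0] := leP 0 (d2 0 i); apply/orP; [right|left];
  rewrite -(ler_pM2r q1); apply: le_trans l _; apply: le_trans u _; nra.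
Qed.

Lemma pencil_is_eigenvalues n (Q G : 'M[R]_n) : Q^T = Q -> spd G ->
  exists s, is_eigenvalues (Q *m invmx G) s.
Proof.
move=> QT Gs; have [P [d [GE QE ds]]] := pencil_diagonalization QT Gs.
by exists (row_seq d); exact: pencil_eigenvalues GE QE ds.
Qed.

Lemma conjmx_mul n (P D D' : 'M[R]_n) : P *m P^T = 1%:M ->
  P^T *m D *m P *m (P^T *m D' *m P) = P^T *m (D *m D') *m P.
Proof. by move=> PP; rewrite !mulmxA -(mulmxA (P^T *m D)) PP mulmx1. Qed.

Lemma invmx_spectral n (P : 'M[R]_n) (d : 'rV[R]_n) : P *m P^T = 1%:M ->
  (forall j, 0 < d 0 j) ->
  invmx (P^T *m diag_mx d *m P) = P^T *m diag_mx (map_mx GRing.inv d) *m P.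
Proof.
move=> PP d0; pose N := P^T *m diag_mx d *m P.
have NE : P^T *m diag_mx (map_mx GRing.inv d) *m P *m N = 1%:M.
  rewrite /N !mulmxA -(mulmxA _ P) PP mulmx1 -(mulmxA P^T) mulmx_diag.
  have -> : \row_j (map_mx GRing.inv d 0 j * d 0 j) = const_mx 1.
    by apply/rowP => j; rewrite !mxE mulVf// gt_eqF.
  by rewrite diag_const_mx mulmx1; exact: mulmx1C.
exact: invmx_uniq.
Qed.

Lemma sigma_sqr m n (A : 'M[R]_(m, n)) (P : 'M[R]_n) (d : 'rV[R]_n) i
    (ni : (i < n)%N) :
  P *m P^T = 1%:M -> A^T *m A = P^T *m diag_mx d *m P ->
  (forall i j : 'I_n, (i <= j)%N -> d 0 j <= d 0 i) ->
  (forall j, 0 <= d 0 j) -> sigma i.+1 A ^+ 2 = d 0 (Ordinal ni).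
Proof.
move=> PP AE ds d0; rewrite /sigma /=.
rewrite (eigenvalues_diag (orthogonal_unitmx PP) _ ds); last first.
  by rewrite AE !mulmxA PP mul1mx.
by rewrite nth_row_seq sqr_sqrtr.
Qed.

(** In an eigenbasis of [M^T *m M] with eigenvalues d_j, the inverse form is the sum of y_j^2 / d_j
    and the squared norm the sum of y_j^2; the extreme d_j are squares of the extreme singular
    values. *)
Lemma sigma_bounds_inv m n (M : 'M[R]_(m, n)) : (0 < n)%N ->
  spd (M^T *m M) -> forall x : 'rV[R]_n,
  sigma n M ^+ 2 * qform (invmx (M^T *m M)) x <= sqnorm x <=
  sigma 1 M ^+ 2 * qform (invmx (M^T *m M)) x.
Proof.
case: n M => // n M _ /spd_spectral[P [d [PP NE ds d0]]] x.
have d0' j : 0 <= d 0 j by exact: ltW.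
rewrite (sigma_sqr (ltnSn n) PP NE ds d0') (sigma_sqr (ltn0Sn n) PP NE ds d0').
rewrite NE invmx_spectral// diag_conj_qform.
have -> : sqnorm x = \sum_j (x *m P^T) 0 j ^+ 2.
  rewrite -sqnormE /sqnorm trmx_mul trmxK mulmxA -(mulmxA x).
  by rewrite (mulmx1C PP) mulmx1.
rewrite !mulr_sumr; apply/andP; split; apply: ler_sum => j _;
  rewrite [map_mx _ _ _ _]mxE mulrA.
  apply: ler_piMl; first exact: sqr_ge0.
  by rewrite ler_pdivrMr// mul1r; apply: ds; rewrite /= -ltnS.
apply: ler_peMl; first exact: sqr_ge0.
by rewrite ler_pdivlMr// mul1r; exact: ds.
Qed.

Lemma trace_mulmx_tr m n (A : 'M[R]_n) (E : 'M[R]_(m, n)) :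
  \tr (E *m A *m E^T) = \sum_i qform A (row i E).
Proof. by apply: eq_bigr => i _; rewrite qform_row. Qed.

(** For M = V^(-1/2) B one has (M^T M)^-1 = B^-1 V B^-1. Hence tr(V D^T D) is the inverse form of
    M^T M summed over the rows of D B, which is where the singular values of M come from. *)
Lemma V_weight_bounds m n (V B : 'M[R]_n) (D : 'M[R]_(m, n)) : (0 < n)%N ->
  spd V -> spd B ->
  sigma n (invmx (sqrtmx V) *m B) ^+ 2 * \tr (V *m D^T *m D) <=
  \tr (D *m B *m (D *m B)^T) <=
  sigma 1 (invmx (sqrtmx V) *m B) ^+ 2 * \tr (V *m D^T *m D).
Proof.
move=> n0 Vs Bs; have [] := sqrtmxP Vs.
move: (sqrtmx V) => S Ss SS; set M := invmx _ *m B.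
have uS := spd_unitmx Ss; have uB := spd_unitmx Bs.
have [ST _] := Ss; have [BT _] := Bs.
have uM : M \in unitmx by rewrite unitmx_mul unitmx_inv uS.
have Ns : spd (M^T *m M).
  rewrite -[M^T]mulmx1 -{2}[M]trmxK; apply: spd_congr; last by rewrite unitmx_tr.
  rewrite -diag_const_mx; apply: spd_diag => j; rewrite mxE; exact: ltr01.
have -> : \tr (V *m D^T *m D) = \tr (D *m B *m invmx (M^T *m M) *m (D *m B)^T).
  have -> : invmx (M^T *m M) = invmx B *m V *m invmx B.
    have h : invmx B *m V *m invmx B *m (M^T *m M) = 1%:M.
      rewrite /M trmx_mul BT trmx_inv ST -SS !mulmxA mulmxKV// -(mulmxA _ S).
      by rewrite mulmxV// mulmx1 mulmxK// mulVmx.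
    exact: invmx_uniq.
  rewrite trmx_mul BT !mulmxA mulmxK// -(mulmxA _ (invmx B)) mulVmx// mulmx1.
  by rewrite mxtrace_mulC mulmxA.
have -> : \tr (D *m B *m (D *m B)^T) = \sum_i sqnorm (row i (D *m B)).
  rewrite -{1}[D *m B]mulmx1 trace_mulmx_tr; apply: eq_bigr => i _.
  by rewrite sqnorm_qform.
rewrite trace_mulmx_tr !mulr_sumr.
by apply/andP; split; apply: ler_sum => i _;
  have /andP[] := sigma_bounds_inv n0 Ns (row i (D *m B)).
Qed.

(** In an eigenbasis of W^-1 with eigenvalues k_i, the weighted trace is the sum of T'_ij^2 / (k_i
    k_j) and the plain one the sum of T'_ij^2. Each product k_i k_j lies between the squares of the
    extreme eigenvalues. *)
Lemma W_weight_bounds n (W T : 'M[R]_n) : (0 < n)%N -> spd W -> T^T = T ->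
  sigma n (invmx W) ^+ 2 * \tr (W *m T *m W *m T) <= \tr (T *m T^T) <=
  sigma 1 (invmx W) ^+ 2 * \tr (W *m T *m W *m T).
Proof.
move=> n0 Ws TT; have Ks := spd_invmx Ws; have [KT _] := Ks.
have [P [k [PP KE ks k0]]] := spd_spectral Ks.
have PTP := mulmx1C PP.
pose k2 : 'rV[R]_n := map_mx (fun x => x ^+ 2) k.
have K2E : (invmx W)^T *m invmx W = P^T *m diag_mx k2 *m P.
  rewrite KT KE conjmx_mul// mulmx_diag.
  by congr (_ *m diag_mx _ *m _); apply/rowP => j; rewrite !mxE expr2.
have k2s (i j : 'I_n) : (i <= j)%N -> k2 0 j <= k2 0 i.
  by move=> ij; rewrite !mxE ler_pXn2r ?nnegrE ?ks// ltW.
have k2E j : k2 0 j = k 0 j ^+ 2 by rewrite mxE.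
have k20 j : 0 <= k2 0 j by rewrite mxE sqr_ge0.
have WE : W = P^T *m diag_mx (map_mx GRing.inv k) *m P.
  by rewrite -invmx_spectral// -KE invmxK.
pose T' := P *m T *m P^T.
have T'T : T'^T = T' by rewrite /T' !trmx_mul trmxK TT mulmxA.
have T'C i j : T' j i = T' i j by have /matrixP /(_ i j) := T'T; rewrite mxE.
have -> : \tr (T *m T^T) = \sum_i \sum_j T' i j ^+ 2.
  have -> : T *m T^T = P^T *m (T' *m T') *m P.
    by rewrite TT /T' !mulmxA PTP mul1mx -(mulmxA _ P^T) PTP mulmx1 -(mulmxA _ P^T) PTP mulmx1.
  rewrite mxtrace_mulC (mulmxA P P^T) PP mul1mx; apply: eq_bigr => i _.
  by rewrite mxE; apply: eq_bigr => j _; rewrite (T'C i j) expr2.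
have -> : \tr (W *m T *m W *m T) = \sum_i \sum_j (k 0 i)^-1 * (k 0 j)^-1 * T' i j ^+ 2.
  pose Dk := diag_mx (map_mx GRing.inv k).
  have -> : W *m T *m W *m T = P^T *m (Dk *m T' *m Dk *m T') *m P.
    rewrite WE -/Dk /T' !mulmxA -(mulmxA _ P^T P) PTP mulmx1.
    by rewrite -!mulmxA.
  rewrite mxtrace_mulC (mulmxA P P^T) PP mul1mx; apply: eq_bigr => i _.
  rewrite mxE; apply: eq_bigr => j _.
  have -> : (Dk *m T' *m Dk) i j = (k 0 i)^-1 * T' i j * (k 0 j)^-1.
    rewrite /Dk mul_diag_mx mul_mx_diag; move: (T') => T''.
    by rewrite !mxE.
  by rewrite (T'C i j) expr2; ring.
move: (T') => T'' in T'T T'C *; clear - n0 PP K2E k2s k20 k0 ks k2E.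
case: n n0 W P k PP ks k0 k2 K2E k2s k2E k20 T'' => // n _ W P k PP ks k0 k2 K2E k2s k2E k20 T'.
rewrite (sigma_sqr (ltnSn n) PP K2E k2s k20) (sigma_sqr (ltn0Sn n) PP K2E k2s k20).
have kk (i j : 'I_n.+1) : 0 < k 0 i * k 0 j by rewrite mulr_gt0.
rewrite !mulr_sumr; apply/andP; split; apply: ler_sum => i _; rewrite mulr_sumr;
  apply: ler_sum => j _; rewrite k2E mulrA -invfM.
  apply: ler_piMl; first exact: sqr_ge0.
  rewrite ler_pdivrMr// mul1r expr2.
  by apply: (ler_pM (ltW (k0 _)) (ltW (k0 _))); apply: ks; rewrite /= -ltnS.
apply: ler_peMl; first exact: sqr_ge0.
rewrite ler_pdivlMr// mul1r expr2.
by apply: (ler_pM (ltW (k0 _)) (ltW (k0 _))); apply: ks.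
Qed.

(** * Orthonormal complements *)

(** [row_mx U K] is square up to the identity [r + (p - r) = p], so its left inverse is also a right
    inverse. *)
Lemma mulmx_trU p r (U : 'M[R]_(p, r)) (K : 'M[R]_(p, p - r)) : (r <= p)%N ->
  U^T *m U = 1%:M -> K^T *m K = 1%:M -> U^T *m K = 0 ->
  U *m U^T + K *m K^T = 1%:M.
Proof.
move=> rp UU KK UK.
have e : (r + (p - r) = p)%N by rewrite subnKC.
pose S := row_mx U K.
have SS : S^T *m S = 1%:M.
  rewrite tr_row_mx mul_col_row UU KK UK -[K^T *m U]trmxK trmx_mul trmxK UK trmx0.
  by rewrite -scalar_mx_block.
have : S *m S^T = 1%:M.
  move: S SS; rewrite e => S; exact: mulmx1C.
by rewrite tr_row_mx mul_row_col.
Qed.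

(** A basis [N] of the left kernel of [U] is orthonormalised at once by the inverse square root of
    its Gram matrix [N *m N^T]. *)
Lemma perp_exists p r (U : 'M[R]_(p, r)) : (r <= p)%N -> U^T *m U = 1%:M ->
  exists K : 'M[R]_(p, p - r), K^T *m K = 1%:M /\ U^T *m K = 0.
Proof.
move=> rp UU.
have rU : \rank U = r.
  apply/eqP; rewrite eqn_leq rank_leq_col /= -[X in (X <= _)%N](mxrank1 R) -UU.
  by rewrite mxrankM_maxr.
have rK : \rank (kermx U) = (p - r)%N by rewrite mxrank_ker rU.
have [N [fN NU]] : exists N : 'M[R]_(p - r, p), row_free N /\ N *m U = 0.
  rewrite -rK; exists (row_base (kermx U)); split; first exact: row_base_free.
  by apply/sub_kermxP; rewrite eq_row_base.
have Gs : spd (N *m N^T).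
  apply/spdP; split; first by rewrite trmx_mul trmxK.
  move=> x x0; have -> : qform (N *m N^T) x = sqnorm (x *m N).
    by rewrite /qform /sqnorm trmx_mul !mulmxA.
  rewrite sqnorm_gt0; apply: contra x0 => /eqP xN.
  by apply/eqP; apply: (row_free_inj fN); rewrite xN mul0mx.
have [S [Ss SS]] := spd_sqrt Gs; have uS := spd_unitmx Ss; have [ST _] := Ss.
exists (N^T *m invmx S); split.
  rewrite trmx_mul trmxK trmx_inv ST mulmxA -(mulmxA _ N) -SS.
  by rewrite mulmxA mulVmx// mul1mx mulmxV.
by rewrite mulmxA -[U^T *m _]trmxK trmx_mul !trmxK NU trmx0 mul0mx.
Qed.

Lemma perpP p r (U : 'M[R]_(p, r)) : (r <= p)%N -> stiefel U ->
  [/\ (perp U)^T *m perp U = 1%:M, U^T *m perp U = 0 &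
  U *m U^T + perp U *m (perp U)^T = 1%:M].
Proof.
move=> rp UU; have /getPex [KK UK] := perp_exists rp UU.
by split=> //; exact: mulmx_trU.
Qed.

End Pencils.

(** * Openness of positive definiteness among symmetric matrices *)

Section Spd.
Variable R : realType.

Lemma spd_lower_bound n (B : 'M[R]_n) : spd B ->
  exists2 m, 0 < m & forall x, m * sqnorm x <= qform B x.
Proof.
case: n B => [|n] B Bs.
  by exists 1 => // x; rewrite [x]thinmx0 /sqnorm /qform !mul0mx mxE mulr0.
have [P [d [PP -> ds d0]]] := spd_spectral Bs.
exists (d 0 ord_max) => // x; rewrite diag_conj_qform.
have -> : sqnorm x = sqnorm (x *m P^T).
  by rewrite /sqnorm trmx_mul trmxK mulmxA -(mulmxA x) (mulmx1C PP) mulmx1.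
rewrite sqnormE mulr_sumr; apply: ler_sum => j _.
by apply: ler_wpM2r; [exact: sqr_ge0|apply: ds; rewrite /= -ltnS].
Qed.

(** The bound |x_i x_j| <= (x_i^2 + x_j^2) / 2, summed over all pairs, gives n times the squared
    norm. *)
Lemma qform_lower_bound n (E : 'M[R]_n) e x : (forall i j, `|E i j| <= e) ->
  - (e * n%:R * sqnorm x) <= qform E x.
Proof.
move=> Ee.
have -> : qform E x = \sum_i \sum_j x 0 j * E j i * x 0 i.
  rewrite /qform mxE; apply: eq_bigr => i _; rewrite !mxE big_distrl /=.
  by apply: eq_bigr.
have -> : - (e * n%:R * sqnorm x) =
    \sum_(i < n) \sum_(j < n) - (e * ((x 0 i ^+ 2 + x 0 j ^+ 2) / 2)).
  rewrite sqnormE; transitivity (- (e / 2 * (\sum_(i < n) \sum_(j < n) x 0 i ^+ 2 +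
     \sum_(i < n) \sum_(j < n) x 0 j ^+ 2))).
    have cst (c : R) : \sum_(j < n) c = n%:R * c.
      by rewrite big_const card_ord iter_addr_0 mulr_natl.
    have -> : \sum_(i < n) \sum_(j < n) x 0 i ^+ 2 = n%:R * \sum_j x 0 j ^+ 2.
      by rewrite mulr_sumr; apply: eq_bigr => i _; exact: cst.
    by rewrite cst; field.
  rewrite -big_split /= mulr_sumr -sumrN; apply: eq_bigr => i _.
  rewrite -big_split /= mulr_sumr -sumrN; apply: eq_bigr => j _; by field.
apply: ler_sum => i _; apply: ler_sum => j _.
have := Ee j i; rewrite ler_norml => /andP[h1 h2].
have h : `|x 0 j * x 0 i| <= (x 0 i ^+ 2 + x 0 j ^+ 2) / 2.
  rewrite ler_norml; have := sqr_ge0 (x 0 i + x 0 j); have := sqr_ge0 (x 0 i - x 0 j).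
  by move=> *; apply/andP; split; nra.
have e0 : 0 <= e by exact: le_trans (normr_ge0 _) (Ee j i).
rewrite mulrAC lerNl; apply: le_trans (_ : `|x 0 j * x 0 i * E j i| <= _).
  by rewrite -normrN ler_norm.
by rewrite normrM mulrC; apply: ler_pM.
Qed.

Lemma qform_addl n (A B : 'M[R]_n) x : qform (A + B) x = qform A x + qform B x.
Proof. by rewrite /qform mulmxDr mulmxDl mxE. Qed.

Lemma spd_open n (B : 'M[R]_n) : spd B -> exists2 e, 0 < e &
  forall A : 'M[R]_n, A^T = A -> (forall i j, `|A i j - B i j| < e) -> spd A.
Proof.
move=> Bs; have [m m0 mB] := spd_lower_bound Bs.
(* A perturbation of this size costs at most [m * n / (n + 1)] times the squared norm, strictly less
   than the lower bound [m]; the successor also covers [n = 0]. *)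
exists (m / n.+1%:R) => [|A AT AB]; first by rewrite divr_gt0.
apply/spdP; split=> // x x0.
have -> : qform A x = qform B x + qform (A - B) x.
  by rewrite -qform_addl addrC subrK.
have /(qform_lower_bound x) h : forall i j, `|(A - B) i j| <= m / n.+1%:R.
  by move=> i j; rewrite !mxE ltW.
have s0 : 0 < sqnorm x by rewrite sqnorm_gt0.
have h2 := mB x.
have : 0 < m * sqnorm x - m / n.+1%:R * n%:R * sqnorm x.
  have -> : m * sqnorm x - m / n.+1%:R * n%:R * sqnorm x = m * sqnorm x / n.+1%:R.
    rewrite -[in LHS]natr1 -[in RHS]natr1; field.
    by rewrite natr1 pnatr_eq0.
  by rewrite divr_gt0// mulr_gt0.
rewrite subr_gt0 => h3; apply: lt_le_trans (lerD h2 h).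
by rewrite subr_gt0.
Qed.

Lemma near_spd (V : normedModType R) n (F : V -> 'M[R]_n) x : spd (F x) ->
  (forall y, (F y)^T = F y) -> {for x, continuous F} -> \near x, spd (F x).
Proof.
move=> /spd_open[e e0 eF] FT cF.
have H : \forall y \near x, forall ij, `|F y ij.1 ij.2 - F x ij.1 ij.2| < e.
  apply: filter_forall => -[i j] /=.
  have : (F y i j) @[y --> x] --> F x i j.
    by apply: (cvg_comp F (fun N => N i j) cF); exact: coord_continuous.
  move=> /cvgrPdist_lt /(_ e e0); apply: filterS => y; by rewrite distrC.
by apply: filterS H => y h; apply: eF => // i j; exact: (h (i, j)).
Qed.

End Spd.

(** * Tangent spaces and charts *)

Section Embedded.
Variables (R : realType) (p r : nat).
Implicit Types (U Z : 'M[R]_(p, r)) (B C : 'M[R]_r).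

(** Only a left inverse of [Z] is asked for, because the columns of [U + K *m D] in the embedded
    chart are not orthonormal; there [Y = U^T]. *)
Lemma embedded_psd_mul (Y : 'M[R]_(r, p)) Z C : Y *m Z = 1%:M -> spd C ->
  @embedded_psd R p r (Z *m C *m Z^T).
Proof.
move=> YZ Cs; have [CT _] := Cs; split; first split.
- by rewrite /is_sym !trmx_mul trmxK CT mulmxA.
- move=> v; have := spd_qform_ge0 (v^T *m Z) Cs.
  by rewrite /qform !trmx_mul trmxK !mulmxA.
- apply/eqP; rewrite eqn_leq; apply/andP; split.
    by apply: leq_trans (mxrankM_maxr _ _) _; exact: rank_leq_row.
  have rC : \rank C = r by apply: mxrank_unit; exact: spd_unitmx.
  rewrite -[X in (X <= _)%N]rC.
  have {1}-> : C = Y *m (Z *m C *m Z^T) *m Y^T.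
    by rewrite !mulmxA YZ mul1mx -mulmxA -trmx_mul YZ trmx1 mulmx1.
  by apply: leq_trans (mxrankM_maxl _ _) _; exact: mxrankM_maxr.
Qed.

Section Base.
Variables (U : 'M[R]_(p, r)) (B : 'M[R]_r).
Hypotheses (rp : (r <= p)%N) (hU : stiefel U) (hB : spd B).
Let K := perp U.
Let X := U *m B *m U^T.

Lemma perp_tr : K^T *m K = 1%:M. Proof. by have [] := perpP rp hU. Qed.
Lemma tr_mul_perp : U^T *m K = 0. Proof. by have [] := perpP rp hU. Qed.
Lemma perp_mul_tr : K^T *m U = 0.
Proof. by rewrite -[LHS]trmxK trmx_mul trmxK tr_mul_perp trmx0. Qed.
Lemma perp_resolution : U *m U^T + K *m K^T = 1%:M.
Proof. by have [] := perpP rp hU. Qed.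

Lemma Lmap_sym theta : is_sym theta.2 -> is_sym (Lmap (U, B) theta).
Proof.
move=> T; have [BT _] := hB; rewrite /is_sym /Lmap /= !linearD /= !trmx_mul.
by rewrite !trmxK BT T !mulmxA addrC addrA addrAC.
Qed.

Lemma perp_Lmap theta : K^T *m Lmap (U, B) theta *m K = 0.
Proof.
rewrite /Lmap /= !mulmxDr !mulmxDl !mulmxA perp_mul_tr !mul0mx !add0r.
by rewrite -!mulmxA tr_mul_perp !mulmx0.
Qed.

(** Cut [xi] into four blocks along [U] and [K]. The missing one vanishes, and the other three are
    the terms of [Lmap]; [invmx B] cancels the [B] that [Lmap] puts next to the first component. *)
Lemma Lmap_surj xi : is_sym xi -> K^T *m xi *m K = 0 ->
  xi = Lmap (U, B) (K *m (K^T *m xi *m U *m invmx B), U^T *m xi *m U).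
Proof.
move=> xiT xiK; have [BT _] := hB; have uB := spd_unitmx hB.
have iBT : (invmx B)^T = invmx B by rewrite trmx_inv BT.
rewrite /Lmap /= !trmx_mul !trmxK iBT xiT !mulmxA.
rewrite -(mulmxA U B) mulmxV// mulmx1 -(mulmxA _ (invmx B)) mulVmx// mulmx1.
have P1 := perp_resolution.
have {1}-> : xi = (U *m U^T + K *m K^T) *m xi *m (U *m U^T + K *m K^T).
  by rewrite P1 mul1mx mulmx1.
rewrite !mulmxDl !mulmxDr !mulmxA -(mulmxA K) -(mulmxA K _ K) xiK mulmx0 mul0mx.
by rewrite addr0 [X in X + _ = _]addrC -!addrA.
Qed.

End Base.

Lemma affine_is_derive (V W : normedModType R) (D : V -> W) c x v :
  derivable D x v -> is_derive x v (fun y => c + D y) ('D_v D x).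
Proof.
move=> dD; have H := is_deriveD (is_derive_cst c x v) (derivableP dD).
by apply: is_derive_eq H _; rewrite add0r.
Qed.

Lemma derive_conj (V : normedModType R) (Z : V -> 'M[R]_(p, r)) (C : V -> 'M[R]_r) x v :
  derivable Z x v -> derivable C x v ->
  is_derive x v (fun y => Z y *m C y *m (Z y)^T)
    (Lmap (Z x, C x) ('D_v Z x, 'D_v C x)).
Proof.
move=> dZ dC.
have H1 := derive_mulmx dZ dC; have H2 := derive_trmx dZ.
have [d1 e1] := H1; have [d2 e2] := H2.
apply: is_derive_eq (derive_mulmx d1 d2) _.
by rewrite e1 e2 /Lmap /= mulmxDl addrC addrAC addrA.
Qed.

End Embedded.

Section CkMore.
Variables (R : realType) (V : normedModType R).

Lemma Ck_id k (A : set V) : Ck k A (fun x : V => x).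
Proof.
case: k => [|k]; first by move=> x _; exact: cvg_id.
split=> [x _|v]; first exact: (@ex_diff _ _ _ _ _ _ id).
have -> : (fun x => 'D_v (fun x : V => x) x) = (fun=> v).
  by apply/funext => x; exact: derive_id.
exact: Ck_cst.
Qed.

Lemma Ck_differentiable (W : normedModType R) (A : set V) (f : V -> W) x k :
  Ck k.+1 A f -> A x -> differentiable f x.
Proof. by move=> [df _] Ax; exact: df. Qed.

Lemma smooth_differentiable (W : normedModType R) (A : set V) (f : V -> W) x :
  smooth_on A f -> A x -> differentiable f x.
Proof. by move=> /(_ 1%N) Cf; exact: Ck_differentiable Cf. Qed.

Lemma Ck_sub (W : normedModType R) k (A B : set V) (f : V -> W) :
  A `<=` B -> Ck k B f -> Ck k A f.
Proof.
move=> AB; elim: k f => [|k IH] f; first by move=> Cf x /AB /Cf.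
by move=> [df Df]; split=> [x /AB /df|v] //; exact: IH (Df v).
Qed.

Lemma Ck_scalemx k (A : set V) m n (f : V -> R) (M : 'M[R]_(m, n)) :
  open A -> Ck k A f -> Ck k A (fun x => f x *: M).
Proof.
move=> oA Cf; apply/(Ck_mxP k _ oA) => i j.
apply: (Ck_eq (f := fun x => f x * M i j) oA) => [x _|]; first by rewrite mxE.
by apply: CkM => //; exact: Ck_cst.
Qed.

Lemma derive_mulmx_cst m n q l (A : 'M[R]_(m, n)) (M : V -> 'M[R]_(n, q))
    (B : 'M[R]_(q, l)) x v : derivable M x v ->
  is_derive x v (fun y => A *m M y *m B) (A *m 'D_v M x *m B).
Proof.
move=> dM; have H := derive_mulmx (derivable_cst A x v) dM; have [d1 e1] := H.
apply: is_derive_eq (derive_mulmx d1 (derivable_cst B x v)) _.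
rewrite e1 -/(cst A) -/(cst B) (derive_cst A) (derive_cst B).
by rewrite mul0mx mulmx0 add0r addr0.
Qed.

Lemma derive_sym n (M : V -> 'M[R]_n) x v : derivable M x v ->
  (\near x, (M x)^T = M x) -> ('D_v M x)^T = 'D_v M x.
Proof.
by move=> dM MT; rewrite -(is_deriveE (derive_trmx dM)); exact: near_eq_derive.
Qed.

End CkMore.

Section TangentEmbedded.
Variables (R : realType) (p r : nat) (U : 'M[R]_(p, r)) (B : 'M[R]_r).
Hypotheses (rp : (r <= p)%N) (hU : stiefel U) (hB : spd B).
Let K := perp U.
Let X := U *m B *m U^T.

Lemma embedded_psd_tangent_perp (c : R -> 'M[R]_p) I :
  open I -> I 0 -> smooth_on I c -> (forall t, I t -> embedded_psd r (c t)) ->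
  c 0 = X -> is_sym ('D_1 c 0) /\ K^T *m 'D_1 c 0 *m K = 0.
Proof.
move=> oI I0 sc cM c0.
have dc t : I t -> derivable c t 1.
  by move=> It; exact/diff_derivable/(smooth_differentiable sc It).
have nI : \forall t \near (0:R), I t by exact: open_nbhs_nbhs.
have xiT : ('D_1 c 0)^T = 'D_1 c 0.
  apply: derive_sym; first exact: dc.
  by apply: filterS nI => t /cM [[]].
split=> //; set xi := 'D_1 c 0 in xiT *.
have KxiT : (K^T *m xi *m K)^T = K^T *m xi *m K.
  by rewrite !trmx_mul trmxK xiT mulmxA.
have q0 x : qform (K^T *m xi *m K) x = 0.
  pose h t := ((x *m K^T) *m c t *m (K *m x^T)) 0 0.
  have hE t : I t -> is_derive t 1 h (((x *m K^T) *m 'D_1 c t *m (K *m x^T)) 0 0).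
    move=> It; have [d e] := derive_mulmx_cst (x *m K^T) (K *m x^T) (dc t It).
    have /derivable_mxP /(_ 0 0) dh := d.
    by apply: DeriveDef => //; rewrite -e -derive_coef.
  move: nI => /nbhs_ballP [e /= e0 eI].
  have inI t : t \in `]-e, e[ -> I t.
    rewrite in_itv /= => te; apply: eI; rewrite /ball /= sub0r normrN.
    by rewrite ltr_norml.
  have H := @derive1_at_min R h (- e) e 0 _ _ _ _.
  have h0 : h 0 = 0.
    rewrite /h c0 /X !mulmxA -(mulmxA x) (perp_mul_tr rp hU) mulmx0 !mul0mx.
    by rewrite mxE.
  have {}H : is_derive (0:R) (1:R) h 0.
    apply: H => [|t te||t te].
    - by rewrite ge0_cp// ltW.
    - by have [] := hE t (inI t te).
    - by rewrite in_itv /= oppr_lt0 e0.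
    - have [[_ ct0] _] := cM t (inI t te).
      rewrite h0 /h; have := ct0 (K *m x^T); by rewrite trmx_mul trmxK.
  have := is_deriveE (hE 0 I0); rewrite (is_deriveE H) => /esym.
  by rewrite /qform !mulmxA.
(* The form vanishes identically, so it is semidefinite and every vector is isotropic, hence in the
   kernel. *)
have Z (x : 'rV[R]_(p - r)) : x *m (K^T *m xi *m K) = 0.
  by apply: psd_qform_eq0 => // y; rewrite q0.
by rewrite -[LHS]mul1mx; apply/row_matrixP => i; rewrite row_mul Z row0.
Qed.

Section Charts.
Variables (V : normedModType R).
Variables (D : V -> 'M[R]_(p - r, r)) (S : V -> 'M[R]_r).
Hypotheses (sD : smooth_on setT D) (sS : smooth_on setT S).
Hypotheses (ST : forall y, (S y)^T = S y) (D0 : D 0 = 0) (S0 : S 0 = 0).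

(** The column space moves as a graph over the span of [U], and [B + S y] stays positive definite
    near 0. [D] and [S] are left arbitrary: linear in a real parameter they give a curve with
    prescribed velocity, and as coordinates they give a chart. *)
Definition embedded_chart y : 'M[R]_p :=
  (U + K *m D y) *m (B + S y) *m (U + K *m D y)^T.

Lemma embedded_chart0 : embedded_chart 0 = X.
Proof. by rewrite /embedded_chart D0 S0 mulmx0 !addr0. Qed.

Lemma spd_domain : exists O : set V,
  [/\ open O, O 0 & forall y, O y -> spd (B + S y)].
Proof.
have [BT _] := hB.
have H : \forall y \near (0:V), spd (B + S y).
  apply: (near_spd (F := fun y => B + S y)).
  - by rewrite S0 addr0.
  - by move=> y; rewrite linearD /= BT ST.
  - apply: cvgD; first exact: cvg_cst.
    exact: (sS 0%N 0 I).
exists [set y | spd (B + S y)]°; split=> [||y]; first exact: open_interior.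
  exact: H.
exact: interior_subset.
Qed.

Lemma embedded_chart_smooth : smooth_on setT embedded_chart.
Proof.
move=> k; have o := @openT V.
have CZ : Ck k setT (fun y => U + K *m D y).
  by apply: CkD => //; [exact: Ck_cst|apply: Ck_mulmx => //; exact: Ck_cst].
have CC : Ck k setT (fun y => B + S y).
  by apply: CkD => //; exact: Ck_cst.
by apply: Ck_mulmx => //; [exact: Ck_mulmx|exact: Ck_trmx].
Qed.

Lemma embedded_chart_in y : spd (B + S y) -> embedded_psd r (embedded_chart y).
Proof.
move=> Cs; apply: (@embedded_psd_mul _ _ _ U^T) => //.
by rewrite mulmxDr hU mulmxA (tr_mul_perp rp hU) mul0mx addr0.
Qed.

Lemma embedded_chart_derive v : 'D_v embedded_chart 0 =
  Lmap (U, B) (K *m 'D_v D 0, 'D_v S 0).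
Proof.
have dD : derivable D 0 v by exact/diff_derivable/(smooth_differentiable sD).
have dS : derivable S 0 v by exact/diff_derivable/(smooth_differentiable sS).
have H1 := derive_mulmx_cst K 1%:M dD; have [d1 e1] := H1.
have E1 : (fun y => K *m D y *m 1%:M) = (fun y => K *m D y).
  by apply/funext => y; rewrite mulmx1.
rewrite E1 in d1 e1; rewrite mulmx1 in e1.
have [d2 e2] := affine_is_derive U d1.
have [d3 e3] := affine_is_derive B dS.
have := is_deriveE (derive_conj d2 d3); rewrite e2 e3 e1 D0 S0 mulmx0 !addr0.
by [].
Qed.

End Charts.

Lemma tangent_embeddedP xi : tangent_space (@embedded_psd R p r) X xi <->
  is_sym xi /\ K^T *m xi *m K = 0.
Proof.
split=> [[c [I [[oI I0] sc cM c0 <-]]]|[xiT xiK]].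
  exact: embedded_psd_tangent_perp oI I0 sc cM c0.
rewrite (Lmap_surj rp hU hB xiT xiK) -/K.
set D := _ *m invmx B; set S := U^T *m xi *m U.
have ST : S^T = S by rewrite /S !trmx_mul trmxK xiT mulmxA.
pose Dt (t : R) := t *: D; pose St (t : R) := t *: S.
have sDt : smooth_on setT Dt.
  by move=> k; apply: Ck_scalemx; [exact: openT|exact: Ck_id].
have sSt : smooth_on setT St.
  by move=> k; apply: Ck_scalemx; [exact: openT|exact: Ck_id].
have StT t : (St t)^T = St t by rewrite /St linearZ /= ST.
have Dt0 : Dt 0 = 0 by rewrite /Dt scale0r.
have St0 : St 0 = 0 by rewrite /St scale0r.
have [N [oN N0 Ns]] := spd_domain sSt StT St0.
exists (embedded_chart Dt St), N; split=> //.
- move=> k; apply: (@Ck_sub _ _ _ _ _ setT) => //; exact: embedded_chart_smooth.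
- by move=> t Nt; apply: embedded_chart_in; exact: Ns.
- exact: embedded_chart0.
- rewrite embedded_chart_derive//.
  have dsc m n (M : 'M[R]_(m, n)) : 'D_1 (fun t : R => t *: M) 0 = M.
    by rewrite deriveE// diff_val scale1r.
  by rewrite /Dt /St !dsc.
Qed.

End TangentEmbedded.

(** * The Cayley transform from skew to orthogonal matrices *)

Section Cayley.
Variables (R : realType) (n : nat).

Lemma qform_skew (A : 'M[R]_n) x : A^T = - A -> qform A x = 0.
Proof.
move=> AT; have : qform A^T x = qform A x.
  rewrite /qform; have -> : x *m A^T *m x^T = (x *m A *m x^T)^T.
    by rewrite !trmx_mul trmxK mulmxA.
  by rewrite mxE.
rewrite AT /qform mulmxN mulNmx mxE => /eqP.
by rewrite eq_sym -subr_eq0 opprK -mulr2n mulrn_eq0 => /eqP.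
Qed.

(** A kernel vector satisfies [x = x *m A], so its squared norm is the value at [x] of a skew form,
    which is 0. *)
Lemma skew_unitmx (A : 'M[R]_n) : A^T = - A -> 1%:M - A \in unitmx.
Proof.
move=> AT; rewrite -row_free_unit -kermx_eq0; apply/rowV0P => x /sub_kermxP.
rewrite mulmxBr mulmx1 => /eqP; rewrite subr_eq0 => /eqP xA.
by apply/eqP; rewrite -sqnorm_eq0 /sqnorm {1}xA -/(qform _ _) qform_skew.
Qed.

(** A rational substitute for the exponential. Its derivative at 0 is twice the identity, whence the
    factor [2^-1] in the skew matrices it is applied to. *)
Definition cayley (A : 'M[R]_n) : 'M[R]_n := invmx (1%:M - A) *m (1%:M + A).

Lemma cayley0 : cayley 0 = 1%:M.
Proof. by rewrite /cayley subr0 addr0 mulmx1 invmx1. Qed.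

Lemma cayley_orthogonal (A : 'M[R]_n) : A^T = - A -> orthogonal (cayley A).
Proof.
move=> AT; have uB := skew_unitmx AT.
have uC : 1%:M + A \in unitmx.
  by rewrite -[A]opprK; apply: skew_unitmx; rewrite linearN /= AT.
rewrite /orthogonal /cayley trmx_mul trmx_inv linearB linearD /= trmx1 AT opprK.
set b := 1%:M - A in uB *; set c := 1%:M + A in uC *.
have bc : b *m c = c *m b.
  rewrite /b /c mulmxBl mulmxDl !mul1mx !mulmxDr !mulmxN !mulmx1 opprD !addrA.
  by rewrite addrK subrK.
have -> : b *m invmx c = invmx c *m b.
  by rewrite -[LHS](mulKmx uC) (mulmxA c) -bc mulmxK.
by rewrite mulmxA mulmxK// mulVmx.
Qed.

Variable V : normedModType R.

Lemma cayley_smooth (A : V -> 'M[R]_n) : (forall y, (A y)^T = - A y) ->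
  smooth_on setT A -> smooth_on setT (fun y => cayley (A y)).
Proof.
move=> AT sA k; have o := @openT V; apply: Ck_mulmx => //.
  apply: Ck_invmx => // [y _|]; first exact: skew_unitmx.
  apply: CkD => //; first exact: Ck_cst.
  have H : Ck k setT (fun y => -1%:M *m A y) by apply: Ck_mulmx => //; exact: Ck_cst.
  by apply: Ck_eq o _ H => y _; rewrite mulNmx mul1mx.
by apply: CkD => //; exact: Ck_cst.
Qed.

Lemma cayley_derive (A : V -> 'M[R]_n) v : (forall y, (A y)^T = - A y) ->
  smooth_on setT A -> A 0 = 0 -> 'D_v (fun y => cayley (A y)) 0 = 2 *: 'D_v A 0.
Proof.
move=> AT sA A0.
have dA : derivable A 0 v by exact/diff_derivable/(smooth_differentiable sA).
have dC : derivable (fun y => cayley (A y)) 0 v.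
  exact/diff_derivable/(smooth_differentiable (cayley_smooth AT sA)).
have [d1 e1] := affine_is_derive 1%:M dA.
have H2 : is_derive 0 v (fun y => 1%:M - A y) (- 'D_v A 0).
  have H := is_deriveB (is_derive_cst (1%:M : 'M[R]_n) (0 : V) v) (derivableP dA).
  by apply: is_derive_eq H _; rewrite sub0r.
have [d2 e2] := H2.
have := is_deriveE (derive_mulmx d2 dC).
(* Differentiating this product identity at 0 avoids a formula for the derivative of the inverse. *)
have -> : (fun y => (1%:M - A y) *m cayley (A y)) = (fun y => 1%:M + A y).
  by apply/funext => y; rewrite /cayley mulKVmx// skew_unitmx.
rewrite e1 e2 A0 cayley0 mulmx1 subr0 mul1mx => E.
by rewrite scaler_nat mulr2n {2}E addrA subrr add0r.
Qed.

End Cayley.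

(** * Vertical vectors and horizontal lifts *)

Section Fiber.
Variables (R : realType) (p r : nat) (U : 'M[R]_(p, r)) (B : 'M[R]_r).
Hypotheses (rp : (r <= p)%N) (hU : stiefel U) (hB : spd B).
Let K := perp U.

Lemma fiber_tangent tau : tangent_space (fiber (U, B)) (U, B) tau <->
  exists2 Om : 'M[R]_r, Om^T = - Om & tau = (U *m Om, B *m Om - Om *m B).
Proof.
split=> [[c [I [[oI I0] sc cM c0 <-]]]|[Om OmT ->]].
  have d0 : differentiable c 0 by exact: smooth_differentiable sc I0.
  have d00 := diff_derivable (v := (1 : R)) d0.
  have d1 : derivable (fun t => (c t).1) 0 1 by exact/diff_derivable/differentiable_fst.
  have d2 : derivable (fun t => (c t).2) 0 1 by exact/diff_derivable/differentiable_snd.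
  (* Membership in the fiber gives an orthogonal matrix for each [t] separately; multiplying by
     [U^T] recovers it as a smooth function of [t]. Differentiating [Q^T *m Q = 1] makes its
     velocity skew. *)
  pose Q t := U^T *m (c t).1.
  have H := derive_mulmx_cst U^T 1%:M d1; have [dQ eQ] := H.
  have QE : (fun t => U^T *m (c t).1 *m 1%:M) = Q by apply/funext => t; rewrite mulmx1.
  rewrite QE in dQ eQ; rewrite mulmx1 in eQ.
  have Q0 : Q 0 = 1%:M by rewrite /Q c0.
  have nI : \forall t \near (0:R), I t by exact: open_nbhs_nbhs.
  have cE t : I t -> [/\ (Q t)^T *m Q t = 1%:M, (c t).1 = U *m Q t &
      (c t).2 = (Q t)^T *m B *m Q t].
    move=> It; have [q qo cq] := cM t It.
    have -> : Q t = q by rewrite /Q cq /= mulmxA hU mul1mx.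
    by rewrite cq.
  have [dT eT] := derive_trmx dQ.
  set Om := 'D_1 Q 0 in eQ eT.
  have OmT : Om^T = - Om.
    have := is_deriveE (derive_mulmx dT dQ).
    rewrite eT -/Om Q0 trmx1 mulmx1 mul1mx.
    rewrite (near_eq_derive (g := cst 1%:M)); last first.
      by apply: filterS nI => t /cE[].
    by rewrite derive_cst => /eqP; rewrite eq_sym addr_eq0 => /eqP.
  exists Om => //.
  have e1 : 'D_1 (fun t => (c t).1) 0 = U *m Om.
    rewrite (near_eq_derive (g := fun t => U *m Q t *m 1%:M)).
      by have := is_deriveE (derive_mulmx_cst U 1%:M dQ); rewrite mulmx1.
    by apply: filterS nI => t /cE[_ + _]; rewrite mulmx1.
  have e2 : 'D_1 (fun t => (c t).2) 0 = B *m Om - Om *m B.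
    rewrite (near_eq_derive (g := fun t => (Q t)^T *m B *m Q t)); last first.
      by apply: filterS nI => t /cE[].
    have [d3 e3] := derive_mulmx dT (derivable_cst B (0 : R) (1 : R)).
    rewrite (is_deriveE (derive_mulmx d3 dQ)) e3 eT -/Om /cst Q0 trmx1.
    have -> : 'D_1 (fun _ : R => B) 0 = 0 := derive_cst B (0 : R) (1 : R).
    by rewrite OmT mulmx0 addr0 mulmx1 mul1mx mulNmx addrC.
  by rewrite [LHS]surjective_pairing -derive_fst// -derive_snd// e1 e2.
pose A (t : R) := t *: (2^-1 *: Om).
have sA : smooth_on setT A.
  by move=> k; apply: Ck_scalemx; [exact: openT|exact: Ck_id].
have AT t : (A t)^T = - A t by rewrite /A !linearZ /= OmT !scalerN.
have A0 : A 0 = 0 by rewrite /A scale0r.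
pose Q t := cayley (A t).
have sQ : smooth_on setT Q by exact: cayley_smooth.
have o := @openT R.
have s1 : smooth_on setT (fun t => U *m Q t).
  by move=> k; apply: Ck_mulmx => //; exact: Ck_cst.
have s2 : smooth_on setT (fun t => (Q t)^T *m B *m Q t).
  move=> k; apply: Ck_mulmx => //; apply: Ck_mulmx => //; last exact: Ck_cst.
  exact: Ck_trmx.
have sc : smooth_on setT (fun t => (U *m Q t, (Q t)^T *m B *m Q t)).
  by move=> k; exact: Ck_pair.
have Q0 : Q 0 = 1%:M by rewrite /Q A0 cayley0.
exists (fun t => (U *m Q t, (Q t)^T *m B *m Q t)), setT; split=> //.
- by move=> t _; exists (Q t) => //; exact: cayley_orthogonal.
- by rewrite Q0 trmx1 !mulmx1 mul1mx.
have dc : derivable (fun t => (U *m Q t, (Q t)^T *m B *m Q t)) 0 1.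
  exact/diff_derivable/(smooth_differentiable sc).
have dQ : derivable Q 0 1 by exact/diff_derivable/(smooth_differentiable sQ).
have eQ : 'D_1 Q 0 = Om.
  rewrite cayley_derive// /A deriveE// diff_val scale1r scalerA divff ?scale1r//.
have [dT eT] := derive_trmx dQ.
rewrite [LHS]surjective_pairing -derive_fst// -derive_snd//=; congr pair.
  have := is_deriveE (derive_mulmx_cst U 1%:M dQ); rewrite mulmx1 eQ.
  by under eq_fun do rewrite mulmx1.
have [d3 e3] := derive_mulmx dT (derivable_cst B (0 : R) (1 : R)).
rewrite (is_deriveE (derive_mulmx d3 dQ)) e3 eT eQ /cst Q0 trmx1.
have -> : 'D_1 (fun _ : R => B) 0 = 0 := derive_cst B (0 : R) (1 : R).
by rewrite OmT mulmx0 addr0 mulmx1 mul1mx mulNmx addrC.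
Qed.

(** The hypotheses say that [tau] is tangent to the total space. Horizontal vectors have first
    component orthogonal to [U], so the vertical part can only be generated by [U^T *m tau.1], which
    settles both components and the uniqueness asked by [get]. *)
Lemma hliftE tau : (U^T *m tau.1)^T = - (U^T *m tau.1) -> tau.2^T = tau.2 ->
  hlift (U, B) tau = (K *m K^T *m tau.1,
    tau.2 - (B *m (U^T *m tau.1) - U^T *m tau.1 *m B)).
Proof.
move=> OmT t2T; set Om := U^T *m tau.1 in OmT *; have [BT _] := hB.
have UK := tr_mul_perp rp hU.
set th := (K *m _ *m _, _); have Hth : horizontal (U, B) th /\
    tangent_space (fiber (U, B)) (U, B) (tau - th).
  split.
    split; first by exists (K^T *m tau.1); rewrite /th /= mulmxA.
    rewrite /is_sym /th /= !linearB /= (trmx_mul B) (trmx_mul Om) t2T BT OmT !mulNmx mulmxN opprK.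
    by rewrite opprK [Om *m B - _]addrC.
  apply/fiber_tangent; exists Om => //.
  have -> : tau - th = (tau.1 - K *m K^T *m tau.1, tau.2 - th.2).
    by rewrite [LHS]surjective_pairing.
  congr pair; last by rewrite /th /= opprB addrC subrK.
  rewrite /Om mulmxA -[X in X - _]mul1mx -mulmxBl; congr (_ *m _).
  by rewrite -(perp_resolution rp hU) addrK.
apply: get_unique => // th' [[[D' E1] S'] /fiber_tangent[Om' Om'T]].
move=> E.
have E1' : tau.1 - th'.1 = U *m Om' by have := congr1 fst E.
have E2' : tau.2 - th'.2 = B *m Om' - Om' *m B by have := congr1 snd E.
have OmE : Om' = Om.
  have := congr1 (mulmx U^T) E1'; rewrite mulmxA hU mul1mx => <-.
  by rewrite mulmxBr E1 /= mulmxA UK mul0mx subr0.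
rewrite [LHS]surjective_pairing /th; congr pair.
  have -> : th'.1 = tau.1 - U *m Om by rewrite -OmE -E1' opprB addrC subrK.
  rewrite /Om mulmxA -[X in X - _]mul1mx -mulmxBl; congr (_ *m _).
  by rewrite -(perp_resolution rp hU) addrC addrA addNr add0r.
by rewrite -OmE -E2' opprB addrC subrK.
Qed.

(** The same lift written without [perp], as [tau] minus its vertical part. *)
Lemma hlift_vertical tau :
  (U^T *m tau.1)^T = - (U^T *m tau.1) -> tau.2^T = tau.2 ->
  hlift (U, B) tau = tau - (U *m (U^T *m tau.1),
    B *m (U^T *m tau.1) - U^T *m tau.1 *m B).
Proof.
move=> OmT t2T; rewrite hliftE// [RHS]surjective_pairing; congr pair.
rewrite /= mulmxA -[X in X - _]mul1mx -mulmxBl; congr (_ *m _).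
by rewrite -(perp_resolution rp hU) addrC addKr.
Qed.

Lemma LmapP (x : 'M[R]_(p, r) * 'M[R]_r) a s t :
  Lmap x (a *: s + t) = a *: Lmap x s + Lmap x t.
Proof.
rewrite /Lmap.
have -> : (a *: s + t).1 = a *: s.1 + t.1 by [].
have -> : (a *: s + t).2 = a *: s.2 + t.2 by [].
have -> : (a *: s.1 + t.1)^T = a *: s.1^T + t.1^T by rewrite linearD linearZ.
rewrite !mulmxDr !mulmxDl -!scalemxAr -!scalemxAl !scalerDr.
by rewrite [RHS]addrACA; congr (_ + _); rewrite [RHS]addrACA.
Qed.

Lemma Lmap_vertical Om : Om^T = - Om ->
  Lmap (U, B) (U *m Om, B *m Om - Om *m B) = 0.
Proof.
move=> OmT; rewrite /Lmap /= trmx_mul OmT mulNmx mulmxN mulmxBr mulmxBl !mulmxA.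
by rewrite addrA addNr sub0r addNr.
Qed.

Lemma Lmap_hlift tau : (U^T *m tau.1)^T = - (U^T *m tau.1) -> tau.2^T = tau.2 ->
  Lmap (U, B) (hlift (U, B) tau) = Lmap (U, B) tau.
Proof.
move=> OmT t2T; rewrite hlift_vertical//; set v := (U *m _, _).
have -> : tau - v = (-1) *: v + tau by rewrite scaleN1r addrC.
by rewrite LmapP Lmap_vertical// scaler0 add0r.
Qed.

End Fiber.

(** * An explicit chart of the quotient *)

Section QuotientChart.
Variables (R : realType) (p r : nat) (U : 'M[R]_(p, r)) (B : 'M[R]_r).
Hypotheses (rp : (r <= p)%N) (hU : stiefel U) (hB : spd B).
Let K := perp U.
Variables (V : normedModType R).
Variables (D : V -> 'M[R]_(p - r, r)) (S : V -> 'M[R]_r).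
Hypotheses (sD : smooth_on setT D) (sS : smooth_on setT S).
Hypotheses (ST : forall y, (S y)^T = S y) (D0 : D 0 = 0) (S0 : S 0 = 0).

(** A skew matrix which sends [U] to half of [K *m D y]. Its Cayley transform therefore moves [U]
    with velocity [K *m 'D_v D 0] at 0 and keeps the columns orthonormal. *)
Definition quotient_generator y : 'M[R]_p :=
  2^-1 *: (K *m D y *m U^T - U *m (D y)^T *m K^T).

Definition quotient_chart y : 'M[R]_(p, r) * 'M[R]_r :=
  (cayley (quotient_generator y) *m U, B + S y).

Lemma quotient_generator_skew y :
  (quotient_generator y)^T = - quotient_generator y.
Proof.
rewrite /quotient_generator linearZ linearB /= !trmx_mul !trmxK -scalerN opprB.
by rewrite !mulmxA.
Qed.

Lemma quotient_generator_smooth : smooth_on setT quotient_generator.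
Proof.
move=> k; have o := @openT V.
have H1 : Ck k setT (fun y => K *m D y *m U^T).
  by do 2?[apply: Ck_mulmx => //]; exact: Ck_cst.
have H2 : Ck k setT (fun y => - U *m (D y)^T *m K^T).
  by do 2?[apply: Ck_mulmx => //]; [exact: Ck_cst|exact: Ck_trmx|exact: Ck_cst].
have H3 : Ck k setT (fun y => 2^-1%:M *m (K *m D y *m U^T + - U *m (D y)^T *m K^T)).
  by apply: Ck_mulmx => //; [exact: Ck_cst|exact: CkD].
by apply: Ck_eq o _ H3 => y _; rewrite mul_scalar_mx !mulNmx.
Qed.

Lemma quotient_generator0 : quotient_generator 0 = 0.
Proof. by rewrite /quotient_generator D0 trmx0 !mulmx0 !mul0mx subrr scaler0. Qed.

Lemma quotient_chart0 : quotient_chart 0 = (U, B).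
Proof. by rewrite /quotient_chart quotient_generator0 cayley0 mul1mx S0 addr0. Qed.

Lemma quotient_chart_in y : spd (B + S y) -> total_space (quotient_chart y).
Proof.
move=> Bs; split=> //=; rewrite /stiefel trmx_mul mulmxA -(mulmxA U^T).
by rewrite (cayley_orthogonal (quotient_generator_skew y)) mulmx1.
Qed.

Lemma quotient_chart_smooth : smooth_on setT quotient_chart.
Proof.
move=> k; have o := @openT V; apply: Ck_pair => //.
  apply: Ck_mulmx => //; last exact: Ck_cst.
  apply: cayley_smooth; last exact: quotient_generator_smooth.
  exact: quotient_generator_skew.
by apply: CkD => //; exact: Ck_cst.
Qed.

Lemma quotient_chart_derive v :
  'D_v quotient_chart 0 = (K *m 'D_v D 0, 'D_v S 0).
Proof.
have dD : derivable D 0 v by exact/diff_derivable/(smooth_differentiable sD).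
have dS : derivable S 0 v by exact/diff_derivable/(smooth_differentiable sS).
have dc : derivable quotient_chart 0 v.
  exact/diff_derivable/(smooth_differentiable quotient_chart_smooth).
have sG := quotient_generator_smooth.
have dG : derivable quotient_generator 0 v.
  exact/diff_derivable/(smooth_differentiable sG).
have dC : derivable (fun y => cayley (quotient_generator y)) 0 v.
  apply/diff_derivable/(smooth_differentiable _ (I : setT _)).
  by apply: cayley_smooth => //; exact: quotient_generator_skew.
rewrite [LHS]surjective_pairing -derive_fst// -derive_snd//=; congr pair; last first.
  by have [] := affine_is_derive B dS.
have := is_deriveE (derive_mulmx_cst 1%:M U dC).
under eq_fun do rewrite mul1mx.
move=> ->; rewrite mul1mx (cayley_derive _ quotient_generator_skew sG quotient_generator0).
have [dT eT] := derive_trmx dD.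
have e1 := is_deriveE (derive_mulmx_cst K U^T dD).
have e2 := is_deriveE (derive_mulmx_cst U K^T dT); rewrite eT in e2.
have d1 : derivable (fun y => K *m D y *m U^T) 0 v by have [] := derive_mulmx_cst K U^T dD.
have d2 : derivable (fun y => U *m (D y)^T *m K^T) 0 v by have [] := derive_mulmx_cst U K^T dT.
have -> : 'D_v quotient_generator 0 =
    2^-1 *: (K *m 'D_v D 0 *m U^T - U *m ('D_v D 0)^T *m K^T).
  rewrite -e1 -e2.
  have H := is_deriveZ 2^-1 (is_deriveB (derivableP d1) (derivableP d2)).
  exact: is_deriveE H.
rewrite scalerA divff// scale1r mulmxBl -!mulmxA hU mulmx1 (perp_mul_tr rp hU).
by rewrite !mulmx0 subr0.
Qed.

End QuotientChart.

(** * Hessians at stationary points *)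

Lemma continuous_mx (R : realType) m n (T : topologicalType)
    (M : T -> 'M[R]_(m, n)) x :
  (forall i j, {for x, continuous (fun y => M y i j)}) -> {for x, continuous M}.
Proof. by move=> cM; apply: cvg_mx => i j; exact: cM. Qed.

Lemma continuous_invmx (R : realType) n (T : topologicalType)
    (M : T -> 'M[R]_n) x : M x \in unitmx -> {for x, continuous M} ->
  {for x, continuous (fun y => invmx (M y))}.
Proof.
move=> uM cM; pose A := [set N : 'M[R]_n | \det N != 0].
have oA : open A.
  have -> : A = (fun N : 'M[R]_n => \det N) @^-1` [set y | y != 0] by [].
  apply: open_comp; last exact: open_neq.
  move=> N _; have H := Ck_det (@openT 'M[R]_n) (@Ck_id R 'M[R]_n 0%N setT).
  exact: (H N I).
have H : Ck 0 A (fun N : 'M[R]_n => invmx N).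
  have uA (N : 'M[R]_n) : A N -> N \in unitmx by move=> NA; rewrite unitmxE unitfE.
  exact: (Ck_invmx oA uA (@Ck_id R 'M[R]_n 0%N A)).
have cI : {for M x, continuous (fun N : 'M[R]_n => invmx N)}.
  by apply: (H (M x)); rewrite /A /= -unitfE -unitmxE.
exact: (cvg_comp M _ cM cI).
Qed.

Section InnerProductSubspace.
Variables (R : realType) (V : lmodType R) (E : set V) (g : V -> V -> R).

(** Linearity and symmetry are asked everywhere but positivity only on [E]: the term tr(W s W s) of
    the total metric is positive for symmetric nonzero [s], not for arbitrary ones. *)
Record inner_on : Prop := InnerOn {
  inner_sub : forall a s t, E s -> E t -> E (a *: s + t);
  inner_lin : forall a s t u, g (a *: s + t) u = a * g s u + g t u;
  inner_sym : forall s t, g s t = g t s;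
  inner_pos : forall s, E s -> s != 0 -> 0 < g s s }.

Hypothesis gE : inner_on.

Lemma inner_linr a s t u : g u (a *: s + t) = a * g u s + g u t.
Proof. by rewrite inner_sym// inner_lin// !(inner_sym _ u). Qed.

Lemma inner_ext s t : E s -> E t -> (forall u, E u -> g s u = g t u) -> s = t.
Proof.
move=> Es Et st; pose w := (-1) *: t + s.
have Ew : E w by exact: inner_sub.
apply/eqP; rewrite -subr_eq0.
have -> : s - t = w by rewrite /w scaleN1r addrC.
apply/contraT => w0; have := inner_pos gE Ew w0.
by rewrite {1}/w inner_lin// mulN1r st// addNr ltxx.
Qed.

Lemma inner_sum (I : finType) (a : I -> R) (e : I -> V) u :
  g (\sum_i a i *: e i) u = \sum_i a i * g (e i) u.
Proof.
have g0 : g 0 u = 0 by have := inner_lin gE (-1) 0 0 u; rewrite scaler0 addr0 mulN1r addNr.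
by elim: (index_enum I) => [|i r IH]; rewrite ?big_nil// !big_cons inner_lin// IH.
Qed.

End InnerProductSubspace.

Section RiemannianHessian.
Variables (R : realType) (V : normedModType R) (M : rmanifold V).
Variables (f : V -> R) (x : V) (Q : V -> V -> R).
Let E := tspace M x.
Let g := metric M x.
Hypothesis gE : inner_on E g.
Hypothesis Qlin : forall xi a s t, E s -> E t ->
  Q xi (a *: s + t) = a * Q xi s + Q xi t.

(** What the Hessian computation uses of a chart at a stationary point. Linearity is listed because
    [tproj] is an arbitrary function in the record. One form [Q] serves all charts, which makes the
    result independent of the chart. *)
Definition stationary_chart d (s : 'rV[R]_d -> V) : Prop :=
  [/\ forall a v w, tproj M x ('D_(a *: v + w) s 0) =
        a *: tproj M x ('D_v s 0) + tproj M x ('D_w s 0),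
      forall i j, {for 0, continuous (fun y => gram M s y i j)},
      forall l, 'D_(delta_mx 0 l) (f \o s) 0 = 0
    & forall v l, is_derive 0 v ('D_(delta_mx 0 l) (f \o s))
        (Q (tproj M x ('D_v s 0)) (tproj M x ('D_(delta_mx 0 l) s 0)))].

Hypothesis charts : forall d (s : 'rV[R]_d -> V), parametrization M x s ->
  stationary_chart s.
Variables (d0 : nat) (s0 : 'rV[R]_d0 -> V).
Hypothesis s0P : parametrization M x s0.

(** With [G] the Gram matrix at 0 and [e] the coordinate basis, the covariant derivative is the row
    [q *m invmx G], where [q] lists the values of [Q] against [e]. Taking inner products with [e]
    multiplies by [G] and returns [q]. *)
Lemma nabla_grad_stationary d (s : 'rV[R]_d -> V) v : parametrization M x s ->
  let h := tproj M x ('D_(covariant_derivative (gram M s) v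
    (coord_grad (gram M s) (f \o s)) 0) s 0) in
  E h /\ forall eta, E eta -> g h eta = Q (tproj M x ('D_v s 0)) eta.
Proof.
move=> sP; have [tlin cg F0 F2] := charts sP; have [s0x [N [_ _ _ sbij]]] := sP.
pose tau w := tproj M x ('D_w s 0).
have tE w : E (tau w) by case: sbij => /(_ w I).
have tlin' a v' w : tau (a *: v' + w) = a *: tau v' + tau w by exact: tlin.
have tau0 : tau 0 = 0.
  by have := tlin' (-1) 0 0; rewrite scaler0 addr0 scaleN1r addNr.
have tausum w : tau w = \sum_k w 0 k *: tau (delta_mx 0 k).
  have {1}-> : w = \sum_k w 0 k *: delta_mx 0 k.
    rewrite [LHS]matrix_sum_delta big_ord1; apply: eq_bigr => k _.
    by [].
  by elim: (index_enum _) => [|i r IH]; rewrite ?big_nil// !big_cons tlin' IH.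
have tauinj w : tau w = 0 -> w = 0.
  move=> w0; have [_ inj _] := sbij.
  by apply: inj; rewrite ?inE// -/(tau w) -/(tau 0) w0 tau0.
pose e k := tau (delta_mx 0 k).
have [G Geq] : exists G, gram M s 0 = G by eexists.
have GE i j : G i j = g (e i) (e j) by rewrite -Geq mxE s0x.
have Gs : spd G.
  apply/spdP; split; first by apply/matrixP => i j; rewrite mxE !GE (inner_sym gE).
  move=> w w0; have -> : qform G w = g (tau w) (tau w).
    rewrite {1}(tausum w) (inner_sum gE) /qform mxE.
    under eq_bigr do rewrite mxE big_distrl /=.
    rewrite exchange_big /=; apply: eq_bigr => i _.
    rewrite (inner_sym gE) (tausum w) (inner_sum gE) mulr_sumr; apply: eq_bigr => j _.
    by rewrite mxE GE (inner_sym gE) -/(e i) -/(e j); ring.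
  apply: (inner_pos gE) => //; apply: contra_neq w0; exact: tauinj.
have cG : {for 0, continuous (gram M s)} by apply: continuous_mx => i j; exact: cg.
have cI k l : {for 0, continuous (fun y => invmx (gram M s y) k l)}.
  have uG : gram M s 0 \in unitmx by rewrite Geq; exact: spd_unitmx.
  have := continuous_invmx uG cG => cI.
  apply: (cvg_comp _ (fun N : 'M[R]_d => N k l) cI); exact: coord_continuous.
set cov := covariant_derivative _ _ _ _.
pose q : 'rV[R]_d := \row_l Q (tau v) (e l).
have covE : cov = q *m invmx G.
  apply/rowP => k; rewrite mxE [X in _ + X]big1 ?addr0; last first.
    move=> i _; apply: big1 => j _; rewrite mxE big1 ?mulr0// => l _.
    by rewrite /partial F0 mulr0.
  (* The partial derivatives vanish at 0, so continuity of the inverse Gram matrix suffices here. *)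
  have H l : is_derive 0 v
      (fun z => invmx (gram M s z) k l * 'D_(delta_mx 0 l) (f \o s) z)
      (invmx G k l * Q (tau v) (e l)).
    have [dF eF] := F2 v l.
    have := derive_mul_vanishing (cI k l) (F0 l) dF; rewrite eF Geq; exact.
  have := is_deriveE (is_derive_sum H); rewrite fct_sumE.
  have -> : (fun z => (coord_grad (gram M s) (f \o s) z) 0 k) =
    (fun z => \sum_l invmx (gram M s z) k l * 'D_(delta_mx 0 l) (f \o s) z).
    by apply/funext => z; rewrite mxE.
  move=> ->; rewrite mxE; apply: eq_bigr => l _.
  have [iT _] := spd_invmx Gs; rewrite mulrC -[in LHS]iT mxE; congr (_ * _).
  by rewrite mxE.
have ge j : g (tau cov) (e j) = Q (tau v) (e j).
  rewrite tausum (inner_sum gE).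
  have -> : \sum_i cov 0 i * g (tau (delta_mx 0 i)) (e j) = (cov *m G) 0 j.
    by rewrite mxE; apply: eq_bigr => i _; rewrite GE.
  by rewrite covE mulmxKV ?spd_unitmx// mxE.
split; first exact: tE.
move=> eta; have [_ _ /[apply] -[u _ <-]] := sbij.
rewrite -/(tau u) tausum.
(* [Q] is assumed linear on [E] only, so the induction carries membership in [E] along with the
   identity. *)
have : forall I (r : seq I) (b : I -> R) (z : I -> V), (forall i, E (z i)) ->
    E (\sum_(i <- r) b i *: z i) /\
    g (tau cov) (\sum_(i <- r) b i *: z i) - Q (tau v) (\sum_(i <- r) b i *: z i) =
    \sum_(i <- r) b i * (g (tau cov) (z i) - Q (tau v) (z i)).
  have E0 : E 0 by rewrite -tau0.
  have Q0 : Q (tau v) 0 = 0.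
    have := Qlin (tau v) (-1) E0 E0; rewrite scaler0 addr0 => ->.
    by rewrite mulN1r addNr.
  have g0 : g (tau cov) 0 = 0.
    have := inner_linr gE (-1) 0 0 (tau cov); rewrite scaler0 addr0 => ->.
    by rewrite mulN1r addNr.
  move=> J r b z Ez; elim: r => [|i r [IH1 IH2]].
    by rewrite !big_nil g0 Q0 subrr.
  rewrite !big_cons; split; first by apply: (inner_sub gE).
  by rewrite (inner_linr gE) Qlin// -IH2; ring.
move=> /(_ _ (index_enum _) (fun i => u 0 i) e (fun i => tE _)) [_].
rewrite [RHS]big1 => [/eqP|i _]; last by rewrite /= ge subrr mulr0.
by rewrite subr_eq0 => /eqP.
Qed.

(** Every chart yields the vector representing [Q xi], so an operator satisfying [is_rhess] exists;
    the chart [s0] reaches all of [E] and forces the one chosen by [get] to be this operator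
    there. *)
Lemma rhess_stationary xi : E xi ->
  E (rhess M f x xi) /\ forall eta, E eta -> g (rhess M f x xi) eta = Q xi eta.
Proof.
pose P xi h := E h /\ forall eta, E eta -> g h eta = Q xi eta.
have Puniq z h h' : P z h -> P z h' -> h = h'.
  move=> [Eh gh] [Eh' gh']; apply: (inner_ext gE) => // u Eu.
  by rewrite gh// gh'.
pose H0 xi := get (P xi).
(* [H0] takes a default value where no representing vector exists, but [is_rhess] evaluates it only
   at velocities of charts, where one does. *)
have H0P : is_rhess M f x H0.
  move=> d s sP v; have h := nabla_grad_stationary v sP.
  exact: (Puniq _ _ _ (getPex (ex_intro _ _ h)) h).
have HP : is_rhess M f x (rhess M f x) by apply: (getPex (ex_intro _ _ H0P)).
move=> Exi; have [_ [N [_ _ _ [_ _ sur]]]] := s0P.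
have [v _ <-] := sur xi Exi.
by rewrite (HP _ _ s0P); exact: nabla_grad_stationary.
Qed.

End RiemannianHessian.

(** * Gradients *)

Section Traces.
Variable R : realType.

Lemma mxtrace_mulmx_tr m n (A : 'M[R]_(m, n)) :
  \tr (A *m A^T) = \sum_i \sum_j A i j ^+ 2.
Proof.
by apply: eq_bigr => i _; rewrite mxE; apply: eq_bigr => j _; rewrite mxE expr2.
Qed.

Lemma mxtrace_mulmx_tr_gt0 m n (A : 'M[R]_(m, n)) : A != 0 -> 0 < \tr (A *m A^T).
Proof.
move=> A0; rewrite mxtrace_mulmx_tr lt_def; apply/andP; split; last first.
  by apply: sumr_ge0 => i _; apply: sumr_ge0 => j _; exact: sqr_ge0.
apply: contra A0 => /eqP S0; apply/eqP/matrixP => i j; rewrite mxE.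
have h i' : 0 <= \sum_j A i' j ^+ 2 by apply: sumr_ge0 => k _; exact: sqr_ge0.
have h1 : \sum_j A i j ^+ 2 = 0 by apply: (psumr_eq0P _ S0) => // i' _; exact: h.
have : A i j ^+ 2 = 0 by apply: (psumr_eq0P _ h1) => // j' _; exact: sqr_ge0.
by move/eqP; rewrite sqrf_eq0 => /eqP.
Qed.

Lemma mxtrace_tr n (A : 'M[R]_n) : \tr A^T = \tr A.
Proof. by apply: eq_bigr => i _; rewrite mxE. Qed.

End Traces.

Section Conjugation.
Variables (R : realType) (p r : nat).
Notation pt := ('M[R]_(p, r) * 'M[R]_r)%type.

Definition conj_map (x : pt) : 'M[R]_p := x.1 *m x.2 *m x.1^T.

Lemma conj_map_Ck k (V : normedModType R) (A : set V) (s : V -> pt) : open A ->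
  Ck k A s -> Ck k A (conj_map \o s).
Proof.
move=> oA Cs; apply: Ck_mulmx => //; last by apply: Ck_trmx => //; exact: Ck_fst.
by apply: Ck_mulmx => //; [exact: Ck_fst|exact: Ck_snd].
Qed.

Lemma derive_conj_map (V : normedModType R) (s : V -> pt) x v :
  derivable s x v -> differentiable s x ->
  'D_v (conj_map \o s) x = Lmap (s x) ('D_v s x).
Proof.
move=> ds dds; have d1 : derivable (fun y => (s y).1) x v.
  exact/diff_derivable/differentiable_fst.
have d2 : derivable (fun y => (s y).2) x v.
  exact/diff_derivable/differentiable_snd.
have := is_deriveE (derive_conj d1 d2).
rewrite derive_fst// derive_snd// -!surjective_pairing; exact.
Qed.

End Conjugation.
Arguments conj_map {R p r} x.

Section Gradients.
Variables (R : realType) (p r : nat) (f : 'M[R]_p -> R) (V W : 'M[R]_r -> 'M[R]_r).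
Variables (U : 'M[R]_(p, r)) (B : 'M[R]_r).
Hypotheses (rp : (r <= p)%N) (hf : Ck 2 setT f) (hfT : forall X, f X = f X^T).
Hypotheses (hV : spd (V B)) (hW : spd (W B)) (hU : stiefel U) (hB : spd B).
Let X := U *m B *m U^T.
Let K := perp U.
Let M := Me R p r.
Let Mq := Mq2 p V W.

Lemma C2_differentiable Y : differentiable f Y.
Proof. by case: hf => + _; exact. Qed.

Lemma base_point_sym : X^T = X.
Proof. by have [BT _] := hB; rewrite /X !trmx_mul trmxK BT mulmxA. Qed.

(* The transpose of the Euclidean gradient at X; [egradT] makes it the gradient. *)
Definition egrad : 'M[R]_p := \matrix_(i, j) 'D_(delta_mx j i) f X.

Lemma egradE xi : 'D_xi f X = \tr (egrad *m xi).
Proof.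
rewrite (derive_delta xi (C2_differentiable X)).
rewrite -(pair_bigA _ (fun i j => xi i j * 'D_(delta_mx i j) f X)) /=.
rewrite exchange_big /=; apply: eq_bigr => i _; rewrite mxE; apply: eq_bigr => j _.
by rewrite mxE mulrC.
Qed.

Lemma egradT : egrad^T = egrad.
Proof.
apply/matrixP => i j; rewrite !mxE.
have fE : f \o trmx = f by apply/funext => Y /=; rewrite -hfT.
have Ctr : Ck 1 setT (fun Y : 'M[R]_p => Y^T).
  by apply: Ck_trmx; [exact: openT|exact: Ck_id].
have dI : derivable (fun Y : 'M[R]_p => Y) X (delta_mx i j) by exact: derivable_id.
have := derive_comp (delta_mx i j) (Ck_differentiable Ctr I) (C2_differentiable X^T).
rewrite fE (is_deriveE (derive_trmx dI)) base_point_sym => ->.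
have -> : 'D_(delta_mx i j) (fun Y : 'M[R]_p => Y) X = delta_mx i j.
  exact: derive_id.
by rewrite trmx_delta.
Qed.

Lemma inner_Me : inner_on (tspace M X) (metric M X).
Proof.
split.
- move=> a s t /(tangent_embeddedP rp hU hB)[sT sK].
  move=> /(tangent_embeddedP rp hU hB)[tT tK].
  apply/(tangent_embeddedP rp hU hB); split.
    by rewrite /is_sym linearD linearZ /= sT tT.
  by rewrite mulmxDr mulmxDl -scalemxAr -scalemxAl sK tK scaler0 addr0.
- move=> a s t u /=.
  by rewrite linearD linearZ /= mulmxDl -scalemxAl mxtraceD mxtraceZ.
- by move=> s t /=; rewrite -mxtrace_tr trmx_mul trmxK.
- move=> s _ s0 /=; rewrite mxtrace_mulC; exact: mxtrace_mulmx_tr_gt0.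
Qed.

Lemma inner_Mq : inner_on (tspace Mq (U, B)) (metric Mq (U, B)).
Proof.
have [VT _] := hV; have [WT _] := hW; split.
- move=> a s t [[D1 E1] S1] [[D2 E2] S2]; split.
    by exists (a *: D1 + D2); rewrite /= E1 E2 mulmxDr -scalemxAr.
  by rewrite /is_sym /= linearD linearZ /= S1 S2.
- move=> a s t u; rewrite /= /total_metric /=.
  rewrite linearD linearZ /= !mulmxDr !mulmxDl -!scalemxAr -!scalemxAl.
  by rewrite !mxtraceD !mxtraceZ; ring.
- move=> s t; rewrite /= /total_metric /=; congr (_ + _).
    by rewrite -mxtrace_tr !trmx_mul trmxK VT mulmxA mxtrace_mulC mulmxA.
  by rewrite -mulmxA mxtrace_mulC !mulmxA.
- move=> s [_ S1] s0; rewrite /= /total_metric /=.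
  (* The square roots of the weights exhibit the metric as |s_U Vh|^2 + |Wh s_B Wh|^2, with
     invertible factors. *)
  have [Vh [[VhT Vh0] VhE]] := spd_sqrt hV; have [Wh [[WhT Wh0] WhE]] := spd_sqrt hW.
  have uV : Vh \in unitmx by exact: spd_unitmx.
  have uW : Wh \in unitmx by exact: spd_unitmx.
  have -> : \tr (V B *m s.1^T *m s.1) = \tr (s.1 *m Vh *m (s.1 *m Vh)^T).
    by rewrite trmx_mul VhT !mulmxA -(mulmxA s.1) VhE mxtrace_mulC mulmxA.
  have -> : \tr (W B *m s.2 *m W B *m s.2) =
     \tr (Wh *m s.2 *m Wh *m (Wh *m s.2 *m Wh)^T).
    rewrite !trmx_mul WhT S1 !mulmxA -(mulmxA (Wh *m s.2) Wh Wh) WhE.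
    by rewrite [RHS]mxtrace_mulC !mulmxA WhE.
  have ge0 m n (A : 'M[R]_(m, n)) : 0 <= \tr (A *m A^T).
    have [->|/mxtrace_mulmx_tr_gt0/ltW//] := eqVneq A 0.
    by rewrite mul0mx mxtrace0.
  have [s1|s1] := eqVneq s.1 0; last first.
    apply: ltr_pwDl => //; apply: mxtrace_mulmx_tr_gt0.
    by apply: contra_neq s1 => e; rewrite -(mulmxK uV s.1) e mul0mx.
  apply: ltr_wpDl => //; apply: mxtrace_mulmx_tr_gt0.
  have s2 : s.2 != 0.
    by apply: contra_neq s0 => s2; rewrite [LHS]surjective_pairing s1 s2.
  apply: contra_neq s2 => e.
  by rewrite -(mulmxK uW s.2) -(mulKmx uW (s.2 *m Wh)) (mulmxA Wh) e mulmx0 mul0mx.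
Qed.

Lemma rgrad_uniq (N : normedModType R) (L : rmanifold N) h x xi :
  inner_on (tspace L x) (metric L x) -> is_rgrad L h x xi -> rgrad L h x = xi.
Proof.
move=> iL xiP; apply: get_unique => // xi' [Exi' xi'P]; have [Exi xiP'] := xiP.
by apply: (inner_ext iL) => // u Eu; rewrite xiP'// xi'P.
Qed.

Lemma rgrad_MeE : rgrad M f X = egrad - K *m K^T *m egrad *m K *m K^T.
Proof.
apply: rgrad_uniq inner_Me _.
have GT := egradT; have KK := perp_tr rp hU; split.
  apply/(tangent_embeddedP rp hU hB); split.
    by rewrite /is_sym linearB /= !trmx_mul !trmxK GT !mulmxA.
  rewrite mulmxBr mulmxBl !mulmxA KK mul1mx -(mulmxA _ K^T) KK mulmx1.
  by rewrite subrr.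
move=> eta /(tangent_embeddedP rp hU hB)[eT eK].
rewrite /= egradE linearB /= !trmx_mul !trmxK GT !mulmxA mulmxBl mxtraceD.
rewrite linearN /= [X in _ - X](_ : _ = 0) ?subr0//.
have -> : K *m K^T *m egrad *m K *m K^T *m eta = K *m (K^T *m egrad *m K *m K^T *m eta).
  by rewrite !mulmxA.
by rewrite mxtrace_mulC -!mulmxA (mulmxA K^T eta) eK !mulmx0 mxtrace0.
Qed.

(** Stationarity makes [egrad] equal to its own [K]-[K] block, so the derivative of [f] sees only
    the block [K^T *m eta *m K]. It vanishes for tangent [eta], and for a second derivative of a
    chart only the normal part counts. *)
Lemma stationary_tangent eta : rgrad M f X = 0 -> is_sym eta ->
  'D_eta f X = \tr (egrad *m K *m (K^T *m eta *m K) *m K^T).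
Proof.
rewrite rgrad_MeE => /eqP; rewrite subr_eq0 => /eqP GE etaT.
by rewrite egradE {1}GE [RHS]mxtrace_mulC -!mulmxA [LHS]mxtrace_mulC -!mulmxA.
Qed.

Lemma derive_hq eta : 'D_eta (hq f) (U, B) = 'D_(Lmap (U, B) eta) f X.
Proof.
have o := @openT ('M[R]_(p, r) * 'M[R]_r)%type.
have CI := @conj_map_Ck R p r 1 _ setT id o (Ck_id 1 setT).
have dc : differentiable (conj_map \o id) (U, B).
  exact: (Ck_differentiable CI I).
have := derive_comp eta dc (C2_differentiable _).
by rewrite derive_conj_map ?derive_id.
Qed.

Lemma Lmap_tangent theta : horizontal (U, B) theta ->
  tspace M X (Lmap (U, B) theta).
Proof.
move=> [_ S1]; apply/(tangent_embeddedP rp hU hB); split.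
  by apply: Lmap_sym.
by apply: perp_Lmap.
Qed.

(** The gradient represents the trace of [egrad] against [Lmap]. The two terms of [Lmap] containing
    the first component are transposes of each other and [egrad] is symmetric, hence the factor 2;
    the inverse weights undo the metric. *)
Lemma rgrad_MqE : rgrad Mq (hq f) (U, B) =
  (2 *: (Pperp U *m egrad *m U *m B *m invmx (V B)),
   invmx (W B) *m U^T *m egrad *m U *m invmx (W B)).
Proof.
apply: rgrad_uniq inner_Mq _.
have GT := egradT; have [BT _] := hB.
have uV := spd_unitmx hV; have uW := spd_unitmx hW.
have [VT _] := spd_invmx hV; have [WT _] := spd_invmx hW; split.
  split.
    exists (2 *: (K^T *m egrad *m U *m B *m invmx (V B))).
    by rewrite /= -scalemxAr /Pperp !mulmxA.
  by rewrite /is_sym /= !trmx_mul trmxK WT GT !mulmxA.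
move=> eta [[D E1] S1]; rewrite derive_hq egradE /= /total_metric /=.
rewrite linearZ /= !trmx_mul trmxK BT VT GT !mulmxA.
rewrite -scalemxAr -scalemxAl mxtraceZ !mulmxA.
have -> : V B *m invmx (V B) *m B *m U^T *m egrad *m K *m K^T *m eta.1 =
   B *m U^T *m egrad *m eta.1.
  rewrite mulmxV// mul1mx -!mulmxA; congr (_ *m (_ *m (_ *m _))).
  by rewrite E1 /= (mulmxA K^T) (perp_tr rp hU) mul1mx.
have -> : \tr (W B *m invmx (W B) *m U^T *m egrad *m U *m invmx (W B) *m W B *m eta.2) =
   \tr (egrad *m (U *m eta.2 *m U^T)).
  by rewrite mulmxV// mul1mx -(mulmxA _ _ (W B)) mulVmx// mulmx1 !mulmxA
    [RHS]mxtrace_mulC !mulmxA.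
rewrite /Lmap /= !mulmxDr !mxtraceD.
have -> : \tr (egrad *m (U *m B *m eta.1^T)) = \tr (B *m U^T *m egrad *m eta.1).
  by rewrite -mxtrace_tr !trmx_mul trmxK BT GT !mulmxA [RHS]mxtrace_mulC !mulmxA.
have -> : \tr (egrad *m (eta.1 *m B *m U^T)) = \tr (B *m U^T *m egrad *m eta.1).
  by rewrite !mulmxA mxtrace_mulC !mulmxA mxtrace_mulC !mulmxA.
ring.
Qed.

Lemma rgrad_Me_of_Mq : let gradf := rgrad M f X in
  let gradh := rgrad Mq (hq f) (U, B) in
  gradf = 2^-1 *: (gradh.1 *m V B *m invmx B *m U^T)
              + 2^-1 *: (gradh.1 *m V B *m invmx B *m U^T)^T
              + U *m W B *m gradh.2 *m W B *m U^T.
Proof.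
rewrite /= rgrad_MeE rgrad_MqE /=.
have GT := egradT; have uV := spd_unitmx hV; have uW := spd_unitmx hW.
have uB := spd_unitmx hB; have P1 := perp_resolution rp hU.
rewrite -/K in P1.
have -> : 2 *: (Pperp U *m egrad *m U *m B *m invmx (V B)) *m V B *m invmx B *m U^T
   = 2 *: (K *m K^T *m egrad *m U *m U^T).
  by rewrite -!scalemxAl mulmxKV// mulmxK.
have -> : U *m W B *m (invmx (W B) *m U^T *m egrad *m U *m invmx (W B)) *m W B *m U^T
   = U *m U^T *m egrad *m U *m U^T.
  by rewrite !mulmxA mulmxK// mulmxKV.
have trZ (A : 'M[R]_p) : (2 *: A)^T = 2 *: A^T by rewrite linearZ.
rewrite trZ !scalerA mulVf// !scale1r !trmx_mul !trmxK GT !mulmxA.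
have {1}-> : egrad = (U *m U^T + K *m K^T) *m egrad *m (U *m U^T + K *m K^T).
  by rewrite P1 mul1mx mulmx1.
rewrite !mulmxDl !mulmxDr !mulmxA addrA addrK.
by rewrite addrAC -addrA addrC.
Qed.

Lemma rgrad_Mq_of_Me : let gradf := rgrad M f X in
  rgrad Mq (hq f) (U, B) =
  (2 *: (Pperp U *m gradf *m U *m B *m invmx (V B)),
   invmx (W B) *m U^T *m gradf *m U *m invmx (W B)).
Proof.
have KU := perp_mul_tr rp hU.
rewrite /= rgrad_MeE rgrad_MqE; set P := egrad - _.
(* The two gradients differ by the [K]-[K] block, which [U] kills, and the formula only involves
   their product with [U]. *)
have PU : P *m U = egrad *m U by rewrite /P mulmxBl -!mulmxA KU !mulmx0 subr0.
by rewrite -(mulmxA _ P U) -(mulmxA _ egrad U) -(mulmxA _ P U) PU !mulmxA.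
Qed.

End Gradients.

(** * Second derivatives in charts *)

(** [U^T *m Y] already has rank [r], so its rows span those of [Y]: [Y = E *m (U^T *m Y)], and
    multiplying by [U] on the right identifies [E]. This is the vanishing of the Schur
    complement. *)
Lemma rank_schur (R : realType) p r (Y : 'M[R]_p) (U : 'M[R]_(p, r)) :
  (\rank Y = r)%N -> U^T *m Y *m U \in unitmx ->
  Y = Y *m U *m invmx (U^T *m Y *m U) *m (U^T *m Y).
Proof.
move=> rY uA.
have /submxP[E YE] : (Y <= U^T *m Y)%MS.
  have le1 : (U^T *m Y <= Y)%MS by exact: submxMl.
  have := mxrank_leqif_sup le1 => /leqifP.
  case: ifP => // _; rewrite rY ltnNge => /negP[].
  by rewrite -[X in (X <= _)%N](mxrank_unit uA); exact: mxrankM_maxl.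
have -> : Y *m U = E *m (U^T *m Y *m U) by rewrite mulmxA -YE.
by rewrite mulmxK.
Qed.

Lemma Ck_mxtrace (R : realType) (V : normedModType R) k (N : set V) n
    (F : V -> 'M[R]_n) : open N -> Ck k N F -> Ck k N (fun y => \tr (F y)).
Proof.
move=> oN CF; apply: Ck_sum => // i.
by move/(Ck_mxP _ _ oN): CF => /(_ i i).
Qed.

Lemma Ck_subr (R : realType) (V : normedModType R) k (N : set V) m n
    (F G : V -> 'M[R]_(m, n)) : open N -> Ck k N F -> Ck k N G ->
  Ck k N (fun y => F y - G y).
Proof.
move=> oN CF CG.
have H := CkD oN CF (Ck_mulmx oN (Ck_cst k N ((-1)%:M : 'M[R]_m)) CG).
by apply: (Ck_eq oN _ H) => y _; rewrite mul_scalar_mx scaleN1r.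
Qed.

Section NormalSecondDerivative.
Variables (R : realType) (p r : nat).
Variables (U : 'M[R]_(p, r)) (B : 'M[R]_r).
Hypotheses (rp : (r <= p)%N) (hU : stiefel U) (hB : spd B).
Let X := U *m B *m U^T.
Let K := perp U.
Variables (V : normedModType R) (sg : V -> 'M[R]_p) (O : set V).
Hypotheses (oO : open O) (O0 : O 0) (sgC : Ck 2 O sg).
Hypotheses (sgM : forall y, O y -> embedded_psd r (sg y)) (sg0 : sg 0 = X).

(** On tangent vectors, the sum of this expression and its swap is the second fundamental form at
    [X], in the coordinates of the normal block. *)
Definition normal_form (xi eta : 'M[R]_p) : 'M[R]_(p - r) :=
  K^T *m xi *m U *m invmx B *m U^T *m eta *m K.

Lemma velocity_sym v : is_sym ('D_v sg 0).
Proof.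
apply: derive_sym; first exact/diff_derivable/(Ck_differentiable sgC O0).
apply: (@filterS _ _ _ O) => [y /sgM[[]]//|]; exact: open_nbhs_nbhs.
Qed.

(* Near X the manifold is the graph N = C A^-1 C^T of the block N = K^T Y K over
   A = U^T Y U and C = K^T Y U, and C vanishes at X. *)
Lemma normal_second_derivative v w :
  K^T *m 'D_v ('D_w sg) 0 *m K =
  normal_form ('D_w sg 0) ('D_v sg 0) + normal_form ('D_v sg 0) ('D_w sg 0).
Proof.
have UK := tr_mul_perp rp hU; have KU := perp_mul_tr rp hU.
have uB := spd_unitmx hB.
pose A y := U^T *m sg y *m U.
pose C y := K^T *m sg y *m U.
(* The block N becomes [C y *m T y] with both factors zero at 0, so its second derivative retains
   only products of first derivatives. *)
pose T y := invmx (A y) *m (C y)^T.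
have A0 : A 0 = B by rewrite /A sg0 /X !mulmxA hU mul1mx -mulmxA hU mulmx1.
have C0 : C 0 = 0 by rewrite /C sg0 /X !mulmxA KU !mul0mx.
have T0 : T 0 = 0 by rewrite /T C0 trmx0 mulmx0.
have cst k m n (Z : 'M[R]_(m, n)) N : Ck k N (fun _ : V => Z) by exact: Ck_cst.
have AC : Ck 2 O A by do 2?[apply: Ck_mulmx => //].
have nA : \forall y \near (0:V), A y \in unitmx.
  have cA : {for 0, continuous A}.
    by apply: differentiable_continuous; exact: (Ck_differentiable AC O0).
  pose D := [set Z : 'M[R]_r | \det Z != 0].
  have oD : open D.
    have -> : D = (fun Z : 'M[R]_r => \det Z) @^-1` [set y | y != 0] by [].
    apply: open_comp; last exact: open_neq.
    move=> Z _; have H := Ck_det (@openT 'M[R]_r) (@Ck_id R 'M[R]_r 0%N setT).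
    exact: (H Z I).
  have DB : D (A 0) by rewrite A0 /D /= -unitfE -unitmxE.
  have nD : nbhs (A 0) D by exact: open_nbhs_nbhs.
  apply: (@filterS _ _ _ (A @^-1` D)); last exact: (cA _ nD).
  by move=> y; rewrite /D /= unitmxE unitfE.
pose N := O `&` [set y | A y \in unitmx]°.
have oN : open N by apply: openI => //; exact: open_interior.
have N0 : N 0 by split=> //.
have NO : N `<=` O by move=> y [].
have uA y : N y -> A y \in unitmx by move=> [_ /interior_subset].
have sgN : Ck 2 N sg by exact: Ck_sub sgC.
have AN : Ck 2 N A by exact: Ck_sub AC.
have CN : Ck 2 N C by do 2?[apply: Ck_mulmx => //].
have TN : Ck 2 N T.
  exact: (Ck_mulmx oN (Ck_invmx oN uA AN) (Ck_trmx oN CN)).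
have near_N (P : V -> Prop) : (forall y, N y -> P y) -> \forall y \near (0:V), P y.
  by move=> NP; apply: (@filterS _ _ _ N) NP _; exact: open_nbhs_nbhs.
have d1 (m n : nat) (F : V -> 'M[R]_(m, n)) y u : Ck 2 N F -> N y -> derivable F y u.
  by move=> CF Ny; exact/diff_derivable/(Ck_differentiable CF Ny).
have d2 (m n : nat) (F : V -> 'M[R]_(m, n)) u u' : Ck 2 N F -> derivable ('D_u F) 0 u'.
  move=> [_ DF]; have C1 : Ck 1 N ('D_u F) := DF u.
  exact/diff_derivable/(Ck_differentiable C1 N0).
have e1 u : 'D_u C 0 = K^T *m 'D_u sg 0 *m U.
  exact: (is_deriveE (derive_mulmx_cst K^T U (d1 _ _ _ 0 u sgN N0))).
(* Obtained by differentiating [A *m T = C^T], where [T 0 = 0] removes the derivative of [A]. *)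
have eT u : 'D_u T 0 = invmx B *m ('D_u C 0)^T.
  have := is_deriveE (derive_mulmx (d1 _ _ _ 0 u AN N0) (d1 _ _ _ 0 u TN N0)).
  rewrite (near_eq_derive (g := fun y => (C y)^T)); last first.
    by apply: near_N => y Ny; rewrite /T mulKVmx// uA.
  rewrite (is_deriveE (derive_trmx (d1 _ _ _ 0 u CN N0))) T0 mulmx0 add0r A0 => ->.
  by rewrite mulKmx.
have NE y : N y -> K^T *m sg y *m K = C y *m T y.
  move=> Ny; have [_ rs] := sgM (NO _ Ny); have [[sT _] _] := sgM (NO _ Ny).
  rewrite {1}(rank_schur rs (uA _ Ny)) /T /C -/(A y).
  by rewrite !trmx_mul trmxK sT !mulmxA.
have D1 y u : N y -> K^T *m 'D_u sg y *m K = 'D_u C y *m T y + C y *m 'D_u T y.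
  move=> Ny; rewrite -(is_deriveE (derive_mulmx_cst K^T K (d1 _ _ _ y u sgN Ny))).
  rewrite -(is_deriveE (derive_mulmx (d1 _ _ _ y u CN Ny) (d1 _ _ _ y u TN Ny))).
  apply: near_eq_derive; apply: (@filterS _ _ _ N) NE _; exact: open_nbhs_nbhs.
rewrite -(is_deriveE (derive_mulmx_cst K^T K (d2 _ _ _ w v sgN))).
rewrite (near_eq_derive (g := fun y => 'D_w C y *m T y + C y *m 'D_w T y)); last first.
  by apply: near_N => y; exact: D1.
have H1 := derive_mulmx (d2 _ _ _ w v CN) (d1 _ _ _ 0 v TN N0).
have H2 := derive_mulmx (d1 _ _ _ 0 v CN N0) (d2 _ _ _ w v TN).
clearbody T C; apply: (etrans (is_deriveE (is_deriveD H1 H2))).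
have [sv sw] := (velocity_sym v : _^T = _, velocity_sym w : _^T = _).
rewrite T0 C0 (eT v) (eT w) (e1 v) (e1 w).
move: ('D_v sg 0) ('D_w sg 0) sv sw => xv xw sv sw.
rewrite mulmx0 mul0mx add0r addr0.
by rewrite !trmx_mul !trmxK sv sw /normal_form !mulmxA.
Qed.

End NormalSecondDerivative.

Section StationaryHessian.
Variables (R : realType) (p r : nat) (f : 'M[R]_p -> R) (V W : 'M[R]_r -> 'M[R]_r).
Variables (U : 'M[R]_(p, r)) (B : 'M[R]_r).
Hypotheses (rp : (r <= p)%N) (hf : Ck 2 setT f) (hfT : forall X, f X = f X^T).
Hypotheses (sV : smooth_spd_weight V) (sW : smooth_spd_weight W).
Hypotheses (hU : stiefel U) (hB : spd B).
Let X := U *m B *m U^T.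
Let K := perp U.
Let M := Me R p r.
Let Mq := Mq2 p V W.
Hypothesis gradf0 : rgrad M f X = 0.

(** The classical Hessian of a restriction: the Euclidean Hessian plus the Euclidean gradient paired
    with the second fundamental form. Given on all matrices, it is bilinear and symmetric there. *)
Definition hess_form (xi eta : 'M[R]_p) : R := 'D_xi ('D_eta f) X +
  \tr (egrad f U B *m K *m (normal_form U B eta xi + normal_form U B xi eta) *m K^T).

Lemma hess_formC xi eta : hess_form xi eta = hess_form eta xi.
Proof.
rewrite /hess_form (derive_symmetric X xi eta hf).
by congr (_ + \tr (_ *m _ *m _)); exact: addrC.
Qed.

Lemma hess_form_lin xi a s t :
  hess_form xi (a *: s + t) = a * hess_form xi s + hess_form xi t.
Proof.
rewrite hess_formC (hess_formC xi s) (hess_formC xi t).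
have nfl u : normal_form U B (a *: s + t) u = a *: normal_form U B s u + normal_form U B t u.
  by rewrite /normal_form !mulmxDr !mulmxDl -!scalemxAr -!scalemxAl.
have nfr u : normal_form U B u (a *: s + t) = a *: normal_form U B u s + normal_form U B u t.
  by rewrite /normal_form !mulmxDr !mulmxDl -!scalemxAr -!scalemxAl.
rewrite /hess_form (hessian_linear _ _ _ _ _ hf) nfl nfr addrACA -scalerDr.
move: (normal_form _ _ xi s + _) (normal_form _ _ xi t + _) => x y.
move: ('D_s _ _) ('D_t _ _) => x' y'.
rewrite mulmxDr mulmxDl -scalemxAr -scalemxAl mxtraceD mxtraceZ mulrDr.
exact: addrACA.
Qed.

Lemma stationary_second_derivative (E : normedModType R) (sg : E -> 'M[R]_p) (N : set E)
    v w : open N -> N 0 -> Ck 2 N sg -> (forall y, N y -> embedded_psd r (sg y)) ->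
  sg 0 = X ->
  is_derive 0 v ('D_w (f \o sg)) (hess_form ('D_v sg 0) ('D_w sg 0)).
Proof.
move=> oN N0 Csg sgM sg0.
apply: is_derive_eq (second_derive_comp v w hf oN N0 Csg) _.
have dsg : derivable ('D_w sg) 0 v.
  have [_ Dsg] := Csg; have C1 : Ck 1 N ('D_w sg) := Dsg w.
  exact/diff_derivable/(Ck_differentiable C1 N0).
have Zsym : is_sym ('D_v ('D_w sg) 0).
  apply: derive_sym => //; apply: (@filterS _ _ _ N); last exact: open_nbhs_nbhs.
  move=> y Ny; apply: derive_sym.
    exact/diff_derivable/(Ck_differentiable Csg Ny).
  apply: (@filterS _ _ _ N) => [z /sgM[[]]//|]; exact: open_nbhs_nbhs.
rewrite /hess_form sg0; congr (_ + _).
rewrite (stationary_tangent rp hf hfT hU hB gradf0 Zsym).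
by rewrite (normal_second_derivative rp hU hB oN N0 Csg sgM sg0).
Qed.

Lemma chart_Me d (s : 'rV[R]_d -> 'M[R]_p) : parametrization M X s ->
  stationary_chart M f X hess_form s.
Proof.
move=> [s0 [N [[oN N0] ss sM [sT _ _]]]].
have ds := smooth_differentiable ss N0.
split.
- by move=> a v w; rewrite /= deriveDl// deriveZl.
- move=> i j.
  have H : Ck 0 N (fun y => \tr (('D_(delta_mx 0 i) s y)^T *m 'D_(delta_mx 0 j) s y)).
    have D1 u : Ck 0 N ('D_u s) by case: (ss 1%N) => _ /(_ u).
    exact: (Ck_mxtrace oN (Ck_mulmx oN (Ck_trmx oN (D1 _)) (D1 _))).
  have -> : (fun y => gram M s y i j) =
     (fun y => \tr (('D_(delta_mx 0 i) s y)^T *m 'D_(delta_mx 0 j) s y)).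
    by apply/funext => y; rewrite mxE.
  exact: (H 0 N0).
- move=> l; rewrite (derive_comp _ ds (C2_differentiable hf _)) s0.
  have := sT (delta_mx 0 l) I => /= tl.
  have /(tangent_embeddedP rp hU hB)[lT lK] := tl.
  by rewrite (stationary_tangent rp hf hfT hU hB gradf0 lT) lK mulmx0 mul0mx mxtrace0.
- move=> v l /=; exact: (stationary_second_derivative _ _ oN N0 (ss 2%N) sM s0).
Qed.


Section TotalSpaceChart.
Variables (d : nat) (s : 'rV[R]_d -> 'M[R]_(p, r) * 'M[R]_r) (N : set 'rV[R]_d).
Hypotheses (oN : open N) (ss : smooth_on N s) (sM : forall y, N y -> total_space (s y)).

Lemma total_velocity y v : N y ->
  ((s y).1^T *m ('D_v s y).1)^T = - ((s y).1^T *m ('D_v s y).1) /\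
  ('D_v s y).2^T = ('D_v s y).2.
Proof.
move=> Ny; have ds := smooth_differentiable ss Ny.
have nN : \forall z \near y, N z by exact: open_nbhs_nbhs.
have d1 : derivable (fun z => (s z).1) y v by exact/diff_derivable/differentiable_fst.
have d2 : derivable (fun z => (s z).2) y v by exact/diff_derivable/differentiable_snd.
rewrite -(derive_fst (diff_derivable ds)) -(derive_snd (diff_derivable ds)).
split; last first.
  by apply: derive_sym => //; apply: filterS nN => z /sM[_ []].
have [dT eT] := derive_trmx d1.
have := is_deriveE (derive_mulmx dT d1); rewrite eT.
rewrite (near_eq_derive (g := cst 1%:M)); last by apply: filterS nN => z /sM[].
by rewrite derive_cst trmx_mul trmxK => /eqP; rewrite eq_sym addr_eq0 => /eqP ->.
Qed.

(** The components of the lifted coordinate velocity, written through [s y] and its derivative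
    alone. [perp] at a moving point is a mere choice, so a formula containing it would not yield
    continuity of the Gram matrix. *)
Definition lift1 y i := ('D_(delta_mx 0 i) s y).1 -
  (s y).1 *m ((s y).1^T *m ('D_(delta_mx 0 i) s y).1).
Definition lift2 y i := ('D_(delta_mx 0 i) s y).2 -
  ((s y).2 *m ((s y).1^T *m ('D_(delta_mx 0 i) s y).1) -
   (s y).1^T *m ('D_(delta_mx 0 i) s y).1 *m (s y).2).

Lemma hlift_chart y i : N y ->
  hlift (s y) ('D_(delta_mx 0 i) s y) = (lift1 y i, lift2 y i).
Proof.
move=> Ny; have [sy1 sy2] := sM Ny; have [v1 v2] := total_velocity (delta_mx 0 i) Ny.
rewrite {1}[s y]surjective_pairing (hlift_vertical rp sy1 sy2 v1 v2).
by rewrite [LHS]surjective_pairing.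
Qed.

(** The second component of a chart is symmetric, so [symmetrize], through which smoothness of the
    weight is expressed, acts as the identity along it. *)
Lemma smooth_weight (F : 'M[R]_r -> 'M[R]_r) : smooth_spd_weight F ->
  Ck 0 N (fun y => F (s y).2).
Proof.
move=> [_ sF]; have C2 := Ck_snd oN (ss 0%N).
have symE y : N y -> symmetrize (s y).2 = (s y).2.
  move=> /sM[_ [sT _]]; rewrite /symmetrize sT scalerDr -scalerDl.
  have -> : 2^-1 + 2^-1 = 1 :> R by lra.
  by rewrite scale1r.
have H : Ck 0 N (fun y => F (symmetrize (s y).2)).
  move=> y Ny; apply: (cvg_comp _ (fun A => F (symmetrize A)) (C2 y Ny)).
  apply: (sF 0%N); rewrite /= symE//; exact: (sM Ny).2.
by apply: (Ck_eq oN _ H) => y Ny; rewrite symE.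
Qed.

Lemma gram_continuous i j : Ck 0 N (fun y => gram Mq s y i j).
Proof.
have D1 u : Ck 0 N ('D_u s) by case: (ss 1%N) => _ /(_ u).
have C0 := ss 0%N.
have C1 := Ck_fst oN C0; have C2 := Ck_snd oN C0; have C1T := Ck_trmx oN C1.
have DC k := Ck_fst oN (D1 (delta_mx 0 k)); have DC2 k := Ck_snd oN (D1 (delta_mx 0 k)).
have Om k := Ck_mulmx oN C1T (DC k).
have L1 k : Ck 0 N (fun y => lift1 y k).
  exact: (Ck_subr oN (DC k) (Ck_mulmx oN C1 (Om k))).
have L2 k : Ck 0 N (fun y => lift2 y k).
  exact: (Ck_subr oN (DC2 k) (Ck_subr oN (Ck_mulmx oN C2 (Om k)) (Ck_mulmx oN (Om k) C2))).
have CV := smooth_weight sV; have CW := smooth_weight sW.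
have H1 := Ck_mxtrace oN (Ck_mulmx oN (Ck_mulmx oN CV (Ck_trmx oN (L1 i))) (L1 j)).
have H2 := Ck_mxtrace oN (Ck_mulmx oN (Ck_mulmx oN (Ck_mulmx oN CW (L2 i)) CW) (L2 j)).
apply: (Ck_eq oN _ (CkD oN H1 H2)) => y Ny.
have gE : gram Mq s y i j = total_metric V W (s y)
    (hlift (s y) ('D_(delta_mx 0 i) s y)) (hlift (s y) ('D_(delta_mx 0 j) s y)).
  by rewrite mxE.
apply/esym; apply: (etrans gE).
exact: (congr2 (total_metric V W (s y)) (hlift_chart i Ny) (hlift_chart j Ny)).
Qed.

End TotalSpaceChart.

Lemma chart_Mq d (s : 'rV[R]_d -> 'M[R]_(p, r) * 'M[R]_r) :
  parametrization Mq (U, B) s ->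
  stationary_chart Mq (hq f) (U, B)
    (fun a b => hess_form (Lmap (U, B) a) (Lmap (U, B) b)) s.
Proof.
move=> [s0 [N [[oN N0] ss sM [sT _ _]]]].
have ds := smooth_differentiable ss N0.
have tv v : (U^T *m ('D_v s 0).1)^T = - (U^T *m ('D_v s 0).1) /\
    ('D_v s 0).2^T = ('D_v s 0).2.
  by have := total_velocity oN ss sM v N0; rewrite s0.
pose sg := conj_map \o s.
have Csg : Ck 2 N sg by apply: conj_map_Ck => //; exact: ss.
have sgM y : N y -> embedded_psd r (sg y).
  by move=> /sM[s1 s2]; exact: embedded_psd_mul s1 s2.
have sg0 : sg 0 = X by rewrite /sg /= /conj_map s0.
have sgD v : 'D_v sg 0 = Lmap (U, B) (hlift (U, B) ('D_v s 0)).
  have [t1 t2] := tv v; rewrite (Lmap_hlift rp hU hB t1 t2).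
  by rewrite /sg derive_conj_map ?s0//; exact: diff_derivable.
split.
- move=> a v w.
  (* [hlift] is a [get], so linearity is read off the closed formula it agrees with on velocities of
     charts. *)
  pose hl (x : 'M[R]_(p, r) * 'M[R]_r) := (K *m K^T *m x.1,
    x.2 - (B *m (U^T *m x.1) - U^T *m x.1 *m B)).
  have hE u : hlift (U, B) ('D_u s 0) = hl ('D_u s 0).
    by have [u1 u2] := tv u; exact: hliftE.
  apply: (etrans (hE (a *: v + w))); apply/esym.
  apply: (etrans (congr2 (fun x y => a *: x + y) (hE v) (hE w))).
  have D : 'D_(a *: v + w) s 0 = a *: 'D_v s 0 + 'D_w s 0 by rewrite deriveDl// deriveZl.
  apply: etrans _ (congr1 hl (esym D)).
  move: ('D_v s 0) ('D_w s 0) => x y.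
  rewrite [LHS]surjective_pairing /hl /=; congr pair.
    by rewrite mulmxDr scalemxAr.
  rewrite !mulmxDr !mulmxDl -!scalemxAr -!scalemxAl !scalerBr.
  rewrite addrACA -opprD; congr (_ - _).
  by rewrite opprD addrACA -opprD.
- by move=> i j; exact: (gram_continuous oN ss sM N0).
- move=> l; rewrite -[hq f \o s]/(f \o sg).
  rewrite (derive_comp _ (Ck_differentiable Csg N0) (C2_differentiable hf _)).
  rewrite sg0 sgD; have tl := sT (delta_mx 0 l) I.
  have /(tangent_embeddedP rp hU hB)[lT lK] := Lmap_tangent rp hU hB tl.
  by rewrite (stationary_tangent rp hf hfT hU hB gradf0 lT) lK mulmx0 mul0mx mxtrace0.
- move=> v l.
  have H := stationary_second_derivative v (delta_mx 0 l) oN N0 Csg sgM sg0.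
  exact: (is_derive_eq H (congr2 hess_form (sgD v) (sgD (delta_mx 0 l)))).
Qed.

End StationaryHessian.

(** * Spectra of the Hessians *)

Section OperatorEigenvalues.
Variable R : realType.

Variables (V : lmodType R) (E : set V).
Definition lincomb n (e : 'I_n -> V) (c : 'rV[R]_n) : V := \sum_i c 0 i *: e i.

Lemma lincomb_delta n (e : 'I_n -> V) i : lincomb e (delta_mx 0 i) = e i.
Proof.
rewrite /lincomb (bigD1 i)//= mxE !eqxx scale1r big1 ?addr0// => j ji.
by rewrite mxE (negbTE ji) andbF scale0r.
Qed.

Lemma lincomb_mul m n (e : 'I_n -> V) (C : 'M[R]_(m, n)) (x : 'rV[R]_m) :
  lincomb (fun i => lincomb e (row i C)) x = lincomb e (x *m C).
Proof.
rewrite /lincomb.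
under eq_bigr do rewrite scaler_sumr.
rewrite exchange_big /=; apply: eq_bigr => j _; rewrite mxE scaler_suml.
by apply: eq_bigr => i _; rewrite scalerA mxE.
Qed.

Lemma basis_change m n (e : 'I_m -> V) (e' : 'I_n -> V) :
  set_bij [set: 'rV[R]_m] E (lincomb e) -> set_bij [set: 'rV[R]_n] E (lincomb e') ->
  exists C : 'M[R]_(m, n), forall i, e i = lincomb e' (row i C).
Proof.
move=> [eE _ _] [_ _ sur].
have H i : exists c, lincomb e' c = e i.
  have [|c _ <-] := sur (e i); last by exists c.
  by rewrite -lincomb_delta; exact: (eE (delta_mx 0 i) I).
exists (\matrix_i projT1 (cid (H i))) => i.
by rewrite rowK; case: (cid (H i)).
Qed.

(** The basis, its size and the matrix in [op_eigenvalues] are all chosen. Two bases are related by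
    mutually inverse matrices, so the sizes agree and the two matrices of [T] are similar. *)
Lemma op_eigenvalues_basis n (e : 'I_n -> V) (T : V -> V) (A : 'M[R]_n) s :
  set_bij [set: 'rV[R]_n] E (lincomb e) ->
  (forall c, T (lincomb e c) = lincomb e (c *m A)) -> is_eigenvalues A s ->
  op_eigenvalues E T = s.
Proof.
move=> eb TA sA.
have linc m (e' : 'I_m -> V) (B : 'M[R]_m) i : \sum_j B i j *: e' j = lincomb e' (row i B).
  by apply: eq_bigr => j _; rewrite mxE.
rewrite /op_eigenvalues; case: xgetP => [s' _ |/(_ s) not_s]; last first.
  by case: not_s; exists n, e, A; split=> // i; rewrite linc -[e i]lincomb_delta TA -rowE.
move=> [m [e' [A' [eb' TA' sA']]]].
have inj k (e1 : 'I_k -> V) (b : set_bij [set: 'rV[R]_k] E (lincomb e1)) c c' :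
    lincomb e1 c = lincomb e1 c' -> c = c'.
  by have [_ + _] := b; move=> h cc; apply: h; rewrite ?inE.
have [C CE] := basis_change eb' eb; have [C' CE'] := basis_change eb eb'.
have CC' : C *m C' = 1%:M.
  apply/row_matrixP => i; apply: (inj _ _ eb').
  rewrite row_mul row1 lincomb_delta CE -lincomb_mul.
  by apply: eq_bigr => j _; rewrite -CE'.
have C'C : C' *m C = 1%:M.
  apply/row_matrixP => i; apply: (inj _ _ eb).
  rewrite row_mul row1 lincomb_delta CE' -lincomb_mul.
  by apply: eq_bigr => j _; rewrite -CE.
have mn : m = n.
  apply/eqP; rewrite eqn_leq; apply/andP; split.
    rewrite -[X in (X <= _)%N](mxrank1 R) -CC'.
    by apply: leq_trans (mxrankM_maxl _ _) _; exact: rank_leq_col.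
  rewrite -[X in (X <= _)%N](mxrank1 R) -C'C.
  by apply: leq_trans (mxrankM_maxl _ _) _; exact: rank_leq_col.
have CA : C *m A = A' *m C.
  apply/row_matrixP => i; apply: (inj _ _ eb).
  rewrite !row_mul -TA -CE TA' linc -lincomb_mul.
  by apply: eq_bigr => j _; rewrite -CE.
clear - sA sA' CA CC' mn.
(* Identifying the two sizes makes the change of basis a square matrix, to which similarity
   applies. *)
case: _ / mn A C C' sA CA CC' => A C C' sA CA CC'.
have uC : C \in unitmx by case: (mulmx1_unit CC').
apply: (is_eigenvalues_uniq _ sA' sA); apply/esym; exact: char_poly_similar uC CA.
Qed.

End OperatorEigenvalues.

Section InnerOperator.
Variables (R : realType) (V : lmodType R) (E : set V) (g Q : V -> V -> R) (H : V -> V).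
Variables (n : nat) (e : 'I_n -> V).
Hypothesis gE : inner_on E g.
Hypothesis QC : forall xi eta, Q xi eta = Q eta xi.
Hypothesis Qlin : forall xi a s t, Q xi (a *: s + t) = a * Q xi s + Q xi t.
Hypothesis HE : forall xi, E xi ->
  E (H xi) /\ forall eta, E eta -> g (H xi) eta = Q xi eta.
Hypothesis eb : set_bij [set: 'rV[R]_n] E (lincomb e).

Definition gram_matrix (q : V -> V -> R) : 'M[R]_n := \matrix_(i, j) q (e i) (e j).

Lemma form_lincomb (q : V -> V -> R) x y :
  (forall xi eta, q xi eta = q eta xi) ->
  (forall xi a s t, q xi (a *: s + t) = a * q xi s + q xi t) ->
  q (lincomb e x) (lincomb e y) = bil (gram_matrix q) x y.
Proof.
move=> qC ql.
have q0 xi : q xi 0 = 0.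
  by have := ql xi (-1) 0 0; rewrite scaler0 addr0 mulN1r addNr.
have qs xi c : q xi (lincomb e c) = \sum_i c 0 i * q xi (e i).
  rewrite /lincomb.
  by elim: (index_enum _) => [|i s IH]; rewrite ?big_nil// !big_cons ql IH.
rewrite qs /bil mxE; apply: eq_bigr => j _.
rewrite qC qs mulrC [y^T _ _]mxE; congr (_ * _).
by rewrite mxE; apply: eq_bigr => i _; rewrite mxE qC.
Qed.

Let G := gram_matrix g.
Let A := gram_matrix Q.

Lemma inner_gram_qform x : qform G x = g (lincomb e x) (lincomb e x).
Proof.
rewrite form_lincomb//; first exact: inner_sym gE.
by move=> *; exact: (inner_linr gE).
Qed.

Lemma gram_spd : spd G.
Proof.
apply/spdP; split.
  by apply/matrixP => i j; rewrite !mxE (inner_sym gE).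
move=> x x0; rewrite inner_gram_qform; have [eE inj _] := eb.
apply: (inner_pos gE); first exact: (eE x I).
apply: contra_neq x0 => ex0; apply: inj; rewrite ?inE// ex0.
by rewrite /lincomb big1// => i _; rewrite mxE scale0r.
Qed.

Lemma op_eigenvalues_pencil : is_eigenvalues (A *m invmx G) (op_eigenvalues E H).
Proof.
have AT : A^T = A by apply/matrixP => i j; rewrite !mxE QC.
have uG := spd_unitmx gram_spd.
have gl xi a s t : g xi (a *: s + t) = a * g xi s + g xi t := inner_linr gE a s t xi.
have [s sP] := pencil_is_eigenvalues AT gram_spd.
have eE c : E (lincomb e c) by have [eE _ _] := eb; exact: (eE c I).
rewrite (op_eigenvalues_basis eb _ sP)// => c.
have [EH gH] := HE (eE c); apply: (inner_ext gE) => // u.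
have [_ _ /[apply] -[y _ <-]] := eb.
rewrite gH// (form_lincomb _ _ QC Qlin) (form_lincomb _ _ (inner_sym gE) gl).
by rewrite /bil mulmxA mulmxKV.
Qed.

End InnerOperator.

(** * Linear coordinates on the horizontal space and its dimension *)

Section Coordinates.
Variable R : realType.

Lemma coord_mx_Ck n m q (phi : 'I_m -> 'I_q -> 'I_n) k :
  Ck k setT (fun y : 'rV[R]_n => \matrix_(i, j) y 0 (phi i j)).
Proof.
have o := @openT 'rV[R]_n; apply/(Ck_mxP _ _ o) => i j.
have /(Ck_mxP _ _ o) /(_ 0 (phi i j)) := @Ck_id R 'rV[R]_n k setT.
by apply: (Ck_eq o) => y _; rewrite mxE.
Qed.

Lemma coord_mx_derive n m q (phi : 'I_m -> 'I_q -> 'I_n) x v :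
  'D_v (fun y : 'rV[R]_n => \matrix_(i, j) y 0 (phi i j)) x =
  \matrix_(i, j) v 0 (phi i j).
Proof.
have d : derivable (fun y : 'rV[R]_n => \matrix_(i, j) y 0 (phi i j)) x v.
  exact/diff_derivable/(Ck_differentiable (coord_mx_Ck phi 1) I).
rewrite (derive_mx d); apply/matrixP => i j; rewrite !mxE.
have -> : (fun t : 'rV[R]_n => (\matrix_(i, j) t 0 (phi i j)) i j) =
   (fun t => t 0 (phi i j)) by apply/funext => t; rewrite mxE.
have dI : derivable (fun y : 'rV[R]_n => y) x v by exact: derivable_id.
by rewrite (derive_coef _ _ dI) (derive_id x v : 'D_v (fun y => y) x = v).
Qed.

Variables (p r : nat).

(** Indices of the independent entries of a symmetric matrix, on and above the diagonal. *)
Definition ordered_pair := {x : 'I_r * 'I_r | (x.1 <= x.2)%N}.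

Fact order_pair_subproof (i j : 'I_r) :
  let x := if (i <= j)%N then (i, j) else (j, i) in (x.1 <= x.2)%N.
Proof. by case: (leqP i j) => [//|/ltnW]. Qed.

Definition order_pair (i j : 'I_r) : ordered_pair :=
  exist (fun x : 'I_r * 'I_r => is_true (x.1 <= x.2)%N) _ (order_pair_subproof i j).

Lemma order_pairC i j : order_pair i j = order_pair j i.
Proof.
apply: val_inj => /=; case: (ltngtP i j) => // /val_inj ->.
by [].
Qed.

Lemma order_pairK (x : ordered_pair) : order_pair (val x).1 (val x).2 = x.
Proof. by apply: val_inj => /=; rewrite (valP x); case: (val x). Qed.

(** The swap matches the strict triangles, and the diagonal has [r] elements. Doubling avoids a
    division in the naturals. *)
Lemma card_ordered_pair : (#|{: ordered_pair}| * 2 = r ^ 2 + r)%N.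
Proof.
rewrite card_sig.
pose le := [pred x : 'I_r * 'I_r | (x.1 <= x.2)%N].
pose gt := [pred x : 'I_r * 'I_r | (x.2 < x.1)%N].
pose lt := [pred x : 'I_r * 'I_r | (x.1 < x.2)%N].
pose dg := [pred x : 'I_r * 'I_r | x.1 == x.2].
have E1 : (#|le| + #|gt| = r ^ 2)%N.
  have -> : #|gt| = #|[predC le]| by apply: eq_card => x; rewrite !inE ltnNge.
  by rewrite cardC card_prod !card_ord mulnn.
have swap_inj : injective (fun x : 'I_r * 'I_r => (x.2, x.1)).
  by move=> [a b] [c d] /= [-> ->].
have E2 : #|gt| = #|lt|.
  rewrite -(fintype.card_image swap_inj); apply: eq_card => x.
  apply/fintype.imageP/idP => [[y yg ->]|xl]; first exact: yg.
  by exists (x.2, x.1) => //; case: (x).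
have diag_inj : injective (fun i : 'I_r => (i, i)) by move=> a b [].
have E3 : #|dg| = r.
  rewrite -[RHS]card_ord -(fintype.card_image diag_inj); apply: eq_card => -[a b].
  apply/idP/fintype.imageP => /= [/eqP /= ->|[i _ [-> ->]]]; first by exists b.
  by rewrite inE /=.
have E4 : (#|le| = #|lt| + #|dg|)%N.
  rewrite -cardUI -[LHS]addn0; congr (_ + _)%N.
    by apply: eq_card => x; rewrite !inE leq_eqVlt orbC.
  apply/esym/eqP/pred0P => x; rewrite !inE.
    by case: (eqVneq x.1 x.2) => [->|]; rewrite ?ltnn ?andbF.
have -> : #|[pred x : 'I_r * 'I_r | (x.1 <= x.2)%N]| = #|le| by [].
lia.
Qed.

Notation index := ('I_(p - r) * 'I_r + ordered_pair)%type.

Lemma card_index : (r <= p)%N ->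
  #|{: index}| = (p * r - (r ^ 2 - r) %/ 2)%N.
Proof.
move=> rp; rewrite card_sum card_prod !card_ord; have := card_ordered_pair.
move: #|_| => a E.
have h : (r <= r ^ 2)%N by rewrite -mulnn; case: (r) => // k; rewrite leq_pmulr.
have -> : ((r ^ 2 - r) %/ 2 = a - r)%N.
  by have -> : (r ^ 2 - r = (a - r) * 2)%N; [lia|rewrite mulnK].
have : (p * r = (p - r) * r + r ^ 2)%N by rewrite -mulnn -mulnDl subnK.
by move=> ->; move: E h; move: ((p - r) * r)%N (r ^ 2)%N => q s; lia.
Qed.

Let n := #|{: index}|.

Definition rect_part (y : 'rV[R]_n) : 'M[R]_(p - r, r) :=
  \matrix_(i, j) y 0 (enum_rank (inl (i, j) : index)).
Definition sym_part (y : 'rV[R]_n) : 'M[R]_r :=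
  \matrix_(i, j) y 0 (enum_rank (inr (order_pair i j) : index)).

Lemma sym_part_tr y : (sym_part y)^T = sym_part y.
Proof. by apply/matrixP => i j; rewrite !mxE order_pairC. Qed.

Lemma parts_linear a y z :
  rect_part (a *: y + z) = a *: rect_part y + rect_part z /\
  sym_part (a *: y + z) = a *: sym_part y + sym_part z.
Proof. by split; apply/matrixP => i j; rewrite !mxE. Qed.

Lemma parts_inj y z : rect_part y = rect_part z -> sym_part y = sym_part z -> y = z.
Proof.
move=> /matrixP D /matrixP S; apply/rowP => k; rewrite -[k]enum_valK.
case: (enum_val k) => [[i j]|x]; first by have := D i j; rewrite !mxE.
by have := S (val x).1 (val x).2; rewrite !mxE order_pairK.
Qed.

Lemma parts_surj D S : S^T = S -> exists y, rect_part y = D /\ sym_part y = S.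
Proof.
move=> ST; exists (\row_k match enum_val k with
  | inl ij => D ij.1 ij.2 | inr x => S (val x).1 (val x).2 end); split;
  apply/matrixP => i j; rewrite !mxE enum_rankK //=.
case: ifP => //= _; by rewrite -[in RHS]ST mxE.
Qed.

End Coordinates.

(** The arithmetic of [metric_bounds]: [x] and [y] are the W- and V-parts of the quotient metric,
    [w] and [v] the matching parts of the squared norm of the image under [Lmap]. *)
Lemma weighted_bounds (R : realDomainType) (x y w v c1 c2 c3 c4 a b : R) :
  0 <= x -> 0 <= y -> c1 * x <= w -> w <= c2 * x -> c3 * y <= v -> v <= c4 * y ->
  a <= c1 -> a <= 2 * c3 -> c2 <= b -> 2 * c4 <= b ->
  a * (y + x) <= 2 * v + w /\ 2 * v + w <= b * (y + x).
Proof.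
move=> x0 y0 w1 w2 v1 v2 a1 a2 b1 b2.
have := ler_wpM2r x0 a1; have := ler_wpM2r y0 a2.
have := ler_wpM2r x0 b1; have := ler_wpM2r y0 b2.
by move=> *; split; lra.
Qed.

Lemma eq_set_bij (T T' : Type) (A : set T) (A' : set T') (g h : T -> T') :
  (forall x, g x = h x) -> set_bij A A' g -> set_bij A A' h.
Proof. by move=> /funext ->. Qed.

(** * The two Hessians compared through [Lmap] *)

Section Spectra.
Variables (R : realType) (p r : nat) (f : 'M[R]_p -> R) (V W : 'M[R]_r -> 'M[R]_r).
Variables (U : 'M[R]_(p, r)) (B : 'M[R]_r).
Hypotheses (r0 : (0 < r)%N) (rp : (r <= p)%N).
Hypotheses (hf : Ck 2 setT f) (hfT : forall X, f X = f X^T).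
Hypotheses (sV : smooth_spd_weight V) (sW : smooth_spd_weight W).
Hypotheses (hU : stiefel U) (hB : spd B).
Let X := U *m B *m U^T.
Let K := perp U.
Let M := Me R p r.
Let Mq := Mq2 p V W.
Let n := #|{: 'I_(p - r) * 'I_r + ordered_pair r}|.
Let hV : spd (V B) := sV.1 B hB.
Let hW : spd (W B) := sW.1 B hB.

Definition horizontal_vector (c : 'rV[R]_n) : 'M[R]_(p, r) * 'M[R]_r :=
  (K *m rect_part c, sym_part c).
Definition horizontal_basis (i : 'I_n) := horizontal_vector (delta_mx 0 i).

Lemma horizontal_vectorP a c d : horizontal_vector (a *: c + d) =
  a *: horizontal_vector c + horizontal_vector d.
Proof.
have [Dl Sl] := parts_linear a c d; rewrite /horizontal_vector Dl Sl.
by rewrite mulmxDr -scalemxAr.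
Qed.

Lemma horizontal_vectorE c : horizontal_vector c = lincomb horizontal_basis c.
Proof.
have h0 : horizontal_vector 0 = 0.
  by have := horizontal_vectorP (-1) 0 0; rewrite scaler0 addr0 scaleN1r addNr.
have {1}-> : c = \sum_i c 0 i *: delta_mx 0 i.
  by rewrite [LHS]matrix_sum_delta big_ord1.
rewrite /lincomb; elim: (index_enum _) => [|i s IH]; first by rewrite !big_nil h0.
by rewrite !big_cons horizontal_vectorP IH.
Qed.

Lemma horizontal_bij : set_bij [set: 'rV[R]_n] (horizontal (U, B)) horizontal_vector.
Proof.
have KK := perp_tr rp hU; rewrite -/K in KK; split.
- move=> c _; split; first by exists (rect_part c).
  exact: sym_part_tr.
- move=> c d _ _ [E1 E2]; apply: parts_inj => //.
  by rewrite -[LHS]mul1mx -[RHS]mul1mx -KK -!mulmxA E1.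
- move=> [t1 t2] [[D /= ->] tT]; have [c [cD cS]] := parts_surj D tT.
  by exists c => //; rewrite /horizontal_vector cD cS.
Qed.

Lemma Lmap_bij : set_bij (horizontal (U, B)) (tspace M X) (Lmap (U, B)).
Proof.
have UK := tr_mul_perp rp hU; have KU := perp_mul_tr rp hU.
have KK := perp_tr rp hU; have uB := spd_unitmx hB; split.
- by move=> t; exact: Lmap_tangent.
- have H t : horizontal (U, B) t -> t = (K *m (K^T *m Lmap (U, B) t *m U *m invmx B),
      U^T *m Lmap (U, B) t *m U).
    case: t => t1 t2 [[D /= ->] _]; rewrite /Lmap /= trmx_mul; congr pair.
      rewrite !mulmxDr !mulmxDl !mulmxA KU !mul0mx !add0r KK mul1mx.
      by rewrite -(mulmxA _ U^T) hU mulmx1 mulmxK.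
    rewrite !mulmxDr !mulmxDl !mulmxA hU UK !mul0mx addr0 mul1mx.
    by rewrite -!mulmxA KU !mulmx0 add0r mul1mx hU mulmx1.
  by move=> s t; rewrite !inE => hs ht st; rewrite (H s hs) (H t ht) st.
- move=> xi /(tangent_embeddedP rp hU hB)[xT xK].
  exists (K *m (K^T *m xi *m U *m invmx B), U^T *m xi *m U).
    split; first by eexists.
    by rewrite /is_sym /= !trmx_mul trmxK xT mulmxA.
  exact/esym/(Lmap_surj rp hU hB xT xK).
Qed.

Let D : 'rV[R]_n -> 'M[R]_(p - r, r) := @rect_part R p r.
Let S : 'rV[R]_n -> 'M[R]_r := @sym_part R p r.

Lemma parts_smooth : smooth_on setT D /\ smooth_on setT S.
Proof. by split=> k; exact: coord_mx_Ck. Qed.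

Lemma parts0 : D 0 = 0 /\ S 0 = 0.
Proof. by split; apply/matrixP => i j; rewrite !mxE. Qed.

Lemma parts_derive v : (K *m 'D_v D 0, 'D_v S 0) = horizontal_vector v.
Proof. by rewrite /D /S !coord_mx_derive. Qed.

Lemma parametrization_Me : parametrization M X (embedded_chart U B D S).
Proof.
have [sD sS] := parts_smooth; have [D0 S0] := parts0.
have ST y : (S y)^T = S y by exact: sym_part_tr.
split; first by apply: embedded_chart0.
have [N [oN N0 Ns]] := spd_domain hB sS ST S0.
exists N; split; first by split.
- by move=> k; apply: (@Ck_sub _ _ _ _ _ setT) (embedded_chart_smooth _ _ sD sS k).
- move=> y Ny; suff: embedded_psd r (embedded_chart U B D S y) by [].
  by apply: embedded_chart_in => //; exact: Ns.
(* The differential of the chart at 0 factors through the horizontal space, each factor being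
   bijective. *)
- apply: (eq_set_bij _ (set_bij_comp horizontal_bij Lmap_bij)) => v.
  exact: (esym (etrans (embedded_chart_derive U B sD sS D0 S0 v)
    (congr1 (Lmap (U, B)) (parts_derive v)))).
Qed.

Lemma hlift_horizontal t : horizontal (U, B) t -> hlift (U, B) t = t.
Proof.
have UK := tr_mul_perp rp hU.
case: t => t1 t2 [[E /= ->] tT].
have Z : U^T *m (perp U *m E) = 0 by rewrite mulmxA UK mul0mx.
rewrite (hlift_vertical rp hU hB) /= ?Z ?trmx0 ?oppr0//.
rewrite mulmx0 mul0mx mulmx0 subrr.
by rewrite [LHS]surjective_pairing /= !subr0.
Qed.

Lemma parametrization_Mq : parametrization Mq (U, B) (quotient_chart U B D S).
Proof.
have [sD sS] := parts_smooth; have [D0 S0] := parts0.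
have ST y : (S y)^T = S y by exact: sym_part_tr.
split; first by apply: quotient_chart0.
have [N [oN N0 Ns]] := spd_domain hB sS ST S0.
exists N; split; first by split.
- by move=> k; apply: (@Ck_sub _ _ _ _ _ setT) (quotient_chart_smooth _ _ sD sS k).
- move=> y Ny; suff: total_space (quotient_chart U B D S y) by [].
  by apply: quotient_chart_in => //; exact: Ns.
- apply: (eq_set_bij _ horizontal_bij) => v.
  have E := etrans (quotient_chart_derive B rp hU sD sS D0 v) (parts_derive v).
  apply/esym; apply: (etrans (congr1 (hlift (U, B)) E)).
  by apply: hlift_horizontal; have [h _ _] := horizontal_bij; exact: h.
Qed.

Hypothesis gradf0 : rgrad M f X = 0.

Lemma rhess_MeP xi : tspace M X xi ->
  tspace M X (rhess M f X xi) /\ forall eta, tspace M X eta ->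
  metric M X (rhess M f X xi) eta = hess_form f U B xi eta.
Proof.
apply: (rhess_stationary (inner_Me rp hU hB) _ _ parametrization_Me).
- by move=> z a s t _ _; exact: hess_form_lin.
- by move=> d s; exact: chart_Me.
Qed.

Lemma rhess_MqP xi : tspace Mq (U, B) xi ->
  tspace Mq (U, B) (rhess Mq (hq f) (U, B) xi) /\
  forall eta, tspace Mq (U, B) eta ->
  metric Mq (U, B) (rhess Mq (hq f) (U, B) xi) eta =
  hess_form f U B (Lmap (U, B) xi) (Lmap (U, B) eta).
Proof.
pose Q a b := hess_form f U B (Lmap (U, B) a) (Lmap (U, B) b).
have Qlin z a s t : tspace Mq (U, B) s -> tspace Mq (U, B) t ->
    Q z (a *: s + t) = a * Q z s + Q z t.
  by move=> _ _; rewrite /Q LmapP; exact: hess_form_lin.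
have ch d (s : 'rV[R]_d -> 'M[R]_(p, r) * 'M[R]_r) : parametrization Mq (U, B) s ->
    stationary_chart Mq (hq f) (U, B) Q s by exact: chart_Mq.
exact: (rhess_stationary (inner_Mq U hV hW) Qlin ch parametrization_Mq).
Qed.

Lemma rhess_form_eq theta : horizontal (U, B) theta ->
  rhess_form Mq (hq f) (U, B) theta theta =
  rhess_form M f X (Lmap (U, B) theta) (Lmap (U, B) theta).
Proof.
move=> th; have Lth := Lmap_tangent rp hU hB th.
exact: (etrans ((rhess_MqP th).2 _ th) (esym ((rhess_MeP Lth).2 _ Lth))).
Qed.

Lemma metric_bounds t : horizontal (U, B) t ->
  let a := Num.min (sigma r (invmx (W B)) ^+ 2)
                   (2 * sigma r (invmx (sqrtmx (V B)) *m B) ^+ 2) in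
  let b := Num.max (sigma 1 (invmx (W B)) ^+ 2)
                   (2 * sigma 1 (invmx (sqrtmx (V B)) *m B) ^+ 2) in
  a * metric Mq (U, B) t t <= metric M X (Lmap (U, B) t) (Lmap (U, B) t) /\
  metric M X (Lmap (U, B) t) (Lmap (U, B) t) <= b * metric Mq (U, B) t t.
Proof.
case: t => t1 t2 [[E t1E] tT'].
have {t1E}-> : t1 = perp U *m E by []; have {tT'}tT : t2^T = t2 by [].
move=> a b.
have KK := perp_tr rp hU; have UK := tr_mul_perp rp hU; have KU := perp_mul_tr rp hU.
have [BT _] := hB.
have /andP[w1 w2] := W_weight_bounds r0 hW tT.
have /andP[v1 v2] := V_weight_bounds E r0 hV hB.
have gp := inner_pos (inner_Mq U hV hW).
have ge0 s : tspace Mq (U, B) s -> 0 <= metric Mq (U, B) s s.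
  move=> Es; have [->|s0] := eqVneq s 0; last exact/ltW/gp.
  by rewrite /= /total_metric /= trmx0 !mulmx0 mxtrace0 addr0.
have x0 : 0 <= \tr (W B *m t2 *m W B *m t2).
  have := ge0 (0, t2); rewrite /= /total_metric /= trmx0 !mulmx0 mxtrace0 add0r; apply.
  by split=> //; exists 0; rewrite /= mulmx0.
have y0 : 0 <= \tr (V B *m E^T *m E).
  have := ge0 (K *m E, 0); rewrite /= /total_metric /= !mulmx0 mxtrace0 addr0.
  rewrite trmx_mul !mulmxA -(mulmxA _ K^T) KK mulmx1; apply.
  by split; [exists E|rewrite /is_sym trmx0].
have -> : metric Mq (U, B) (perp U *m E, t2) (perp U *m E, t2) =
    \tr (V B *m E^T *m E) + \tr (W B *m t2 *m W B *m t2).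
  rewrite /= /total_metric /= trmx_mul !mulmxA -(mulmxA _ (perp U)^T) KK mulmx1.
  by [].
(* The three blocks of the image are mutually orthogonal, and the two off-diagonal ones have the
   same norm, that of [E *m B]; this is the origin of the 2 in the bounds. *)
have -> : metric M X (Lmap (U, B) (perp U *m E, t2)) (Lmap (U, B) (perp U *m E, t2)) =
    2 * \tr (E *m B *m (E *m B)^T) + \tr (t2 *m t2^T).
  have LT : (Lmap (U, B) (perp U *m E, t2))^T = Lmap (U, B) (perp U *m E, t2).
    exact: (Lmap_sym U hB (theta := (perp U *m E, t2)) tT).
  rewrite /= LT.
  rewrite /Lmap /= !trmx_mul BT tT.
  rewrite !mulmxDr !mulmxDl !mulmxA.
  have z1 m (A : 'M[R]_(m, _)) : A *m U^T *m perp U = 0 by rewrite -mulmxA UK mulmx0.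
  have z2 m (A : 'M[R]_(m, _)) : A *m (perp U)^T *m U = 0 by rewrite -mulmxA KU mulmx0.
  have o1 m (A : 'M[R]_(m, _)) : A *m U^T *m U = A by rewrite -mulmxA hU mulmx1.
  have o2 m (A : 'M[R]_(m, _)) : A *m (perp U)^T *m perp U = A by rewrite -mulmxA KK mulmx1.
  rewrite !(z1, z2, o1, o2) !mul0mx ?add0r ?addr0 !mxtraceD.
  have -> : \tr (U *m t2 *m B *m E^T *m (perp U)^T) = 0.
    by rewrite -!mulmxA mxtrace_mulC -!mulmxA KU !mulmx0 mxtrace0.
  have -> : \tr (perp U *m E *m B *m t2 *m U^T) = 0.
    by rewrite -!mulmxA mxtrace_mulC -!mulmxA UK !mulmx0 mxtrace0.
  have -> : \tr (perp U *m E *m B *m B *m E^T *m (perp U)^T) = \tr (E *m B *m B *m E^T).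
    by rewrite -!mulmxA mxtrace_mulC -!mulmxA KK mulmx1.
  have -> : \tr (U *m t2 *m t2 *m U^T) = \tr (t2 *m t2).
    by rewrite -!mulmxA mxtrace_mulC -!mulmxA hU mulmx1.
  have -> : \tr (U *m B *m E^T *m E *m B *m U^T) = \tr (E *m B *m B *m E^T).
    rewrite -!mulmxA mxtrace_mulC -!mulmxA hU mulmx1.
    by rewrite mulmxA mxtrace_mulC !mulmxA.
  ring.
have a1 : a <= sigma r (invmx (W B)) ^+ 2 by rewrite /a ge_min lexx.
have a2 : a <= 2 * sigma r (invmx (sqrtmx (V B)) *m B) ^+ 2 by rewrite /a ge_min lexx orbT.
have b1 : sigma 1 (invmx (W B)) ^+ 2 <= b by rewrite /b le_max lexx.
have b2 : 2 * sigma 1 (invmx (sqrtmx (V B)) *m B) ^+ 2 <= b by rewrite /b le_max lexx orbT.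
exact: weighted_bounds x0 y0 w1 w2 v1 v2 a1 a2 b1 b2.
Qed.

Lemma hess_spectra :
  let a := Num.min (sigma r (invmx (W B)) ^+ 2)
                   (2 * sigma r (invmx (sqrtmx (V B)) *m B) ^+ 2) in
  let b := Num.max (sigma 1 (invmx (W B)) ^+ 2)
                   (2 * sigma 1 (invmx (sqrtmx (V B)) *m B) ^+ 2) in
  let spec_f := op_eigenvalues (tspace M X) (rhess M f X) in
  let spec_h := op_eigenvalues (horizontal (U, B)) (rhess Mq (hq f) (U, B)) in
  size spec_h = n /\ forall i, (i < n)%N ->
    sandwiched (nth 0 spec_h i) (a * nth 0 spec_f i) (b * nth 0 spec_f i).
Proof.
move=> a b spec_f spec_h.
(* In the basis [e] and its image [eL] both Hessians have the same matrix of values; only the Gram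
   matrices of the two inner products differ. *)
pose e := horizontal_basis; pose eL i := Lmap (U, B) (e i).
have eb : set_bij [set: 'rV[R]_n] (tspace Mq (U, B)) (lincomb e).
  by apply: (eq_set_bij _ horizontal_bij) => c; exact: horizontal_vectorE.
have LE c : lincomb eL c = Lmap (U, B) (lincomb e c).
  have L0 : Lmap (U, B) 0 = 0.
    by have := LmapP (U, B) (-1) 0 0; rewrite scaler0 addr0 scaleN1r addNr.
  rewrite /lincomb; elim: (index_enum _) => [|i s IH]; first by rewrite !big_nil L0.
  by rewrite !big_cons LmapP IH.
have eLb : set_bij [set: 'rV[R]_n] (tspace M X) (lincomb eL).
  apply: (eq_set_bij _ (set_bij_comp eb Lmap_bij)) => c; exact/esym/LE.
pose Q s t := hess_form f U B (Lmap (U, B) s) (Lmap (U, B) t).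
have QC s t : Q s t = Q t s by exact: hess_formC.
have Ql z c s t : Q z (c *: s + t) = c * Q z s + Q z t.
  by rewrite /Q LmapP; exact: hess_form_lin.
have QfC s t : hess_form f U B s t = hess_form f U B t s by exact: hess_formC.
have Qfl z c s t : hess_form f U B z (c *: s + t) =
    c * hess_form f U B z s + hess_form f U B z t by exact: hess_form_lin.
have gq := inner_Mq U hV hW; have ge := inner_Me rp hU hB.
have H1 := op_eigenvalues_pencil gq QC Ql rhess_MqP eb.
have H2 := op_eigenvalues_pencil ge QfC Qfl rhess_MeP eLb.
apply: (pencil_sandwich _ _ _ _ H1 H2).
- by apply/matrixP => i j; rewrite !mxE QC.
- exact: gram_spd gq eb.
- exact: gram_spd ge eLb.
- move=> x; rewrite (inner_gram_qform _ gq) (inner_gram_qform _ ge) LE.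
  have [eE _ _] := eb.
  by have [h1 h2] := metric_bounds (eE x I); apply/andP.
Qed.

End Spectra.

Theorem theorem4 (R : realType) (p r : nat)
  (f : 'M[R]_p -> R) (V W : 'M[R]_r -> 'M[R]_r)
  (U : 'M[R]_(p, r)) (B : 'M[R]_r)
  (hr : (1 <= r <= p)%N)
  (hf : Ck 2 setT f) (hfT : forall X : 'M[R]_p, f X = f X^T)
  (hV : smooth_spd_weight V) (hW : smooth_spd_weight W)
  (hVinv : forall B' O : 'M[R]_r, spd B' -> orthogonal O ->
     V B' = O *m V (O^T *m B' *m O) *m O^T)
  (hWinv : forall B' O : 'M[R]_r, spd B' -> orthogonal O ->
     W B' = O *m W (O^T *m B' *m O) *m O^T)
  (hU : stiefel U) (hB : spd B) :
  let X := U *m B *m U^T in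
  let M := Me R p r in
  let Mq := Mq2 p V W in
  let h := hq f in
  let gradf := rgrad M f X in
  let gradh := rgrad Mq h (U, B) in
  let lambda_f := nth 0 (op_eigenvalues (tspace M X) (rhess M f X)) in
  let spec_h := op_eigenvalues (horizontal (U, B)) (rhess Mq h (U, B)) in
  let dim := (p * r - (r ^ 2 - r) %/ 2)%N in
  let VB_invsqrt := invmx (sqrtmx (V B)) in
  [/\ gradf = 2^-1 *: (gradh.1 *m V B *m invmx B *m U^T)
              + 2^-1 *: (gradh.1 *m V B *m invmx B *m U^T)^T
              + U *m W B *m gradh.2 *m W B *m U^T,
      gradh = (2 *: (Pperp U *m gradf *m U *m B *m invmx (V B)),
               invmx (W B) *m U^T *m gradf *m U *m invmx (W B))
    & gradh = 0 ->
      [/\ forall theta, horizontal (U, B) theta ->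
            rhess_form Mq h (U, B) theta theta =
            rhess_form M f X (Lmap (U, B) theta) (Lmap (U, B) theta),
          size spec_h = dim
        & forall i : nat, (i < dim)%N ->
            sandwiched (nth 0 spec_h i)
              (Num.min (sigma r (invmx (W B)) ^+ 2)
                       (2 * sigma r (VB_invsqrt *m B) ^+ 2) * lambda_f i)
              (Num.max (sigma 1 (invmx (W B)) ^+ 2)
                       (2 * sigma 1 (VB_invsqrt *m B) ^+ 2) * lambda_f i)]].
Proof.
have /andP[r0 rp] := hr; have hVB := hV.1 B hB; have hWB := hW.1 B hB.
have grad1 := rgrad_Me_of_Mq rp hf hfT hVB hWB hU hB.
have grad2 := rgrad_Mq_of_Me rp hf hfT hVB hWB hU hB.
move=> X M Mq h gradf gradh lambda_f spec_h dim VB_invsqrt; split=> // gradh0.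
(* The first gradient formula carries stationarity from the quotient to the embedded manifold. *)
have gradf0 : rgrad M f X = 0.
  apply: (etrans grad1); rewrite -/h -/Mq -/gradh gradh0 /=.
  by rewrite !(mul0mx, mulmx0) trmx0 !scaler0 !addr0.
have [sz sandwich] := hess_spectra r0 rp hf hfT hV hW hU hB gradf0.
rewrite card_index// -/dim in sz sandwich.
split.
- move=> theta; exact: (rhess_form_eq rp hf hfT hV hW hU hB gradf0).
- exact: sz.
- exact: sandwich.
Qed.
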